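(* Let $\lambda>0$, let $B=\begin{pmatrix}a&b\\c&d\end{pmatrix}$ be a real $2\times2$ matrix and let $\varphi:\mathbb{R}^2\to\mathbb{R}$ be a homogeneous polynomial of even degree $2n\ge2$. Suppose that $\varphi$ and $B$ are of opposite sign. Then the qualitative phase portrait of $$\dot v=\lambda v+\varphi(v)Bv,\qquad v\in\mathbb{R}^2,$$ (up to orientation of the orbits) is of one of the following four types. In all of them the origin is a source and there is a globally attracting invariant circle surrounding the origin; the dynamics on the circle at infinity of the Poincaré disc coincides with that on the invariant circle, and: (I) the invariant circle is a limit cycle (it contains no equilibria); (II) there are exactly four equilibria on the invariant circle, alternately attracting and repelling within the circle; (III) there are exactly two equilibria on the invariant circle, both saddle-nodes; (IV) every point of the invariant circle is an equilibrium.
   Context: The polynomial $\varphi$ is positive (negative) definite if $\varphi(v)>0$ ($\varphi(v)<0$) for all $v\ne(0,0)$. The matrix $B$ is positive (negative) definite if the binary quadratic form $(x,y)B(x,y)^T$ is positive (negative) definite ($B$ need not be symmetric). $\varphi$ and $B$ are of opposite sign if $\varphi$ is positive definite and $B$ is negative definite, or $\varphi$ is negative definite and $B$ is positive definite. In this case $Q(v)=\varphi(v)Bv$ satisfies $\langle v,Q(v)\rangle<0$ for all $v\neq 0$, and the system has a unique invariant topological circle in $\mathbb{R}^2\setminus\{0\}$, surrounding the origin and attracting all trajectories with nonzero initial condition. The flow on this circle and the flow on the circle at infinity are topologically equivalent to $\dot\theta=g(\theta)$, $g(\theta)=\langle(-\sin\theta,\cos\theta),Q(\cos\theta,\sin\theta)\rangle$.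 A saddle-node is an equilibrium corresponding to an isolated zero of $g$ at which $g$ does not change sign. *)

(* Defs.v *)
From Stdlib Require Import Reals ZArith Lra Lia.
From Coquelicot Require Import Coquelicot.
Open Scope R_scope.

Definition plane : Type := (R * R)%type.

Definition dot (v w : plane) : R := fst v * fst w + snd v * snd w.

Definition mat_app (B : @matrix R 2 2) (v : plane) : plane :=
  (coeff_mat 0 B 0 0 * fst v + coeff_mat 0 B 0 1 * snd v,
   coeff_mat 0 B 1 0 * fst v + coeff_mat 0 B 1 1 * snd v).

(** The zero polynomial is homogeneous of every degree here; definiteness
    excludes it wherever the degree matters. *)
Definition homogeneous_poly (m : nat) (phi : plane -> R) : Prop :=
  exists c : nat -> R, forall x y : R,
    phi (x, y) = sum_f_R0 (fun i => c i * x ^ i * y ^ (m - i)) m.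

Definition positive_definite (f : plane -> R) : Prop :=
  forall v : plane, v <> (0, 0) -> 0 < f v.

Definition negative_definite (f : plane -> R) : Prop :=
  forall v : plane, v <> (0, 0) -> f v < 0.

Definition quad_form (B : @matrix R 2 2) (v : plane) : R := dot v (mat_app B v).

Definition opposite_sign (phi : plane -> R) (B : @matrix R 2 2) : Prop :=
  (positive_definite phi /\ negative_definite (quad_form B)) \/
  (negative_definite phi /\ positive_definite (quad_form B)).

Definition nonlinearity (B : @matrix R 2 2) (phi : plane -> R) (v : plane) : plane :=
  scal (phi v) (mat_app B v).

Definition vector_field (lambda : R) (B : @matrix R 2 2) (phi : plane -> R) (v : plane) : plane :=
  plus (scal lambda v) (nonlinearity B phi v).

Definition angular (B : @matrix R 2 2) (phi : plane -> R) (theta : R) : R :=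
  dot (- sin theta, cos theta) (nonlinearity B phi (cos theta, sin theta)).

Definition solution (F : plane -> plane) (J : R -> Prop) (v : R -> plane) : Prop :=
  forall t : R, J t -> is_derive v t (F (v t)).

Definition global_solution (F : plane -> plane) (v : R -> plane) : Prop :=
  solution F (fun _ => True) v.

Definition forward_solution (F : plane -> plane) (p : plane) (v : R -> plane) : Prop :=
  v 0 = p /\ solution F (fun t => 0 <= t) v.

Definition same_orbit (F : plane -> plane) (p q : plane) : Prop :=
  exists (v : R -> plane) (alpha beta t : R),
    alpha < 0 < beta /\ alpha < t < beta /\
    solution F (fun s => alpha < s < beta) v /\ v 0 = p /\ v t = q.

(** Asymptotic stability of the equilibrium [p] for the flow restricted to the
    invariant set [S]. *)
Definition attracting_in (S : plane -> Prop) (F : plane -> plane) (p : plane) : Prop :=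
  F p = (0, 0) /\
  (forall eps : posreal, exists delta : posreal, forall q v,
     S q -> ball p delta q -> forward_solution F q v ->
     forall t, 0 <= t -> ball p eps (v t)) /\
  (exists delta : posreal, forall q, S q -> ball p delta q ->
     (exists v, forward_solution F q v) /\
     (forall v, forward_solution F q v ->
        filterlim v (Rbar_locally p_infty) (locally p))).

Definition repelling_in (S : plane -> Prop) (F : plane -> plane) (p : plane) : Prop :=
  attracting_in S (fun v => opp (F v)) p.

Definition source (F : plane -> plane) (p : plane) : Prop :=
  repelling_in (fun _ => True) F p.

Definition circle_param (gamma : R -> plane) (C : plane -> Prop) : Prop :=
  (forall t, continuous gamma t) /\
  (forall s t, gamma s = gamma t <-> exists k : Z, t = s + 2 * PI * IZR k) /\
  (forall p, C p <-> exists t, gamma t = p).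

Definition topological_circle (C : plane -> Prop) : Prop :=
  exists gamma, circle_param gamma C.

(** [p] lies in a bounded (path) component of the complement of [C]. *)
Definition surrounds (C : plane -> Prop) (p : plane) : Prop :=
  ~ C p /\
  exists M : R, forall sigma : R -> plane,
    (forall t, continuous sigma t) -> sigma 0 = p ->
    (forall t, 0 <= t <= 1 -> ~ C (sigma t)) ->
    dot (sigma 1) (sigma 1) <= M.

Definition invariant (F : plane -> plane) (C : plane -> Prop) : Prop :=
  (forall p, C p -> exists v, global_solution F v /\ v 0 = p) /\
  (forall p q, C p -> same_orbit F p q -> C q).

Definition attracts_all_nonzero (F : plane -> plane) (C : plane -> Prop) : Prop :=
  forall p, p <> (0, 0) ->
    (exists v, forward_solution F p v) /\
    (forall v, forward_solution F p v ->
       forall eps : posreal, exists T : R, forall t, T <= t ->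
         exists q, C q /\ ball q eps (v t)).

Definition homeomorphism (S T : plane -> Prop) (h : plane -> plane) : Prop :=
  continuous_on S h /\ (forall p, S p -> T (h p)) /\
  exists k : plane -> plane,
    continuous_on T k /\ (forall q, T q -> S (k q)) /\
    (forall p, S p -> k (h p) = p) /\ (forall q, T q -> h (k q) = q).

(** Orientation of the orbits is respected: [tau] is an increasing change of time. *)
Definition flow_equivalent (F : plane -> plane) (S : plane -> Prop)
    (G : plane -> plane) (T : plane -> Prop) : Prop :=
  exists h, homeomorphism S T h /\
    forall v, global_solution F v -> S (v 0) ->
      exists (w : R -> plane) (tau : R -> R),
        global_solution G w /\
        (forall s t, s < t -> tau s < tau t) /\
        (forall t, continuous tau t) /\
        (forall r, exists t, tau t = r) /\
        (forall t, h (v t) = w (tau t)).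

(** Only the partitions into orbits are compared, so the orientation of the
    orbits plays no role. *)
Definition same_phase_portrait (S : plane -> Prop) (F G : plane -> plane) : Prop :=
  exists h, homeomorphism S S h /\
    forall p q, S p -> S q -> (same_orbit F p q <-> same_orbit G (h p) (h q)).

Definition poincare_disc (w : plane) : Prop := dot w w <= 1.

Definition circle_at_infinity (w : plane) : Prop := dot w w = 1.

(** Central projection of the plane [z = 1] onto the open upper unit hemisphere,
    followed by orthogonal projection onto the open unit disc. *)
Definition poincare_chart (v : plane) : plane :=
  scal (/ sqrt (1 + dot v v)) v.

(** The field [vector_field lambda B phi] of degree [2 n + 1], transported by
    [poincare_chart], multiplied by [z ^ (2 n)] with [z = sqrt (1 - |w|^2)], and
    extended to [|w| = 1]; see [poincare_chart_solution]. *)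
Definition poincare_field (lambda : R) (B : @matrix R 2 2) (phi : plane -> R) (n : nat)
    (w : plane) : plane :=
  plus (scal (lambda * (1 - dot w w) ^ (n + 1)) w)
       (minus (nonlinearity B phi w) (scal (dot w (nonlinearity B phi w)) w)).

Lemma homogeneous_poly_scal (m : nat) (phi : plane -> R) (k : R) (v : plane) :
  homogeneous_poly m phi -> phi (scal k v) = k ^ m * phi v.
Proof.
  intros [c Hc]; destruct v as [x y].
  change (phi (k * x, k * y) = k ^ m * phi (x, y)).
  rewrite !Hc, scal_sum; apply sum_eq; intros i Hi.
  rewrite !Rpow_mult_distr.
  replace (k ^ m) with (k ^ i * k ^ (m - i)) by (rewrite <- pow_add; f_equal; lia).
  ring.
Qed.

Lemma is_derive_plane (f g : R -> R) (t a b : R) :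
  is_derive f t a -> is_derive g t b ->
  is_derive (fun s => (f s, g s) : plane) t (a, b).
Proof.
  intros Hf Hg.
  apply (filterdiff_ext_lin _ (fun y : R => (y * a, y * b) : plane)).
  2: reflexivity.
  apply (filterdiff_comp'_2 f g (fun x y : R => (x, y) : plane) t
           (fun y : R => y * a) (fun y : R => y * b) (fun x y : R => (x, y) : plane)).
  - exact Hf.
  - exact Hg.
  - apply (filterdiff_ext (fun u : plane => u)).
    + intros [x y]; reflexivity.
    + apply (filterdiff_ext_lin _ (fun u : plane => u)).
      * apply filterdiff_id.
      * intros [x y]; reflexivity.
Qed.

Lemma is_derive_coords (v : R -> plane) (t : R) (l : plane) :
  is_derive v t l ->
  is_derive (fun s => fst (v s)) t (fst l) /\ is_derive (fun s => snd (v s)) t (snd l).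
Proof.
  intros H; split.
  - apply (filterdiff_comp' v (fun u : plane => fst u) t (fun y : R => scal y l : plane)
             (fun u : plane => fst u) H).
    apply filterdiff_linear, is_linear_fst.
  - apply (filterdiff_comp' v (fun u : plane => snd u) t (fun y : R => scal y l : plane)
             (fun u : plane => snd u) H).
    apply filterdiff_linear, is_linear_snd.
Qed.

Lemma poincare_chart_solution (lambda : R) (B : @matrix R 2 2) (phi : plane -> R)
    (n : nat) (v : R -> plane) (t : R) :
  homogeneous_poly (2 * n) phi ->
  is_derive v t (vector_field lambda B phi (v t)) ->
  is_derive (fun s => poincare_chart (v s)) t
    (scal ((1 + dot (v t) (v t)) ^ n)
       (poincare_field lambda B phi n (poincare_chart (v t)))).
Proof.
  intros Hphi Hv.
  destruct (is_derive_coords _ _ _ Hv) as [Hx Hy].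
  set (x := fun s => fst (v s)) in *; set (y := fun s => snd (v s)) in *.
  set (D := 1 + dot (v t) (v t)).
  assert (HD : 0 < D) by (unfold D, dot; nra).
  set (S := sqrt D).
  assert (HS : 0 < S) by (apply sqrt_lt_R0, HD).
  assert (HSD : S * S = D) by (apply sqrt_sqrt; lra).
  set (P := phi (v t)).
  assert (HP : phi (poincare_chart (v t)) = / D ^ n * P).
  { unfold poincare_chart; rewrite (homogeneous_poly_scal _ _ _ _ Hphi); fold D S P.
    rewrite pow_mult; replace ((/ S) ^ 2) with (/ D) by (rewrite <- HSD; field; lra).
    now rewrite pow_inv. }
  assert (Hz : 1 - dot (poincare_chart (v t)) (poincare_chart (v t)) = / D).
  { unfold poincare_chart; fold D S.
    replace (dot (scal (/ S) (v t)) (scal (/ S) (v t))) with (/ (S * S) * (D - 1)).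
    - rewrite HSD; field; lra.
    - unfold D, dot, scal; simpl; unfold prod_scal, scal; simpl; unfold mult; simpl.
      field; lra. }
  assert (HDn : D ^ n <> 0) by (apply pow_nonzero; lra).
  set (m1 := coeff_mat 0 B 0 0 * x t + coeff_mat 0 B 0 1 * y t).
  set (m2 := coeff_mat 0 B 1 0 * x t + coeff_mat 0 B 1 1 * y t).
  assert (Hx' : is_derive x t (lambda * x t + P * m1)) by exact Hx.
  assert (Hy' : is_derive y t (lambda * y t + P * m2)) by exact Hy.
  clear Hx Hy.
  assert (HDe : D = 1 + (x t * x t + y t * y t)) by reflexivity.
  assert (Hr : is_derive (fun s => / sqrt (1 + (x s * x s + y s * y s))) t
     (- (x t * (lambda * x t + P * m1) + y t * (lambda * y t + P * m2)) / (D * S))).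
  { auto_derive.
    - repeat split; try (eexists; eassumption); fold (x t) (y t).
      + rewrite <- HDe; lra.
      + rewrite <- HDe; fold S; lra.
    - change (fun s => x s) with x; change (fun s => y s) with y.
      rewrite (is_derive_unique _ _ _ Hx'), (is_derive_unique _ _ _ Hy').
      rewrite <- HDe; fold S; rewrite <- HSD; field; lra. }
  assert (Hval : scal (D ^ n) (poincare_field lambda B phi n (poincare_chart (v t))) =
     (lambda * x t / (D * S) + P * m1 / S - (x t * m1 + y t * m2) / D * P * x t / S,
      lambda * y t / (D * S) + P * m2 / S - (x t * m1 + y t * m2) / D * P * y t / S)).
  { unfold poincare_field, nonlinearity; rewrite Hz, HP.
    unfold poincare_chart; fold D S.
    rewrite Nat.add_1_r; simpl pow.
    unfold m1, m2, x, y, dot, mat_app, minus, plus, opp, scal; simpl.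
    unfold prod_scal, prod_plus, prod_opp, minus, plus, opp, scal; simpl.
    unfold mult; simpl.
    rewrite pow_inv; rewrite <- HSD in HDn |- *.
    f_equal; field; split; lra || exact HDn. }
  rewrite Hval.
  apply (is_derive_ext (fun s =>
    (/ sqrt (1 + (x s * x s + y s * y s)) * x s,
     / sqrt (1 + (x s * x s + y s * y s)) * y s) : plane)).
  { reflexivity. }
  apply is_derive_plane.
  - evar_last; [apply (is_derive_mult _ _ _ _ _ Hr Hx'); exact Rmult_comm|].
    unfold plus, mult; simpl; rewrite <- HDe; fold S.
    rewrite <- HSD; field_simplify_eq; [|lra].
    replace (S ^ 2) with (1 + (x t * x t + y t * y t)) by (rewrite <- HDe, <- HSD; ring).
    ring.
  - evar_last; [apply (is_derive_mult _ _ _ _ _ Hr Hy'); exact Rmult_comm|].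
    unfold plus, mult; simpl; rewrite <- HDe; fold S.
    rewrite <- HSD; field_simplify_eq; [|lra].
    replace (S ^ 2) with (1 + (x t * x t + y t * y t)) by (rewrite <- HDe, <- HSD; ring).
    ring.
Qed.

Definition equilibrium (F : plane -> plane) (p : plane) : Prop := F p = (0, 0).

Definition saddle_node (g : R -> R) (p : plane) : Prop :=
  exists rho theta : R,
    0 < rho /\ p = (rho * cos theta, rho * sin theta) /\ g theta = 0 /\
    exists eps : posreal,
      (forall s, 0 < Rabs (s - theta) < eps -> g s <> 0) /\
      ((forall s, Rabs (s - theta) < eps -> 0 <= g s) \/
       (forall s, Rabs (s - theta) < eps -> g s <= 0)).

Definition nonconstant_periodic (F : plane -> plane) (v : R -> plane) : Prop :=
  global_solution F v /\
  (exists T, 0 < T /\ forall t, v (t + T) = v t) /\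
  (exists t, v t <> v 0).

Definition limit_cycle (F : plane -> plane) (C : plane -> Prop) : Prop :=
  (exists v, nonconstant_periodic F v /\ forall p, C p <-> exists t, v t = p) /\
  (exists U : plane -> Prop, open U /\ (forall p, C p -> U p) /\
     forall v, nonconstant_periodic F v -> (forall t, U (v t)) -> forall t, C (v t)).

Inductive portrait_type : Set :=
  LimitCycle | FourEquilibria | TwoSaddleNodes | CircleOfEquilibria.

Definition circle_dynamics (T : portrait_type) (F : plane -> plane) (g : R -> R)
    (C : plane -> Prop) : Prop :=
  match T with
  | LimitCycle =>
      limit_cycle F C /\ forall p, C p -> ~ equilibrium F p
  | FourEquilibria =>
      exists (gamma : R -> plane) (t1 t2 t3 t4 : R),
        circle_param gamma C /\
        t1 < t2 /\ t2 < t3 /\ t3 < t4 /\ t4 < t1 + 2 * PI /\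
        (forall p, C p ->
           (equilibrium F p <->
            p = gamma t1 \/ p = gamma t2 \/ p = gamma t3 \/ p = gamma t4)) /\
        attracting_in C F (gamma t1) /\ repelling_in C F (gamma t2) /\
        attracting_in C F (gamma t3) /\ repelling_in C F (gamma t4)
  | TwoSaddleNodes =>
      exists p q, C p /\ C q /\ p <> q /\
        (forall r, C r -> (equilibrium F r <-> r = p \/ r = q)) /\
        saddle_node g p /\ saddle_node g q
  | CircleOfEquilibria =>
      forall p, C p -> equilibrium F p
  end.

Definition has_type (T : portrait_type) (lambda : R) (B : @matrix R 2 2)
    (phi : plane -> R) (n : nat) : Prop :=
  let F := vector_field lambda B phi in
  source F (0, 0) /\
  exists C : plane -> Prop,
    topological_circle C /\ invariant F C /\ surrounds C (0, 0) /\
    attracts_all_nonzero F C /\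
    flow_equivalent F C (poincare_field lambda B phi n) circle_at_infinity /\
    circle_dynamics T F (angular B phi) C.

(* Main.v *)
(** Changing the sign of both [phi] and [B], let [phi > 0] and [B] be negative
    definite. A solution has the form [v t = exp (lambda t) exp (s t B) (v 0)] with
    [s' = phi v], and the function [K], [2 n lambda] times the integral of
    [1 / phi (exp (t B) v)] over [t <= 0], is homogeneous of degree [- 2 n] and satisfies
    [K (exp (s B) v)' = 2 n lambda / phi (exp (s B) v)]. Hence [K - 1] decays like
    [exp (- 2 n lambda t)] along solutions, and [K = 1] is the invariant circle. On it the
    flow is that of [exp (s B)] on directions, so its equilibria are the invariant rays of
    [B], and the discriminant of [B] decides the type.

    For the phase portraits, an orbit in the disc is described by its direction [u],
    moved by [exp (s B)], and by [1 - 1 / K], divided by the factor by which [exp (s B)]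
    multiplies [K u]. Replacing [K] by any other clock of [exp (s B)] homogeneous of the
    same degree, in particular by a power of a norm adapted to [B], only moves directions
    along orbits; powers of [1 - 1 / K] absorb the degree. This leads to normal forms
    without parameters, one for each type. *)
Require Import Defs.
From Stdlib Require Import Reals Lra Lia Ranalysis5.
From Stdlib Require Import Classical ClassicalEpsilon FunctionalExtensionality.
From Coquelicot Require Import Coquelicot.
Open Scope R_scope.
Set Bullet Behavior "Strict Subproofs".

(** * Calculus in one variable and continuity rules *)

(** No general theorem on existence or uniqueness of solutions enters. In the frame moving with the
    linear flow, a solution is constant up to an exponential factor, and inverting [K] along the
    linear flow produces the trajectories. The second half of the theorem compares systems with
    unrelated parameters, while [has_type] only asserts that some circle [C] exists. A topological
    circle is closed, so an attracting one contains every nonzero equilibrium; counting these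
    recovers the type of the matrix, and [algebraic_type] mediates between portrait and matrix.
    Orbits of the compactified field have to be followed up to the circle at infinity, where the
    conserved quantity has a pole. With its denominators cleared it becomes a relation that is
    correct on the boundary too and no longer mentions time. From there on only relations on the
    disc are compared, and the conjugacies split into changes of radius and changes of direction;
    continuity of their inverses comes from compactness. *)

Section ContinuityRules.

Context {U : UniformSpace}.
Implicit Types (f g : U -> R) (x : U).

Lemma cont_const (r : R) x : continuous (fun _ : U => r) x.
Proof. apply continuous_const. Qed.

Lemma cont_add f g x :
  continuous f x -> continuous g x -> continuous (fun y => f y + g y) x.
Proof. intros Hf Hg; exact (continuous_plus f g x Hf Hg). Qed.

Lemma cont_opp f x : continuous f x -> continuous (fun y => - f y) x.
Proof. intros Hf; exact (continuous_opp f x Hf). Qed.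

Lemma cont_sub f g x :
  continuous f x -> continuous g x -> continuous (fun y => f y - g y) x.
Proof. intros Hf Hg; exact (continuous_minus f g x Hf Hg). Qed.

Lemma cont_mul f g x :
  continuous f x -> continuous g x -> continuous (fun y => f y * g y) x.
Proof. intros Hf Hg; exact (continuous_mult f g x Hf Hg). Qed.

Lemma cont_pow f k x : continuous f x -> continuous (fun y => f y ^ k) x.
Proof.
  intros Hf; induction k as [|k IH]; simpl.
  - apply cont_const.
  - now apply cont_mul.
Qed.

Lemma cont_real (h : R -> R) f x :
  continuous f x -> continuous h (f x) -> continuous (fun y => h (f y)) x.
Proof. intros Hf Hh; exact (continuous_comp f h x Hf Hh). Qed.

Lemma cont_inv f x : continuous f x -> f x <> 0 -> continuous (fun y => / f y) x.
Proof.
  intros Hf H0; apply (cont_real Rinv f x Hf).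
  apply continuity_pt_filterlim, continuity_pt_inv; auto.
  apply continuity_pt_id.
Qed.

Lemma cont_div f g x :
  continuous f x -> continuous g x -> g x <> 0 -> continuous (fun y => f y / g y) x.
Proof. intros Hf Hg H0; apply cont_mul; auto; now apply cont_inv. Qed.

Lemma cont_exp f x : continuous f x -> continuous (fun y => exp (f y)) x.
Proof.
  intros Hf; apply (cont_real exp f x Hf).
  apply continuity_pt_filterlim, derivable_continuous_pt, derivable_pt_exp.
Qed.

Lemma cont_sin f x : continuous f x -> continuous (fun y => sin (f y)) x.
Proof. intros Hf; apply (cont_real sin f x Hf), continuity_pt_filterlim, continuity_sin. Qed.

Lemma cont_cos f x : continuous f x -> continuous (fun y => cos (f y)) x.
Proof. intros Hf; apply (cont_real cos f x Hf), continuity_pt_filterlim, continuity_cos. Qed.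

Lemma cont_ln f x : continuous f x -> 0 < f x -> continuous (fun y => ln (f y)) x.
Proof.
  intros Hf H0; apply (cont_real ln f x Hf), continuity_pt_filterlim, derivable_continuous_pt.
  exists (/ f x); now apply derivable_pt_lim_ln.
Qed.

Lemma cont_sqrt f x : continuous f x -> continuous (fun y => sqrt (f y)) x.
Proof. intros Hf; apply (cont_real sqrt f x Hf), continuous_sqrt. Qed.

Lemma cont_fst (f : U -> plane) x : continuous f x -> continuous (fun y => fst (f y)) x.
Proof.
  intros Hf; apply (continuous_comp f (fun p : plane => fst p)); auto.
  destruct (f x); apply continuous_fst.
Qed.

Lemma cont_snd (f : U -> plane) x : continuous f x -> continuous (fun y => snd (f y)) x.
Proof.
  intros Hf; apply (continuous_comp f (fun p : plane => snd p)); auto.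
  destruct (f x); apply continuous_snd.
Qed.

Lemma cont_pair f g x :
  continuous f x -> continuous g x -> continuous (fun y => (f y, g y) : plane) x.
Proof.
  intros Hf Hg; apply (continuous_comp_2 f g (fun a b : R => (a, b) : plane)); auto.
  apply (continuous_ext (fun p : plane => p)).
  - now intros [? ?].
  - apply continuous_id.
Qed.

Lemma cont_id_fst (p : plane) : continuous (fun q : plane => fst q) p.
Proof. destruct p; apply continuous_fst. Qed.

Lemma cont_id_snd (p : plane) : continuous (fun q : plane => snd q) p.
Proof. destruct p; apply continuous_snd. Qed.

End ContinuityRules.

(** Structural rules only: nonvanishing of divisors and positivity under [ln] are left as
    subgoals. *)
Ltac cont_step :=
  match goal with
  | H : continuous ?f ?x |- continuous ?f ?x => exact H
  | H : forall t, continuous ?f t |- continuous ?f _ => apply H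
  | |- continuous (fun _ => ?r) _ => apply continuous_const
  | |- continuous (fun y => y) _ => apply continuous_id
  | |- continuous (fun y => fst y) _ => apply cont_id_fst
  | |- continuous (fun y => snd y) _ => apply cont_id_snd
  | |- continuous (fun y => @?f y + @?g y) ?x => apply (cont_add f g x)
  | |- continuous (fun y => @?f y - @?g y) ?x => apply (cont_sub f g x)
  | |- continuous (fun y => @?f y * @?g y) ?x => apply (cont_mul f g x)
  | |- continuous (fun y => - @?f y) ?x => apply (cont_opp f x)
  | |- continuous (fun y => @?f y / @?g y) ?x => apply (cont_div f g x)
  | |- continuous (fun y => / @?f y) ?x => apply (cont_inv f x)
  | |- continuous (fun y => @?f y ^ ?k) ?x => apply (cont_pow f k x)
  | |- continuous (fun y => exp (@?f y)) ?x => apply (cont_exp f x)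
  | |- continuous (fun y => ln (@?f y)) ?x => apply (cont_ln f x)
  | |- continuous (fun y => sqrt (@?f y)) ?x => apply (cont_sqrt f x)
  | |- continuous (fun y => sin (@?f y)) ?x => apply (cont_sin f x)
  | |- continuous (fun y => cos (@?f y)) ?x => apply (cont_cos f x)
  | |- continuous (fun y => (@?f y, @?g y)) ?x => apply (cont_pair f g x)
  | |- continuous (fun y => fst (@?f y)) ?x => apply (cont_fst f x)
  | |- continuous (fun y => snd (@?f y)) ?x => apply (cont_snd f x)
  end.

Ltac cont := repeat cont_step.

Lemma derive_cont (f : R -> R) (x l : R) : is_derive f x l -> continuous f x.
Proof. intros H; apply (ex_derive_continuous f); now exists l. Qed.

Lemma derive_cont_plane (f : R -> plane) (x : R) (l : plane) :
  is_derive f x l -> continuous f x.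
Proof. intros H; apply (ex_derive_continuous f); now exists l. Qed.

Lemma cont_pt (f : R -> R) (x : R) : continuous f x -> continuity_pt f x.
Proof. intros H; now apply continuity_pt_filterlim. Qed.

Lemma is_derive_val (f : R -> R) (x a b : R) : is_derive f x a -> a = b -> is_derive f x b.
Proof. now intros H <-. Qed.

Lemma is_derive_val_plane (f : R -> plane) (x : R) (a b : plane) :
  is_derive f x a -> a = b -> is_derive f x b.
Proof. now intros H <-. Qed.

Lemma derive_mul (f g : R -> R) (x a b : R) :
  is_derive f x a -> is_derive g x b -> is_derive (fun y => f y * g y) x (a * g x + f x * b).
Proof. intros Hf Hg; apply (is_derive_mult f g x a b Hf Hg Rmult_comm). Qed.

Lemma derive_add (f g : R -> R) (x a b : R) :
  is_derive f x a -> is_derive g x b -> is_derive (fun y => f y + g y) x (a + b).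
Proof. intros Hf Hg; exact (is_derive_plus f g x a b Hf Hg). Qed.

Lemma derive_sub (f g : R -> R) (x a b : R) :
  is_derive f x a -> is_derive g x b -> is_derive (fun y => f y - g y) x (a - b).
Proof. intros Hf Hg; exact (is_derive_minus f g x a b Hf Hg). Qed.

Lemma derive_opp (f : R -> R) (x a : R) : is_derive f x a -> is_derive (fun y => - f y) x (- a).
Proof. intros Hf; exact (is_derive_opp f x a Hf). Qed.

Lemma derive_const (k x : R) : is_derive (fun _ : R => k) x 0.
Proof. exact (is_derive_const k x). Qed.

Lemma derive_id (x : R) : is_derive (fun y : R => y) x 1.
Proof. exact (is_derive_id x). Qed.

Lemma derive_scal (k : R) (f : R -> R) (x a : R) :
  is_derive f x a -> is_derive (fun y => k * f y) x (k * a).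
Proof. intros Hf; exact (is_derive_scal f x k a Hf). Qed.

Lemma derive_lin (k x : R) : is_derive (fun y => k * y) x k.
Proof. eapply is_derive_val; [apply derive_scal, derive_id|ring]. Qed.

Lemma derive_comp (f g : R -> R) (x a b : R) :
  is_derive f (g x) a -> is_derive g x b -> is_derive (fun y => f (g y)) x (b * a).
Proof. intros Hf Hg; exact (is_derive_comp f g x a b Hf Hg). Qed.

Lemma derive_comp_plane (f : R -> plane) (g : R -> R) (x b : R) (a : plane) :
  is_derive f (g x) a -> is_derive g x b -> is_derive (fun y => f (g y)) x (scal b a).
Proof. intros Hf Hg; exact (is_derive_comp f g x a b Hf Hg). Qed.

Lemma derive_ln (f : R -> R) (x a : R) :
  is_derive f x a -> 0 < f x -> is_derive (fun y => ln (f y)) x (a / f x).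
Proof.
  intros Hf H0; apply (derive_comp ln f x (/ f x) a); auto.
  now apply is_derive_ln.
Qed.

Lemma derive_exp (f : R -> R) (x a : R) :
  is_derive f x a -> is_derive (fun y => exp (f y)) x (a * exp (f x)).
Proof. intros Hf; apply (derive_comp exp f x (exp (f x)) a); auto; apply is_derive_exp. Qed.

Lemma derive_pow (f : R -> R) (k : nat) (x a : R) :
  is_derive f x a -> is_derive (fun y => f y ^ k) x (INR k * a * f x ^ pred k).
Proof. intros Hf; apply is_derive_pow; exact Hf. Qed.

(** [T] may be negative. *)
Lemma derive_zero_const (f : R -> R) (T : R) :
  (forall t, Rmin 0 T <= t <= Rmax 0 T -> is_derive f t 0) -> f T = f 0.
Proof.
  intros H; destruct (Rtotal_order 0 T) as [HT|[HT|HT]].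
  - symmetry; apply (eq_is_derive f 0 T); auto; intros t Ht; apply H.
    rewrite Rmin_left, Rmax_right; lra.
  - now rewrite HT.
  - apply (eq_is_derive f T 0); auto; intros t Ht; apply H.
    rewrite Rmin_right, Rmax_left; lra.
Qed.

Lemma primitive_exists (f : R -> R) :
  (forall t, continuous f t) -> exists F, F 0 = 0 /\ forall t, is_derive F t (f t).
Proof.
  intros Hf; exists (fun t => RInt f 0 t); split.
  - exact (RInt_point 0 f).
  - intros t; apply (is_derive_RInt f (fun t => RInt f 0 t) 0 t); auto.
    apply filter_forall; intros y.
    apply (RInt_correct (V := R_CompleteNormedModule)).
    apply (ex_RInt_continuous (V := R_CompleteNormedModule)); auto.
Qed.

Lemma derive_pos_incr (f df : R -> R) :
  (forall x, is_derive f x (df x)) -> (forall x, 0 < df x) ->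
  forall x y, x < y -> f x < f y.
Proof.
  intros Hf Hp x y Hxy.
  apply (incr_function f m_infty p_infty df); simpl; auto.
  intros z _ _; apply Rlt_gt, Hp.
Qed.

Lemma incr_lt_inv (f : R -> R) :
  (forall x y, x < y -> f x < f y) -> forall x y, f x < f y -> x < y.
Proof.
  intros H x y Hxy; destruct (Rtotal_order x y) as [h|[h|h]]; auto.
  - subst; lra.
  - apply H in h; lra.
Qed.

Lemma incr_inj (f : R -> R) :
  (forall x y, x < y -> f x < f y) -> forall x y, f x = f y -> x = y.
Proof.
  intros H x y Hxy; destruct (Rtotal_order x y) as [h|[h|h]]; auto; apply H in h; lra.
Qed.

(** Monotonicity of [f] squeezes [g] and gives its continuity at [y]; the classical rule for inverse
    functions does the rest. The inverse is required only near [y] because [clock_inverse] will be a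
    true inverse at positive arguments only. *)
Lemma inverse_derive (f df g : R -> R) (y : R) (eps : posreal) :
  (forall x, is_derive f x (df x)) -> (forall x, 0 < df x) ->
  (forall z, Rabs (z - y) < eps -> f (g z) = z) ->
  is_derive g y (/ df (g y)).
Proof.
  intros Hf Hp Hg.
  pose proof (derive_pos_incr f df Hf Hp) as Hincr.
  assert (Heps := cond_pos eps).
  assert (gincr : forall u v, Rabs (u - y) < eps -> Rabs (v - y) < eps -> u < v -> g u < g v).
  { intros u v Hu Hv Huv; apply (incr_lt_inv f Hincr); rewrite !Hg; auto. }
  assert (Hgc : continuity_pt g y).
  { apply cont_pt, filterlim_locally; intros e.
    assert (He := cond_pos e).
    assert (H1 : f (g y - e) < y).
    { rewrite <- (Hg y) at 2; [apply Hincr; lra|].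
      rewrite Rminus_diag, Rabs_R0; auto. }
    assert (H2 : y < f (g y + e)).
    { rewrite <- (Hg y) at 1; [apply Hincr; lra|].
      rewrite Rminus_diag, Rabs_R0; auto. }
    set (d := Rmin eps (Rmin (y - f (g y - e)) (f (g y + e) - y))).
    assert (Hd : 0 < d) by (unfold d; repeat apply Rmin_glb_lt; lra).
    exists (mkposreal d Hd); intros z Hz.
    assert (Hz' : Rabs (z - y) < d) by exact Hz.
    assert (Hdd : d <= eps /\ d <= y - f (g y - e) /\ d <= f (g y + e) - y).
    { unfold d; repeat split.
      - apply Rmin_l.
      - eapply Rle_trans; [apply Rmin_r|apply Rmin_l].
      - eapply Rle_trans; [apply Rmin_r|apply Rmin_r]. }
    assert (Hfz : f (g z) = z) by (apply Hg; lra).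
    apply Rabs_def2 in Hz'.
    apply Rabs_def1.
    - cut (g z < g y + e); [unfold minus, plus, opp; simpl; lra|].
      apply (incr_lt_inv f Hincr); lra.
    - cut (g y - e < g z); [unfold minus, plus, opp; simpl; lra|].
      apply (incr_lt_inv f Hincr); lra. }
  assert (Hy0 : Rabs (y - y) < eps) by (rewrite Rminus_diag, Rabs_R0; auto).
  assert (Hl : Rabs (y - eps / 2 - y) < eps) by (apply Rabs_def1; lra).
  assert (Hr : Rabs (y + eps / 2 - y) < eps) by (apply Rabs_def1; lra).
  assert (Hgl : g (y - eps / 2) < g y) by (apply gincr; auto; lra).
  assert (Hgr : g y < g (y + eps / 2)) by (apply gincr; auto; lra).
  assert (Prf : forall a, g (y - eps / 2) <= a <= g (y + eps / 2) -> derivable_pt f a).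
  { intros a _; exists (df a); apply is_derive_Reals, Hf. }
  assert (Pin : g (y - eps / 2) <= g y <= g (y + eps / 2)) by lra.
  assert (Hval : derive_pt f (g y) (Prf (g y) Pin) = df (g y)).
  { apply derive_pt_eq_0, is_derive_Reals, Hf. }
  pose proof (Hp (g y)) as Hpy.
  pose proof (derivable_pt_lim_recip_interv f g (y - eps / 2) (y + eps / 2) y Prf Hgc) as H.
  apply is_derive_Reals.
  replace (/ df (g y)) with (1 / derive_pt f (g y) (Prf (g y) Pin)).
  - apply H; try lra.
    intros z Hz; unfold comp, id; apply Hg, Rabs_def1; lra.
  - rewrite Hval; field; lra.
Qed.

(** The time change is onto because its speed [c] is bounded away from zero. *)
Lemma time_change (c : R -> R) (c0 : R) :
  (forall t, continuous c t) -> 0 < c0 -> (forall t, c0 <= c t) ->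
  exists tau iota : R -> R,
    tau 0 = 0 /\ iota 0 = 0 /\ (forall t, is_derive tau t (c t)) /\
    (forall x y, x < y -> tau x < tau y) /\
    (forall r, tau (iota r) = r) /\ (forall t, iota (tau t) = t) /\
    (forall r, is_derive iota r (/ c (iota r))).
Proof.
  intros Hc H0 Hc0.
  destruct (primitive_exists c Hc) as [tau [Ht0 Htau]].
  assert (Hpos : forall t, 0 < c t) by (intros t; specialize (Hc0 t); lra).
  pose proof (derive_pos_incr tau c Htau Hpos) as Hincr.
  assert (Hlow : forall x y, x < y -> c0 * (y - x) <= tau y - tau x).
  { intros x y Hxy.
    destruct (MVT_gen tau x y c) as [z [Hz He]].
    - intros; apply Htau.
    - intros; apply cont_pt, (derive_cont _ _ _ (Htau _)).
    - rewrite He; apply Rmult_le_compat_r; [lra|apply Hc0]. }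
  assert (Hsurj : forall r, exists t, tau t = r).
  { intros r.
    set (M := (Rabs r + 1) / c0).
    assert (HM : 0 < M).
    { unfold M; pose proof (Rabs_pos r); apply Rdiv_lt_0_compat; lra. }
    assert (HcM : c0 * M = Rabs r + 1) by (unfold M; field; lra).
    pose proof (Hlow 0 M HM) as H1.
    pose proof (Hlow (- M) 0 ltac:(lra)) as H2.
    rewrite Ht0 in *.
    destruct (IVT_gen tau (- M) M r) as [t [_ Ht]].
    - intros x; apply cont_pt, (derive_cont _ _ _ (Htau _)).
    - pose proof (Rle_abs r) as Ha; pose proof (Rle_abs (- r)) as Hb.
      rewrite Rabs_Ropp in Hb.
      rewrite Rmin_left, Rmax_right; nra.
    - now exists t. }
  set (iota := fun r => proj1_sig (constructive_indefinite_description _ (Hsurj r))).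
  assert (Hi : forall r, tau (iota r) = r).
  { intros r; unfold iota; now destruct (constructive_indefinite_description _ (Hsurj r)). }
  assert (Hi' : forall t, iota (tau t) = t).
  { intros t; apply (incr_inj tau Hincr), Hi. }
  exists tau, iota.
  assert (Hi0 : iota 0 = 0).
  { transitivity (iota (tau 0)); [now rewrite Ht0|apply Hi']. }
  refine (conj Ht0 (conj Hi0 (conj Htau (conj Hincr (conj Hi (conj Hi' _)))))).
  intros r; apply (inverse_derive tau c iota r (mkposreal 1 Rlt_0_1)); auto.
Qed.

(** The integrating factor [exp (- A t)] makes [f] constant. Only the sign of the factor [r] matters
    later: it shows that orbits do not cross the circle at infinity. *)
Lemma linear_scalar_ode (f a : R -> R) (T : R) :
  (forall t, continuous a t) ->
  (forall t, Rmin 0 T <= t <= Rmax 0 T -> is_derive f t (a t * f t)) ->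
  exists r, 0 < r /\ f T = r * f 0.
Proof.
  intros Ha Hf; destruct (primitive_exists a Ha) as [A [HA0 HA]].
  exists (exp (A T)); split; [apply exp_pos|].
  assert (H : exp (- A T) * f T = exp (- A 0) * f 0).
  { apply (derive_zero_const (fun t => exp (- A t) * f t)); intros t Ht.
    eapply is_derive_val.
    - apply derive_mul; [|now apply Hf].
      apply derive_exp, derive_opp, HA.
    - cbv beta; ring. }
  rewrite HA0, Ropp_0, exp_0 in H.
  replace (f 0) with (exp (- A T) * f T) by lra.
  rewrite <- Rmult_assoc, <- exp_plus, Rplus_opp_r, exp_0; ring.
Qed.

(** Precomposition with this retraction turns a coefficient known to be continuous on a compact
    interval into one continuous on the whole line, as [primitive_exists] and [time_change]
    demand. *)
Definition clamp (a b t : R) : R := Rmax a (Rmin b t).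

Lemma clamp_id (a b t : R) : a <= t <= b -> clamp a b t = t.
Proof. intros H; unfold clamp; rewrite Rmin_right, Rmax_right; lra. Qed.

Lemma clamp_bounds (a b t : R) : a <= b -> a <= clamp a b t <= b.
Proof.
  intros H; unfold clamp; split; [apply Rmax_l|].
  apply Rmax_lub; auto; apply Rmin_l.
Qed.

Lemma cont_clamp (a b t : R) : continuous (clamp a b) t.
Proof.
  apply filterlim_locally; intros e; exists e; intros s Hs.
  assert (Hs' : Rabs (s - t) < e) by exact Hs.
  change (Rabs (clamp a b s - clamp a b t) < e).
  eapply Rle_lt_trans; [|exact Hs'].
  unfold clamp, Rmax, Rmin; repeat destruct Rle_dec;
    unfold Rabs; repeat destruct Rcase_abs; lra.
Qed.

Lemma cont_comp_clamp {U : UniformSpace} (f : R -> U) (a b : R) :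
  a <= b -> (forall t, a <= t <= b -> continuous f t) ->
  forall t, continuous (fun s => f (clamp a b s)) t.
Proof.
  intros Hab Hf t; apply (continuous_comp (clamp a b) f).
  - apply cont_clamp.
  - apply Hf, clamp_bounds, Hab.
Qed.

(** * The plane and the closed disc *)

Definition sc (r : R) (v : plane) : plane := (r * fst v, r * snd v).

Lemma scal_sc (r : R) (v : plane) : scal r v = sc r v.
Proof. reflexivity. Qed.

Lemma sc_sc (r s : R) (v : plane) : sc r (sc s v) = sc (r * s) v.
Proof. unfold sc; simpl; f_equal; ring. Qed.

Lemma sc_1 (v : plane) : sc 1 v = v.
Proof. destruct v; unfold sc; simpl; f_equal; ring. Qed.

Lemma sc_inv (r : R) (v : plane) : r <> 0 -> sc (/ r) (sc r v) = v.
Proof. intros Hr; rewrite sc_sc, Rinv_l, sc_1; auto. Qed.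

Lemma plane_eq (v w : plane) : fst v = fst w -> snd v = snd w -> v = w.
Proof. destruct v, w; simpl; congruence. Qed.

Lemma sc_0 (r : R) : sc r (0, 0) = (0, 0).
Proof. unfold sc; simpl; f_equal; ring. Qed.

Lemma sc_neq0 (r : R) (v : plane) : r <> 0 -> v <> (0, 0) -> sc r v <> (0, 0).
Proof. intros Hr Hv H; apply Hv; rewrite <- (sc_inv r v Hr), H; apply sc_0. Qed.

Lemma dot_sc (r : R) (v : plane) : dot (sc r v) (sc r v) = r * r * dot v v.
Proof. unfold dot, sc; simpl; ring. Qed.

Lemma dot_nonneg (v : plane) : 0 <= dot v v.
Proof. unfold dot; nra. Qed.

Lemma dot_pos (v : plane) : v <> (0, 0) -> 0 < dot v v.
Proof.
  destruct v as [x y]; unfold dot; simpl; intros H.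
  destruct (Req_dec x 0); [destruct (Req_dec y 0)|]; try nra.
  subst; now destruct H.
Qed.

Lemma dot_pos_neq0 (v : plane) : 0 < dot v v -> v <> (0, 0).
Proof. intros H ->; unfold dot in H; simpl in H; lra. Qed.

Lemma dot_eq0 (v : plane) : dot v v = 0 -> v = (0, 0).
Proof.
  intros H; destruct (classic (v = (0, 0))) as [|Hv]; auto.
  apply dot_pos in Hv; lra.
Qed.

Lemma cont_dot {U : UniformSpace} (f g : U -> plane) (x : U) :
  continuous f x -> continuous g x -> continuous (fun y => dot (f y) (g y)) x.
Proof. intros; unfold dot; cont. Qed.

Lemma cont_sc {U : UniformSpace} (f : U -> R) (g : U -> plane) (x : U) :
  continuous f x -> continuous g x -> continuous (fun y => sc (f y) (g y)) x.
Proof. intros; unfold sc; cont. Qed.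

Lemma cont_comp_plane {U V : UniformSpace} (F : plane -> V) (g : U -> plane) (x : U) :
  continuous g x -> continuous F (g x) -> continuous (fun y => F (g y)) x.
Proof. intros Hg HF; exact (continuous_comp g F x Hg HF). Qed.

Lemma locally_neq0 (v : plane) : v <> (0, 0) -> locally v (fun w => w <> (0, 0)).
Proof.
  intros Hv.
  assert (H : continuous (fun w : plane => dot w w) v) by (apply cont_dot; apply continuous_id).
  apply dot_pos in Hv.
  destruct (H (fun r => 0 < r) (open_gt 0 _ Hv)) as [e He].
  exists e; intros w Hw; apply dot_pos_neq0, He, Hw.
Qed.

Lemma polar_unit (x y : R) :
  x * x + y * y = 1 -> exists t, - PI <= t <= PI /\ x = cos t /\ y = sin t.
Proof.
  intros H.
  assert (Hx : -1 <= x <= 1) by nra.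
  pose proof (acos_bound x) as Hb.
  assert (Hs : sin (acos x) = Rabs y).
  { rewrite sin_acos; auto; unfold Rsqr.
    replace (1 - x * x) with (Rsqr y) by (unfold Rsqr; lra); apply sqrt_Rsqr_abs. }
  destruct (Rle_dec 0 y).
  - exists (acos x); rewrite cos_acos; auto; rewrite Hs, Rabs_right; lra.
  - exists (- acos x); rewrite cos_neg, sin_neg, cos_acos, Hs, Rabs_left; auto; lra.
Qed.

Lemma polar (v : plane) :
  v <> (0, 0) -> exists r t, 0 < r /\ - PI <= t <= PI /\ v = sc r (cos t, sin t).
Proof.
  intros Hv; apply dot_pos in Hv.
  set (r := sqrt (dot v v)).
  assert (Hr : 0 < r) by now apply sqrt_lt_R0.
  assert (Hrr : r * r = dot v v) by (apply sqrt_sqrt; lra).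
  destruct (polar_unit (fst v / r) (snd v / r)) as [t [Ht [H1 H2]]].
  { unfold dot in Hrr; field_simplify_eq; [|lra]; lra. }
  exists r, t; repeat split; try lra.
  apply plane_eq; unfold sc; simpl; rewrite <- ?H1, <- ?H2; field; lra.
Qed.

Lemma cos_sin_sqr (t : R) : cos t * cos t + sin t * sin t = 1.
Proof. pose proof (sin2_cos2 t); unfold Rsqr in *; lra. Qed.

Lemma dot_cos_sin (t : R) : dot (cos t, sin t) (cos t, sin t) = 1.
Proof. apply cos_sin_sqr. Qed.

Lemma cos_sin_neq0 (t : R) : (cos t, sin t) <> (0, 0).
Proof. apply dot_pos_neq0; rewrite dot_cos_sin; lra. Qed.

Lemma cos_sin_period (t : R) (k : Z) :
  cos (t + 2 * PI * IZR k) = cos t /\ sin (t + 2 * PI * IZR k) = sin t.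
Proof.
  assert (H : cos (2 * PI * IZR k) = 1 /\ sin (2 * PI * IZR k) = 0).
  { assert (Hs : sin (PI * IZR k) = 0) by (apply sin_eq_0_1; exists k; ring).
    replace (2 * PI * IZR k) with (2 * (PI * IZR k)) by ring.
    rewrite cos_2a_sin, sin_2a, Hs; split; ring. }
  destruct H as [Hc Hs].
  rewrite cos_plus, sin_plus, Hc, Hs; split; ring.
Qed.

Lemma cos_sin_inj (s t : R) :
  cos s = cos t -> sin s = sin t -> exists k : Z, s = t + 2 * PI * IZR k.
Proof.
  intros Hc Hs.
  assert (H : cos (2 * ((s - t) / 2)) = 1).
  { replace (2 * ((s - t) / 2)) with (s - t) by field.
    rewrite cos_minus, Hc, Hs; apply cos_sin_sqr. }
  rewrite cos_2a_sin in H.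
  destruct (sin_eq_0_0 ((s - t) / 2)) as [k Hk]; [nra|].
  exists k; lra.
Qed.

(** The angle reduces compactness of the unit circle to that of an interval. *)
Lemma circle_bounds (f : plane -> R) :
  (forall v, v <> (0, 0) -> continuous f v) -> (forall v, v <> (0, 0) -> 0 < f v) ->
  exists c1 c2, 0 < c1 /\ forall v, dot v v = 1 -> c1 <= f v <= c2.
Proof.
  intros Hc Hp.
  set (h := fun t => f (cos t, sin t)).
  assert (Hh : forall t, continuity_pt h t).
  { intros t; apply cont_pt; unfold h.
    apply (cont_comp_plane f (fun t => (cos t, sin t) : plane)); [cont|].
    apply Hc, cos_sin_neq0. }
  pose proof PI_RGT_0 as HPI.
  destruct (continuity_ab_min h (- PI) PI) as [t1 [H1 _]]; [lra|auto|].
  destruct (continuity_ab_maj h (- PI) PI) as [t2 [H2 _]]; [lra|auto|].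
  exists (h t1), (h t2); split.
  - apply Hp, cos_sin_neq0.
  - intros [x y] Hv; unfold dot in Hv; simpl in Hv.
    destruct (polar_unit x y Hv) as [t [Ht [-> ->]]].
    split; [apply H1|apply H2]; auto.
Qed.

Lemma homogeneous_bounds (f : plane -> R) (n : nat) :
  (forall v, v <> (0, 0) -> continuous f v) -> (forall v, v <> (0, 0) -> 0 < f v) ->
  (forall r v, 0 < r -> v <> (0, 0) -> f (sc r v) = r ^ (2 * n) * f v) ->
  exists c1 c2, 0 < c1 /\ 0 < c2 /\
    forall v, v <> (0, 0) -> c1 * dot v v ^ n <= f v <= c2 * dot v v ^ n.
Proof.
  intros Hc Hp Hh; destruct (circle_bounds f Hc Hp) as [c1 [c2 [H1 H]]].
  assert (H2 : 0 < c2) by (specialize (H (cos 0, sin 0) (dot_cos_sin 0)); lra).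
  refine (ex_intro _ c1 (ex_intro _ c2 (conj H1 (conj H2 _)))); intros v Hv.
  destruct (polar v Hv) as [r [t [Hr [_ ->]]]].
  rewrite Hh, dot_sc, dot_cos_sin, Rmult_1_r, pow_mult; auto using cos_sin_neq0.
  replace (r ^ 2) with (r * r) by ring.
  destruct (H _ (dot_cos_sin t)); pose proof (pow_lt (r * r) n ltac:(nra)); nra.
Qed.

Lemma ball_plane (p q : plane) (e : R) :
  ball p e q <-> Rabs (fst q - fst p) < e /\ Rabs (snd q - snd p) < e.
Proof. reflexivity. Qed.

(** Openness of balls, phrased as the dichotomy used in the compactness argument of
    [disc_homeomorphism]. *)
Lemma not_ball_open (p : plane) (e : R) (q : plane) :
  (exists d : posreal, forall q' : plane, ball q d q' -> ball p e q') \/ ~ ball p e q.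
Proof.
  destruct (classic (ball p e q)) as [H|]; auto; left.
  apply (proj1 (ball_plane _ _ _)) in H; destruct H as [Ha Hb].
  set (d := Rmin (e - Rabs (fst q - fst p)) (e - Rabs (snd q - snd p))).
  assert (Hd : 0 < d) by (unfold d; apply Rmin_glb_lt; lra).
  exists (mkposreal d Hd); intros q' Hq; apply (proj1 (ball_plane _ _ _)) in Hq; apply (proj2 (ball_plane _ _ _)); change (pos (mkposreal d Hd)) with d in Hq.
  destruct Hq as [Hq1 Hq2].
  assert (H1 : d <= e - Rabs (fst q - fst p)) by apply Rmin_l.
  assert (H2 : d <= e - Rabs (snd q - snd p)) by apply Rmin_r.
  split.
  - pose proof (Rabs_triang (fst q' - fst q) (fst q - fst p)) as Ht.
    replace (fst q' - fst q + (fst q - fst p)) with (fst q' - fst p) in Ht by ring.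
    change (Rabs (fst q' - fst p) < e); lra.
  - pose proof (Rabs_triang (snd q' - snd q) (snd q - snd p)) as Ht.
    replace (snd q' - snd q + (snd q - snd p)) with (snd q' - snd p) in Ht by ring.
    change (Rabs (snd q' - snd p) < e); lra.
Qed.

Lemma within_ball {V : UniformSpace} (S : plane -> Prop) (f : plane -> V) :
  continuous_on S f <->
  forall p, S p -> forall e : posreal, exists d : posreal, forall q : plane, ball p d q -> S q -> ball (f p) e (f q).
Proof.
  split.
  - intros H p Hp e.
    destruct (H p Hp (fun z => ball (f p) e z) (locally_ball (f p) e)) as [d Hd].
    exists d; intros q Hq HS; apply Hd; auto.
  - intros H p Hp; apply filterlim_locally; intros e.
    destruct (H p Hp e) as [d Hd]; exists d; intros q Hq HS; apply Hd; auto.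
Qed.

Lemma disc_coord_bound (w : plane) : poincare_disc w -> -1 <= fst w <= 1 /\ -1 <= snd w <= 1.
Proof. unfold poincare_disc, dot; intros H; split; nra. Qed.

Lemma not_disc_open (p : plane) :
  ~ poincare_disc p -> exists d : posreal, forall q : plane, ball p d q -> ~ poincare_disc q.
Proof.
  unfold poincare_disc; intros Hp; apply Rnot_le_lt in Hp.
  assert (H : continuous (fun w : plane => dot w w) p) by (apply cont_dot; apply continuous_id).
  destruct (H (fun r => 1 < r) (open_gt 1 _ Hp)) as [e He].
  exists e; intros w Hw; specialize (He w Hw); simpl in He; lra.
Qed.

(** A continuous bijection of a compact Hausdorff space is a homeomorphism. Each point of the square
    has a radius within which points of the disc are either close to [k q] or have an image away
    from [q]; compactness provides one margin for all of them. *)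
Lemma disc_homeomorphism (h : plane -> plane) :
  continuous_on poincare_disc h ->
  (forall p, poincare_disc p -> poincare_disc (h p)) ->
  (forall p q, poincare_disc p -> poincare_disc q -> h p = h q -> p = q) ->
  (forall q, poincare_disc q -> exists p, poincare_disc p /\ h p = q) ->
  homeomorphism poincare_disc poincare_disc h.
Proof.
  intros Hc Hd Hi Hs; repeat split; auto.
  set (k := fun q => epsilon (inhabits ((0, 0) : plane)) (fun p => poincare_disc p /\ h p = q)).
  assert (Hk : forall q, poincare_disc q -> poincare_disc (k q) /\ h (k q) = q).
  { intros q Hq; apply (epsilon_spec (inhabits ((0, 0) : plane))
      (fun p => poincare_disc p /\ h p = q)), Hs, Hq. }
  exists k; repeat split; try (intros; now apply Hk).
  2: { intros p Hp; apply Hi; auto; now apply Hk, Hd. }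
  apply within_ball; intros q Hq e.
  destruct (Hk q Hq) as [Hkq Hhq].
  assert (Hloc : forall p : plane, exists d : posreal, forall p' : plane, ball p d p' -> poincare_disc p' ->
     ball (k q) e p' \/ ~ ball q d (h p')).
  { intros p; destruct (classic (poincare_disc p)) as [Hp|Hp].
    2: { destruct (not_disc_open p Hp) as [d Hd']; exists d; intros p' H1 H2.
         now destruct (Hd' p' H1). }
    destruct (not_ball_open (k q) e p) as [[d H]|H].
    { exists d; auto. }
    assert (Hne : h p <> q).
    { intros E; apply H; rewrite <- Hhq in E; apply Hi in E; auto.
      rewrite E; apply ball_center. }
    (* The margin is doubled because one [d0] is spent on the continuity of [h] at [p]. *)
    assert (Hne' : exists d0 : posreal, ~ ball q (2 * d0) (h p)).
    { apply NNPP; intros N; apply Hne; symmetry; apply eq_close; intros r.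
      apply NNPP; intros N'; apply N; exists (pos_div_2 r); simpl.
      now replace (2 * (r / 2)) with (pos r) by field. }
    destruct Hne' as [d0 Hd0].
    destruct (proj1 (within_ball _ _) Hc p Hp d0) as [d1 Hd1].
    assert (Hm : 0 < Rmin d0 d1) by (apply Rmin_glb_lt; apply cond_pos).
    exists (mkposreal _ Hm); intros p' Hp' Hdp'; right; simpl; intros Hb; apply Hd0.
    replace (2 * d0) with (d0 + d0) by ring.
    apply (ball_triangle q (h p')).
    - eapply ball_le; [apply Rmin_l|exact Hb].
    - apply ball_sym, Hd1; auto; eapply ball_le; [apply Rmin_r|exact Hp']. }
  set (delta := fun x y => proj1_sig (constructive_indefinite_description _ (Hloc (x, y)))).
  destruct (compactness_value_2d (-1) 1 (-1) 1 delta) as [d Hd'].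
  exists d; intros q' Hq' Hdq'.
  destruct (Hk q' Hdq') as [Hkq' Hhq'].
  destruct (disc_coord_bound _ Hkq') as [Hx Hy].
  apply NNPP; intros Hn; apply (Hd' _ _ Hx Hy).
  intros [u [v [_ [_ [Hu [Hv Hle]]]]]]; revert Hu Hv Hle; unfold delta.
  destruct (constructive_indefinite_description _ (Hloc (u, v))) as [dd Hdd]; simpl.
  intros Hu Hv Hle.
  destruct (Hdd (k q')) as [H|H]; auto.
  - now apply (proj2 (ball_plane _ _ _)).
  - apply H; rewrite Hhq'; now apply (ball_le q d).
Qed.

(** * The linear flow *)

(** The solutions of [x'' = delta x] with initial data [(1, 0)] and [(0, 1)]. *)
Definition gcos (delta s : R) : R :=
  if Rlt_dec 0 delta then cosh (sqrt delta * s)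
  else if Rlt_dec delta 0 then cos (sqrt (- delta) * s) else 1.

Definition gsin (delta s : R) : R :=
  if Rlt_dec 0 delta then sinh (sqrt delta * s) / sqrt delta
  else if Rlt_dec delta 0 then sin (sqrt (- delta) * s) / sqrt (- delta) else s.

Lemma gcos_0 (delta : R) : gcos delta 0 = 1.
Proof.
  unfold gcos; repeat destruct Rlt_dec; auto; rewrite Rmult_0_r.
  - apply cosh_0.
  - apply cos_0.
Qed.

Lemma gsin_0 (delta : R) : gsin delta 0 = 0.
Proof.
  unfold gsin; repeat destruct Rlt_dec; auto; rewrite Rmult_0_r.
  - rewrite sinh_0; unfold Rdiv; ring.
  - rewrite sin_0; unfold Rdiv; ring.
Qed.

Lemma derive_gcos (delta s : R) : is_derive (gcos delta) s (delta * gsin delta s).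
Proof.
  unfold gcos, gsin; repeat destruct Rlt_dec.
  - assert (Hs := sqrt_lt_R0 _ r); assert (Hd := sqrt_sqrt delta ltac:(lra)).
    eapply is_derive_val.
    + apply (derive_comp cosh (fun s => sqrt delta * s)).
      * apply is_derive_Reals, derivable_pt_lim_cosh.
      * apply derive_lin.
    + set (w := sqrt delta) in *; clearbody w; subst delta; field; lra.
  - assert (Hs := sqrt_lt_R0 (- delta) ltac:(lra)); assert (Hd := sqrt_sqrt (- delta) ltac:(lra)).
    eapply is_derive_val.
    + apply (derive_comp cos (fun s => sqrt (- delta) * s)).
      * apply is_derive_cos.
      * apply derive_lin.
    + set (w := sqrt (- delta)) in *; clearbody w.
      replace delta with (- (w * w)) by lra; field; lra.
  - replace delta with 0 by lra; rewrite Rmult_0_l; apply derive_const.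
Qed.

Lemma derive_gsin (delta s : R) : is_derive (gsin delta) s (gcos delta s).
Proof.
  unfold gcos, gsin; repeat destruct Rlt_dec.
  - assert (Hs := sqrt_lt_R0 _ r).
    eapply is_derive_val.
    + apply (derive_mul _ (fun _ => / sqrt delta)); [|apply derive_const].
      apply (derive_comp sinh (fun s => sqrt delta * s)).
      * apply is_derive_Reals, derivable_pt_lim_sinh.
      * apply derive_lin.
    + field; lra.
  - assert (Hs := sqrt_lt_R0 (- delta) ltac:(lra)).
    eapply is_derive_val.
    + apply (derive_mul _ (fun _ => / sqrt (- delta))); [|apply derive_const].
      apply (derive_comp sin (fun s => sqrt (- delta) * s)).
      * apply is_derive_sin.
      * apply derive_lin.
    + field; lra.
  - apply derive_id.
Qed.

Lemma gcos_add (delta s t : R) :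
  gcos delta (s + t) = gcos delta s * gcos delta t + delta * gsin delta s * gsin delta t.
Proof.
  unfold gcos, gsin; repeat destruct Rlt_dec.
  - assert (Hs := sqrt_lt_R0 _ r); assert (Hd := sqrt_sqrt delta ltac:(lra)).
    set (w := sqrt delta) in *; clearbody w; subst delta; unfold cosh, sinh.
    rewrite Rmult_plus_distr_l, Ropp_plus_distr, !exp_plus; field; lra.
  - assert (Hs := sqrt_lt_R0 (- delta) ltac:(lra)); assert (Hd := sqrt_sqrt (- delta) ltac:(lra)).
    rewrite Rmult_plus_distr_l, cos_plus; set (w := sqrt (- delta)) in *; clearbody w.
    replace delta with (- (w * w)) by lra; field; lra.
  - replace delta with 0 by lra; ring.
Qed.

Lemma gsin_add (delta s t : R) :
  gsin delta (s + t) = gsin delta s * gcos delta t + gcos delta s * gsin delta t.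
Proof.
  unfold gcos, gsin; repeat destruct Rlt_dec.
  - assert (Hs := sqrt_lt_R0 _ r); unfold cosh, sinh.
    rewrite Rmult_plus_distr_l, Ropp_plus_distr, !exp_plus; field; lra.
  - assert (Hs := sqrt_lt_R0 (- delta) ltac:(lra)).
    rewrite Rmult_plus_distr_l, sin_plus; field; lra.
  - ring.
Qed.

Lemma cont_gcos {U : UniformSpace} (delta : R) (f : U -> R) (x : U) :
  continuous f x -> continuous (fun y => gcos delta (f y)) x.
Proof. intros Hf; apply (cont_real _ f x Hf), (derive_cont _ _ _ (derive_gcos delta (f x))). Qed.

Lemma cont_gsin {U : UniformSpace} (delta : R) (f : U -> R) (x : U) :
  continuous f x -> continuous (fun y => gsin delta (f y)) x.
Proof. intros Hf; apply (cont_real _ f x Hf), (derive_cont _ _ _ (derive_gsin delta (f x))). Qed.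

Definition half_trace (B : @matrix R 2 2) : R := (coeff_mat 0 B 0 0 + coeff_mat 0 B 1 1) / 2.

Definition half_diff (B : @matrix R 2 2) : R := (coeff_mat 0 B 0 0 - coeff_mat 0 B 1 1) / 2.

Definition traceless (B : @matrix R 2 2) (v : plane) : plane :=
  (half_diff B * fst v + coeff_mat 0 B 0 1 * snd v,
   coeff_mat 0 B 1 0 * fst v - half_diff B * snd v).

(** A quarter of the discriminant of the characteristic polynomial:
    [traceless B] squares to this scalar. *)
Definition discr (B : @matrix R 2 2) : R :=
  half_diff B * half_diff B + coeff_mat 0 B 0 1 * coeff_mat 0 B 1 0.

(** The matrix exponential [exp (s B)] applied to [v]. *)
Definition flow (B : @matrix R 2 2) (s : R) (v : plane) : plane :=
  (exp (half_trace B * s) *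
     (gcos (discr B) s * fst v + gsin (discr B) s * fst (traceless B v)),
   exp (half_trace B * s) *
     (gcos (discr B) s * snd v + gsin (discr B) s * snd (traceless B v))).

Section Flow.

Variable B : @matrix R 2 2.

Lemma flow_0 (v : plane) : flow B 0 v = v.
Proof.
  unfold flow; rewrite gcos_0, gsin_0, Rmult_0_r, exp_0.
  apply plane_eq; simpl; ring.
Qed.

Lemma flow_add (s t : R) (v : plane) : flow B (s + t) v = flow B s (flow B t v).
Proof.
  unfold flow; rewrite gcos_add, gsin_add, (Rmult_plus_distr_l (half_trace B)), exp_plus.
  apply plane_eq; unfold traceless; simpl; unfold discr; ring.
Qed.

Lemma flow_opp (s : R) (v : plane) : flow B (- s) (flow B s v) = v.
Proof. rewrite <- flow_add, Rplus_opp_l; apply flow_0. Qed.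

Lemma flow_sc (s r : R) (v : plane) : flow B s (sc r v) = sc r (flow B s v).
Proof. unfold flow, sc, traceless; apply plane_eq; simpl; ring. Qed.

Lemma flow_origin (s : R) : flow B s (0, 0) = (0, 0).
Proof. unfold flow, traceless; apply plane_eq; simpl; ring. Qed.

Lemma flow_neq0 (s : R) (v : plane) : v <> (0, 0) -> flow B s v <> (0, 0).
Proof. intros Hv H; apply Hv; rewrite <- (flow_opp s v), H; apply flow_origin. Qed.

(** The scalar part and [traceless B] commute, and the latter squares to a scalar; this is why the
    exponential reduces to [gcos] and [gsin]. *)
Lemma mat_app_traceless (v : plane) :
  mat_app B v = (half_trace B * fst v + fst (traceless B v),
                 half_trace B * snd v + snd (traceless B v)).
Proof. unfold mat_app, traceless, half_trace, half_diff; apply plane_eq; simpl; field. Qed.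

Lemma flow_mat_app (s : R) (v : plane) : flow B s (mat_app B v) = mat_app B (flow B s v).
Proof.
  rewrite !mat_app_traceless.
  unfold flow, traceless; apply plane_eq; simpl; ring.
Qed.

Lemma derive_flow_along (s : R -> R) (v : R -> plane) (t ds : R) (dv : plane) :
  is_derive s t ds -> is_derive v t dv ->
  is_derive (fun t => flow B (s t) (v t)) t
    (plus (sc ds (mat_app B (flow B (s t) (v t)))) (flow B (s t) dv)).
Proof.
  intros Hs Hv; destruct (is_derive_coords _ _ _ Hv) as [H1 H2].
  assert (Hc := derive_comp _ _ _ _ _ (derive_gcos (discr B) (s t)) Hs).
  assert (Hd := derive_comp _ _ _ _ _ (derive_gsin (discr B) (s t)) Hs).
  assert (He := derive_exp _ _ _ (derive_scal (half_trace B) s t ds Hs)).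
  eapply is_derive_val_plane.
  - unfold flow, traceless; cbv beta; simpl.
    apply is_derive_plane; apply derive_mul; try exact He; apply derive_add.
    + apply derive_mul; [exact Hc|exact H1].
    + apply derive_mul; [exact Hd|].
      apply derive_add; [exact (derive_scal (half_diff B) _ t _ H1)
        |exact (derive_scal (coeff_mat 0 B 0 1) _ t _ H2)].
    + apply derive_mul; [exact Hc|exact H2].
    + apply derive_mul; [exact Hd|].
      apply derive_sub; [exact (derive_scal (coeff_mat 0 B 1 0) _ t _ H1)
        |exact (derive_scal (half_diff B) _ t _ H2)].
  - rewrite mat_app_traceless.
    apply plane_eq; unfold flow, traceless, sc; simpl; unfold plus, minus, plus, opp; simpl;
      unfold discr; ring.
Qed.

Lemma derive_flow (s : R) (v : plane) :
  is_derive (fun s => flow B s v) s (mat_app B (flow B s v)).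
Proof.
  eapply is_derive_val_plane.
  - apply (derive_flow_along (fun s => s) (fun _ => v)).
    + apply derive_id.
    + apply (is_derive_const v).
  - change (zero : plane) with ((0, 0) : plane); rewrite flow_origin.
    apply plane_eq; unfold sc, plus, one; simpl; unfold plus; simpl; ring.
Qed.

Lemma cont_flow {U : UniformSpace} (s : U -> R) (v : U -> plane) (x : U) :
  continuous s x -> continuous v x -> continuous (fun y => flow B (s y) (v y)) x.
Proof.
  intros Hs Hv.
  assert (H1 := cont_gcos (discr B) s x Hs); assert (H2 := cont_gsin (discr B) s x Hs).
  unfold flow, traceless; simpl; cont.
Qed.

Lemma derive_dot_flow (s : R) (v : plane) :
  is_derive (fun s => dot (flow B s v) (flow B s v)) s
    (2 * quad_form B (flow B s v)).
Proof.
  destruct (is_derive_coords _ _ _ (derive_flow s v)) as [H1 H2].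
  eapply is_derive_val.
  - unfold dot; apply derive_add; apply derive_mul; eassumption.
  - unfold quad_form, dot; ring.
Qed.

Hypothesis Bneg : negative_definite (quad_form B).

Lemma negative_definite_bound :
  exists beta, 0 < beta /\ forall v, quad_form B v <= - beta * dot v v.
Proof.
  set (f := fun v => - quad_form B v).
  destruct (homogeneous_bounds f 1) as [c1 [c2 [H1 [_ H]]]].
  - intros v _; unfold f, quad_form, dot, mat_app; simpl; cont.
  - intros v Hv; unfold f; specialize (Bneg v Hv); lra.
  - intros r v _ _; unfold f, quad_form, dot, mat_app, sc; simpl; ring.
  - exists c1; split; auto; intros v.
    destruct (classic (v = (0, 0))) as [->|Hv].
    + unfold quad_form, dot; simpl; lra.
    + destruct (H v Hv) as [Ha _]; unfold f in Ha; simpl in Ha; lra.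
Qed.

(** The bound on [quad_form B] makes the derivative of the weighted squared norm nonpositive. As a
    monotonicity statement it gives decay forwards and growth backwards at once. *)
Lemma flow_decay :
  exists beta, 0 < beta /\ forall v s t, s <= t ->
    exp (2 * beta * t) * dot (flow B t v) (flow B t v) <=
    exp (2 * beta * s) * dot (flow B s v) (flow B s v).
Proof.
  destruct negative_definite_bound as [beta [Hb Hq]].
  exists beta; split; auto; intros v s t Hst.
  set (g := fun s => exp (2 * beta * s) * dot (flow B s v) (flow B s v)).
  set (dg := fun s => 2 * exp (2 * beta * s) *
     (beta * dot (flow B s v) (flow B s v) + quad_form B (flow B s v))).
  assert (Hg : forall s, is_derive g s (dg s)).
  { intros u; eapply is_derive_val.
    - apply derive_mul; [|apply derive_dot_flow].
      apply derive_exp, derive_lin.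
    - unfold dg; ring. }
  destruct (MVT_gen g s t dg) as [u [_ Hu]].
  - intros; apply Hg.
  - intros; apply cont_pt, (derive_cont _ _ _ (Hg _)).
  - change (g t <= g s); cut (dg u <= 0); [nra|].
    unfold dg; pose proof (exp_pos (2 * beta * u)); specialize (Hq (flow B u v)); nra.
Qed.

End Flow.

(** * The time function K *)

(** Compactness of the interval makes continuity at the points [(t, v0)] uniform in [t]. The local
    radii are taken for [e / 2], since both values are compared with the one at the centre of a
    covering interval. *)
Lemma tube (f : R -> plane -> R) (v0 : plane) (a b : R) :
  (forall t, a <= t <= b -> continuous (fun z : R * plane => f (fst z) (snd z)) (t, v0)) ->
  forall e, 0 < e -> exists d : posreal, forall t v, a <= t <= b -> ball v0 d v ->
    Rabs (f t v - f t v0) < e.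
Proof.
  intros Hf e He.
  assert (Hloc : forall t, exists d : posreal, a <= t <= b -> forall t' (v : plane),
    Rabs (t' - t) < d -> ball v0 d v -> Rabs (f t' v - f t v0) < e / 2).
  { intros t; destruct (classic (a <= t <= b)) as [Ht|Ht].
    - destruct (proj1 (filterlim_locally _ _) (Hf t Ht) (mkposreal (e / 2) ltac:(lra))) as [d Hd].
      exists d; intros _ t' v H1 H2; apply (Hd (t', v)); split; auto.
    - exists (mkposreal 1 Rlt_0_1); tauto. }
  set (delta := fun t => proj1_sig (constructive_indefinite_description _ (Hloc t))).
  destruct (compactness_value_1d a b delta) as [d Hd].
  exists d; intros t v Ht Hv.
  apply NNPP; intros Hn; apply (Hd t Ht); intros [u [Hu [Htu Hle]]]; apply Hn; clear Hn.
  revert Htu Hle; unfold delta.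
  destruct (constructive_indefinite_description _ (Hloc u)) as [dd Hdd]; simpl; intros Htu Hle.
  assert (H1 := Hdd Hu t v Htu (ball_le v0 d dd Hle v Hv)).
  assert (H2 := Hdd Hu t v0 Htu (ball_center v0 dd)).
  apply Rabs_def2 in H1; apply Rabs_def2 in H2; apply Rabs_def1; lra.
Qed.

(** Let [t] tend to minus infinity. This identifies expressions that differ only by tails of the
    integral defining [timefun]. *)
Lemma exp_le_zero (x M g t0 : R) :
  0 < g -> (forall t, t <= t0 -> Rabs x <= M * exp (g * t)) -> x = 0.
Proof.
  intros Hg H; destruct (Req_dec x 0) as [|Hx]; auto; exfalso.
  apply Rabs_pos_lt in Hx.
  assert (HM : 0 < M) by (pose proof (exp_pos (g * t0)); specialize (H t0 (Rle_refl _)); nra).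
  (* Chosen so that [Rabs x * u >= M] and [- (u / g) <= t0]. At that time the hypothesis gives
     [Rabs x * (1 + u) <= M], a contradiction. *)
  set (u := M / Rabs x + g * Rabs t0).
  assert (Hu : 0 <= u).
  { unfold u; pose proof (Rdiv_lt_0_compat M (Rabs x) HM Hx); pose proof (Rabs_pos t0); nra. }
  assert (Hu' : - (u / g) <= t0).
  { pose proof (Rle_abs (- t0)) as Ha; rewrite Rabs_Ropp in Ha.
    apply Rmult_le_reg_l with g; auto.
    replace (g * - (u / g)) with (- u) by (field; lra).
    unfold u; pose proof (Rdiv_lt_0_compat M (Rabs x) HM Hx); nra. }
  specialize (H _ Hu').
  replace (g * - (u / g)) with (- u) in H by (field; lra).
  assert (Hexp : exp (- u) * (1 + u) <= 1).
  { rewrite exp_Ropp; pose proof (exp_ineq1_le u); pose proof (exp_pos u).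
    apply Rmult_le_reg_l with (exp u); auto.
    rewrite <- Rmult_assoc, Rinv_r; lra. }
  assert (Hxu : Rabs x * u >= M).
  { unfold u; replace (Rabs x * (M / Rabs x + g * Rabs t0)) with (M + Rabs x * g * Rabs t0)
      by (field; lra).
    pose proof (Rabs_pos t0); assert (0 < Rabs x * g) by nra; nra. }
  pose proof (exp_pos (- u)); nra.
Qed.

Lemma polynomial_continuous (m : nat) (phi : plane -> R) (v : plane) :
  homogeneous_poly m phi -> continuous phi v.
Proof.
  intros [c Hc].
  apply (continuous_ext (fun v : plane => sum_f_R0 (fun i => c i * fst v ^ i * snd v ^ (m - i)) m)).
  { intros [x y]; rewrite Hc; reflexivity. }
  (* Only the upper limit of the sum is generalized; the degree inside the exponents stays fixed. *)
  generalize m at 2; intros k; induction k as [|k IH]; simpl sum_f_R0; cont.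
Qed.

Section TimeFunction.

Variables (lambda : R) (B : @matrix R 2 2) (phi : plane -> R) (n : nat).
Hypothesis lambda_pos : 0 < lambda.
Hypothesis n_pos : (1 <= n)%nat.
Hypothesis phi_hom : homogeneous_poly (2 * n) phi.
Hypothesis phi_pos : positive_definite phi.
Hypothesis B_neg : negative_definite (quad_form B).

Lemma phi_sc (r : R) (v : plane) : phi (sc r v) = r ^ (2 * n) * phi v.
Proof. exact (homogeneous_poly_scal (2 * n) phi r v phi_hom). Qed.

Lemma phi_cont (v : plane) : continuous phi v.
Proof. exact (polynomial_continuous (2 * n) phi v phi_hom). Qed.

Lemma rate_const_pos : 0 < 2 * INR n * lambda.
Proof. apply lt_0_INR in n_pos as H; nra. Qed.

Definition rate (v : plane) (t : R) : R := 2 * INR n * lambda / phi (flow B t v).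

Lemma rate_pos (v : plane) (t : R) : v <> (0, 0) -> 0 < rate v t.
Proof.
  intros Hv; apply Rdiv_lt_0_compat; [apply rate_const_pos|].
  apply phi_pos, flow_neq0, Hv.
Qed.

Lemma cont_rate {U : UniformSpace} (v : U -> plane) (t : U -> R) (x : U) :
  continuous v x -> continuous t x -> v x <> (0, 0) -> continuous (fun y => rate (v y) (t y)) x.
Proof.
  intros Hv Ht H0; unfold rate; apply cont_div; [apply cont_const| |].
  - apply (cont_comp_plane phi (fun y => flow B (t y) (v y))); [now apply cont_flow|apply phi_cont].
  - apply Rgt_not_eq, phi_pos, flow_neq0, H0.
Qed.

Definition elapsed (v : plane) (t : R) : R := RInt (rate v) 0 t.

Lemma elapsed_0 (v : plane) : elapsed v 0 = 0.
Proof. exact (RInt_point 0 (rate v)). Qed.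

Lemma elapsed_derive (v : plane) (t : R) : v <> (0, 0) -> is_derive (elapsed v) t (rate v t).
Proof.
  intros Hv.
  assert (Hc : forall t, continuous (rate v) t).
  { intros s; apply (cont_rate (fun _ => v) (fun t => t)); auto; cont. }
  apply (is_derive_RInt (rate v) (elapsed v) 0 t); auto.
  apply filter_forall; intros y.
  apply (RInt_correct (V := R_CompleteNormedModule)).
  apply (ex_RInt_continuous (V := R_CompleteNormedModule)); auto.
Qed.

Lemma elapsed_incr (v : plane) (s t : R) : v <> (0, 0) -> s < t -> elapsed v s < elapsed v t.
Proof.
  intros Hv; apply (derive_pos_incr (elapsed v) (rate v)); intros u.
  - now apply elapsed_derive.
  - now apply rate_pos.
Qed.

Lemma elapsed_flow (v : plane) (s t : R) :
  v <> (0, 0) -> elapsed (flow B s v) t = elapsed v (t + s) - elapsed v s.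
Proof.
  intros Hv.
  assert (H : elapsed (flow B s v) t - elapsed v (t + s) =
              elapsed (flow B s v) 0 - elapsed v (0 + s)).
  { apply (derive_zero_const (fun t => elapsed (flow B s v) t - elapsed v (t + s))).
    intros u _; eapply is_derive_val.
    - apply derive_sub; [apply elapsed_derive, flow_neq0, Hv|].
      apply (derive_comp (elapsed v) (fun t => t + s)); [apply elapsed_derive, Hv|].
      apply derive_add; [apply derive_id|apply derive_const].
    - unfold rate; rewrite flow_add; ring. }
  rewrite elapsed_0, Rplus_0_l in H; lra.
Qed.

(** Backwards in time the linear flow expands exponentially, and [phi] grows with the power [2 n] of
    the norm, so the rate is integrable at minus infinity. The constant is written [C * g] so that
    its integral has the constant [C]. *)
Lemma rate_bound :
  exists C g, 0 < C /\ 0 < g /\ forall v t, v <> (0, 0) -> t <= 0 ->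
    rate v t <= C * g * exp (g * t) / dot v v ^ n.
Proof.
  destruct (homogeneous_bounds phi n) as [c1 [c2 [Hc1 [_ Hphi]]]]; auto.
  { intros; apply phi_cont. }
  { intros r v _ _; apply phi_sc. }
  destruct (flow_decay B B_neg) as [beta [Hb Hdec]].
  pose proof (lt_0_INR n ltac:(lia)) as Hn; pose proof rate_const_pos as Hk.
  set (g := INR n * (2 * beta)).
  assert (Hg : 0 < g) by (unfold g; nra).
  exists (2 * INR n * lambda / c1 / g), g; repeat split; auto.
  { repeat apply Rdiv_lt_0_compat; auto. }
  intros v t Hv Ht.
  pose proof (dot_pos v Hv) as Hd; pose proof (pow_lt _ n Hd) as Hdn.
  specialize (Hdec v t 0 Ht); rewrite flow_0, Rmult_0_r, exp_0, Rmult_1_l in Hdec.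
  destruct (Hphi (flow B t v) (flow_neq0 B t v Hv)) as [Hl _].
  pose proof (phi_pos _ (flow_neq0 B t v Hv)) as Hp.
  assert (He : exp (g * t) = exp (2 * beta * t) ^ n).
  { rewrite <- Rpower_pow by apply exp_pos; unfold Rpower; rewrite ln_exp.
    f_equal; unfold g; ring. }
  assert (Hpow : dot v v ^ n <= exp (g * t) * dot (flow B t v) (flow B t v) ^ n).
  { rewrite He, <- Rpow_mult_distr; apply pow_incr; lra. }
  pose proof (exp_pos (g * t)) as Hep.
  replace (2 * INR n * lambda / c1 / g * g * exp (g * t) / dot v v ^ n) with
    (2 * INR n * lambda * (exp (g * t) / (c1 * dot v v ^ n))) by (field; lra).
  unfold rate, Rdiv at 1; apply Rmult_le_compat_l; [lra|].
  apply Rmult_le_reg_l with (phi (flow B t v)); auto.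
  rewrite Rinv_r by lra.
  apply Rmult_le_reg_r with (c1 * dot v v ^ n); [nra|].
  replace (phi (flow B t v) * (exp (g * t) / (c1 * dot v v ^ n)) * (c1 * dot v v ^ n)) with
    (phi (flow B t v) * exp (g * t)) by (field; split; nra).
  assert (c1 * dot v v ^ n <= c1 * (exp (g * t) * dot (flow B t v) (flow B t v) ^ n)) by nra.
  nra.
Qed.

(** [2 n lambda] times the integral of [1 / phi (flow B t v)] over [t <= 0]. *)
Definition timefun (v : plane) : R :=
  real (Lim_seq (fun k => - elapsed v (- INR k))).

(** For [t <= 0] the sum [timefun v + elapsed v t] is the part of the integral before [t]; comparing
    derivatives with [rate_bound] bounds it. That [C] and [g] do not depend on [v] is what
    continuity of [timefun] needs. *)
Lemma timefun_tail :
  exists C g, 0 < C /\ 0 < g /\ forall v, v <> (0, 0) ->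
    is_lim_seq (fun k => - elapsed v (- INR k)) (timefun v) /\
    forall t, t <= 0 -> 0 <= timefun v + elapsed v t <= C * exp (g * t) / dot v v ^ n.
Proof.
  destruct rate_bound as [C [g [HC [Hg Hr]]]].
  exists C, g; refine (conj HC (conj Hg _)); intros v H.
  assert (Hdn := pow_lt _ n (dot_pos v H)).
  assert (Hmono : forall s t, s <= t -> t <= 0 ->
    0 <= elapsed v t - elapsed v s <= C * exp (g * t) / dot v v ^ n).
  { intros s t Hst Ht.
    destruct (Req_dec s t) as [->|Hne].
    { rewrite Rminus_diag; split; [lra|].
      apply Rlt_le, Rdiv_lt_0_compat; auto; pose proof (exp_pos (g * t)); nra. }
    split; [apply Rlt_le, Rlt_0_minus, elapsed_incr; auto; lra|].
    set (h := fun t => elapsed v t - C * exp (g * t) / dot v v ^ n).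
    set (dh := fun t => rate v t - C * g * exp (g * t) / dot v v ^ n).
    assert (Hh : forall t, is_derive h t (dh t)).
    { intros u; eapply is_derive_val.
      - unfold h; apply derive_sub; [apply elapsed_derive, H|].
        apply (derive_mul _ (fun _ => / dot v v ^ n)); [|apply derive_const].
        apply derive_scal, derive_exp, derive_lin.
      - unfold dh; field; lra. }
    destruct (MVT_gen h s t dh) as [u [Hu Heq]].
    - intros; apply Hh.
    - intros; apply cont_pt, (derive_cont _ _ _ (Hh _)).
    - rewrite Rmin_left, Rmax_right in Hu by lra.
      assert (Hdh : dh u <= 0) by (unfold dh; specialize (Hr v u H ltac:(lra)); lra).
      assert (h t <= h s) by nra.
      unfold h in *.
      assert (0 < C * exp (g * s) / dot v v ^ n).
      { apply Rdiv_lt_0_compat; auto; pose proof (exp_pos (g * s)); nra. }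
      lra. }
  assert (Hlim : is_lim_seq (fun k => - elapsed v (- INR k)) (timefun v)).
  { apply Lim_seq_correct', (ex_finite_lim_seq_incr _ (C / dot v v ^ n)).
    - intros k; pose proof (pos_INR k).
      destruct (Hmono (- INR (S k)) (- INR k)); rewrite ?S_INR in *; lra.
    - intros k; pose proof (pos_INR k); destruct (Hmono (- INR k) 0); try lra.
      rewrite elapsed_0, Rmult_0_r, exp_0 in *; lra. }
  split; auto; intros t Ht.
  (* Since [k0] is the floor of [- t], the integers [- k] lie before [t] from [k = S k0] on. *)
  destruct (nfloor_ex (- t)) as [k0 Hk0]; [lra|].
  assert (Hlim' : is_lim_seq (fun k => elapsed v t - elapsed v (- INR k)) (elapsed v t + timefun v)).
  { apply (is_lim_seq_ext (fun k => elapsed v t + - elapsed v (- INR k))); [intros; ring|].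
    apply (is_lim_seq_plus' (fun _ => elapsed v t)); auto; apply is_lim_seq_const. }
  assert (Hev : forall k, (S k0 <= k)%nat ->
    0 <= elapsed v t - elapsed v (- INR k) <= C * exp (g * t) / dot v v ^ n).
  { intros k Hk; apply le_INR in Hk; rewrite S_INR in Hk; apply Hmono; lra. }
  rewrite Rplus_comm; split.
  - apply (is_lim_seq_le_loc (fun _ => 0) (fun k => elapsed v t - elapsed v (- INR k))
      (Finite 0) (Finite (elapsed v t + timefun v))); auto using is_lim_seq_const.
    exists (S k0); intros k Hk; now apply Hev.
  - apply (is_lim_seq_le_loc (fun k => elapsed v t - elapsed v (- INR k))
      (fun _ => C * exp (g * t) / dot v v ^ n)
      (Finite (elapsed v t + timefun v)) (Finite (C * exp (g * t) / dot v v ^ n)));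
      auto using is_lim_seq_const.
    exists (S k0); intros k Hk; now apply Hev.
Qed.

(** After the time shift of [elapsed_flow], the two sides differ by a difference of two tails, at
    times [t] and [t + s] with [t] arbitrarily far in the past. *)
Lemma timefun_flow (s : R) (v : plane) :
  v <> (0, 0) -> timefun (flow B s v) = timefun v + elapsed v s.
Proof.
  intros Hv; destruct timefun_tail as [C [g [HC [Hg H]]]].
  destruct (H v Hv) as [_ H1]; destruct (H _ (flow_neq0 B s v Hv)) as [_ H2].
  assert (Hz : timefun (flow B s v) - elapsed v s - timefun v = 0); [|lra].
  apply (exp_le_zero _ (C / dot (flow B s v) (flow B s v) ^ n + C * exp (g * s) / dot v v ^ n)
    g (- Rabs s)); auto.
  intros t Ht; pose proof (Rle_abs s) as Ha; pose proof (Rabs_pos s) as Hb.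
  specialize (H2 t ltac:(lra)); rewrite elapsed_flow in H2 by auto.
  specialize (H1 (t + s) ltac:(lra)).
  rewrite Rmult_plus_distr_l, exp_plus in H1.
  assert (E1 : C * exp (g * t) / dot (flow B s v) (flow B s v) ^ n =
    C / dot (flow B s v) (flow B s v) ^ n * exp (g * t)) by (unfold Rdiv; ring).
  assert (E2 : C * (exp (g * t) * exp (g * s)) / dot v v ^ n =
    C * exp (g * s) / dot v v ^ n * exp (g * t)) by (unfold Rdiv; ring).
  rewrite E1 in H2; rewrite E2 in H1.
  rewrite Rmult_plus_distr_r; apply Rabs_le; lra.
Qed.

Lemma timefun_derive (v : plane) (s : R) :
  v <> (0, 0) -> is_derive (fun s => timefun (flow B s v)) s (rate v s).
Proof.
  intros Hv; apply (is_derive_ext (fun s => timefun v + elapsed v s)).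
  { intros t; symmetry; now apply timefun_flow. }
  eapply is_derive_val; [apply derive_add; [apply derive_const|apply elapsed_derive, Hv]|ring].
Qed.

Lemma timefun_pos (v : plane) : v <> (0, 0) -> 0 < timefun v.
Proof.
  intros Hv; destruct timefun_tail as [C [g [HC [Hg H]]]].
  destruct (H v Hv) as [_ H1]; specialize (H1 (-1) ltac:(lra)).
  pose proof (elapsed_incr v (-1) 0 Hv ltac:(lra)); rewrite elapsed_0 in *; lra.
Qed.

Lemma timefun_sc (r : R) (v : plane) :
  r <> 0 -> v <> (0, 0) -> timefun (sc r v) = timefun v / r ^ (2 * n).
Proof.
  intros Hr Hv; assert (Hrn := pow_nonzero r (2 * n) Hr).
  assert (He : forall t, elapsed (sc r v) t = / r ^ (2 * n) * elapsed v t).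
  { intros t.
    assert (H : elapsed (sc r v) t - / r ^ (2 * n) * elapsed v t =
      elapsed (sc r v) 0 - / r ^ (2 * n) * elapsed v 0); [|rewrite !elapsed_0 in H; lra].
    apply (derive_zero_const (fun t => elapsed (sc r v) t - / r ^ (2 * n) * elapsed v t)).
    intros u _; eapply is_derive_val.
    - apply derive_sub; [apply elapsed_derive, sc_neq0; auto|].
      apply derive_scal, elapsed_derive, Hv.
    - pose proof (phi_pos _ (flow_neq0 B u v Hv)).
      unfold rate; rewrite flow_sc, phi_sc; field; split; auto; lra. }
  destruct timefun_tail as [C [g [HC [Hg H]]]]; destruct (H v Hv) as [H1 _].
  unfold timefun at 1.
  rewrite (Lim_seq_ext _ (fun k => / r ^ (2 * n) * - elapsed v (- INR k))).
  2: intros k; rewrite He; ring.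
  rewrite Lim_seq_scal_l, (is_lim_seq_unique _ _ H1); simpl; unfold Rdiv; ring.
Qed.

(** The integral is cut at a time [t] before which it is below [eps / 3], uniformly for [w] with
    [dot w w] above half of [dot v v]; on the compact rest [tube] controls the integrand. *)
Lemma timefun_cont (v : plane) : v <> (0, 0) -> continuous timefun v.
Proof.
  intros Hv; apply filterlim_locally; intros eps.
  assert (Heps := cond_pos eps).
  destruct timefun_tail as [C [g [HC [Hg H]]]].
  assert (Hd := dot_pos v Hv).
  assert (Hd2 := pow_lt (dot v v / 2) n ltac:(lra)).
  assert (Ht : exists t, t <= 0 /\ C * exp (g * t) / (dot v v / 2) ^ n < eps / 3).
  { apply NNPP; intros N.
    assert (Hz : eps / 3 = 0); [|lra].
    apply (exp_le_zero _ (C / (dot v v / 2) ^ n) g 0); auto.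
    intros t Ht; rewrite Rabs_right by lra.
    apply Rnot_lt_le; intros Hlt; apply N; exists t; split; auto.
    eapply Rle_lt_trans; [|apply Hlt]; right; unfold Rdiv; ring. }
  destruct Ht as [t [Ht0 Ht]].
  assert (Hnear : locally v (fun w : plane => dot v v / 2 < dot w w)).
  { assert (Hc : continuous (fun w : plane => dot w w) v) by (apply cont_dot; apply continuous_id).
    apply (Hc (fun r => dot v v / 2 < r)), open_gt; lra. }
  assert (Hq : 0 < eps / (3 * (Rabs t + 1))).
  { pose proof (Rabs_pos t); apply Rdiv_lt_0_compat; lra. }
  destruct (tube (fun t v => rate v t) v t 0) with (e := eps / (3 * (Rabs t + 1))) as [d Hdt]; auto.
  { intros u _; apply (cont_rate (fun z : R * plane => snd z) (fun z : R * plane => fst z)); auto.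
    - apply continuous_snd.
    - apply continuous_fst. }
  assert (Htail : forall w : plane, dot v v / 2 < dot w w ->
    0 <= timefun w + elapsed w t < eps / 3).
  { intros w Hw; destruct (H w) as [_ Hw']; [apply dot_pos_neq0; lra|].
    specialize (Hw' t Ht0); split; [lra|].
    eapply Rle_lt_trans; [apply Hw'|]; eapply Rle_lt_trans; [|apply Ht].
    unfold Rdiv; apply Rmult_le_compat_l; [pose proof (exp_pos (g * t)); nra|].
    apply Rinv_le_contravar; auto; apply pow_incr; lra. }
  apply (filter_imp (fun w : plane => dot v v / 2 < dot w w /\ ball v d w)).
  2: apply filter_and; [exact Hnear|apply locally_ball].
  intros w [Hw Hb].
  assert (Hw0 : w <> (0, 0)) by (apply dot_pos_neq0; lra).
  assert (Hel : Rabs (elapsed w t - elapsed v t) < eps / 3).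
  { destruct (MVT_gen (fun t => elapsed w t - elapsed v t) 0 t (fun t => rate w t - rate v t))
      as [u [Hu Heq]].
    - intros; apply derive_sub; now apply elapsed_derive.
    - intros u _; apply cont_pt; apply (derive_cont _ _ (rate w u - rate v u)).
      apply derive_sub; now apply elapsed_derive.
    - rewrite !elapsed_0 in Heq.
      rewrite Rmin_right, Rmax_left in Hu by lra.
      specialize (Hdt u w ltac:(lra) Hb).
      replace (elapsed w t - elapsed v t) with ((rate w u - rate v u) * t) by lra.
      rewrite Rabs_mult; pose proof (Rabs_pos t); pose proof (Rabs_pos (rate w u - rate v u)).
      apply Rle_lt_trans with (eps / (3 * (Rabs t + 1)) * Rabs t); [nra|].
      apply Rlt_le_trans with (eps / (3 * (Rabs t + 1)) * (Rabs t + 1)); [nra|].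
      right; field; lra. }
  pose proof (Htail w Hw); pose proof (Htail v ltac:(lra)).
  apply Rabs_def2 in Hel.
  change (Rabs (timefun w - timefun v) < eps); apply Rabs_def1; lra.
Qed.

(** The reciprocal of [timefun] is homogeneous of positive degree [2 n], hence comparable to that
    power of the norm. *)
Lemma timefun_bounds :
  exists k1 k2, 0 < k1 /\ 0 < k2 /\ forall v, v <> (0, 0) ->
    k1 * dot v v ^ n <= / timefun v <= k2 * dot v v ^ n.
Proof.
  apply (homogeneous_bounds (fun v => / timefun v) n).
  - intros v Hv; apply cont_inv; [now apply timefun_cont|].
    apply Rgt_not_eq, timefun_pos, Hv.
  - intros v Hv; apply Rinv_0_lt_compat, timefun_pos, Hv.
  - intros r v Hr Hv; rewrite timefun_sc by (auto; lra).
    pose proof (timefun_pos v Hv); pose proof (pow_lt r (2 * n) Hr); field; lra.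
Qed.

Lemma timefun_flow_incr (v : plane) (s t : R) :
  v <> (0, 0) -> s < t -> timefun (flow B s v) < timefun (flow B t v).
Proof.
  intros Hv Hst; rewrite !timefun_flow by auto.
  pose proof (elapsed_incr v s t Hv Hst); lra.
Qed.

Lemma timefun_flow_inj (v : plane) (s t : R) :
  v <> (0, 0) -> timefun (flow B s v) = timefun (flow B t v) -> s = t.
Proof.
  intros Hv; apply (incr_inj (fun s => timefun (flow B s v))).
  intros x y; now apply timefun_flow_incr.
Qed.

(** By [flow_decay] the norm tends to zero forwards and to infinity backwards, so [K] runs through
    all positive values; the intermediate value theorem concludes. *)
Lemma timefun_flow_surj (v : plane) (k : R) :
  v <> (0, 0) -> 0 < k -> exists s, timefun (flow B s v) = k.
Proof.
  intros Hv Hk.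
  destruct timefun_bounds as [k1 [k2 [Hk1 [Hk2 Hb]]]].
  destruct (flow_decay B B_neg) as [beta [Hbeta Hdec]].
  assert (Hd := dot_pos v Hv).
  assert (Hhigh : exists s, 0 <= s /\ k <= timefun (flow B s v)).
  (* Once the squared norm [q] is at most [e], the bound [e <= 1] gives [q ^ n <= e], and the other
     bound gives [/ K <= / k]. The time [s] makes [exp (2 * beta * s)] at least [dot v v / e]. *)
  { set (e := Rmin 1 (/ (k * k2))).
    assert (He : 0 < e) by (apply Rmin_glb_lt; [lra|apply Rinv_0_lt_compat; nra]).
    set (s := dot v v / e / (2 * beta)).
    assert (Hs : 0 < s) by (unfold s; repeat apply Rdiv_lt_0_compat; lra).
    exists s; split; [lra|].
    specialize (Hdec v 0 s ltac:(lra)); rewrite flow_0, Rmult_0_r, exp_0, Rmult_1_l in Hdec.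
    pose proof (exp_ineq1_le (2 * beta * s)) as Hexp.
    replace (2 * beta * s) with (dot v v / e) in * by (unfold s; field; lra).
    set (q := dot (flow B s v) (flow B s v)) in *.
    pose proof (dot_pos _ (flow_neq0 B s v Hv)) as Hq; fold q in Hq.
    assert (Hqe : q <= e).
    { assert (dot v v / e * q <= dot v v) by nra.
      apply Rmult_le_reg_l with (dot v v / e); [apply Rdiv_lt_0_compat; lra|].
      replace (dot v v / e * e) with (dot v v) by (field; lra); lra. }
    assert (He1 : e <= 1) by apply Rmin_l; assert (He2 : e <= / (k * k2)) by apply Rmin_r.
    assert (Hqn : q ^ n <= e).
    { replace n with (S (pred n)) by lia; simpl.
      pose proof (pow_incr q 1 (pred n) ltac:(lra)) as Hp; rewrite pow1 in Hp.
      pose proof (pow_lt q (pred n) Hq); nra. }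
    destruct (Hb _ (flow_neq0 B s v Hv)) as [_ Hup]; fold q in Hup.
    pose proof (timefun_pos _ (flow_neq0 B s v Hv)) as Hpos.
    assert (Hup' : / timefun (flow B s v) <= / k).
    { eapply Rle_trans; [exact Hup|].
      apply Rle_trans with (k2 * / (k * k2)); [nra|right; field; lra]. }
    rewrite <- (Rinv_inv k), <- (Rinv_inv (timefun _)).
    apply Rinv_le_contravar; auto; now apply Rinv_0_lt_compat. }
  assert (Hlow : exists s, s <= 0 /\ timefun (flow B s v) <= k).
  (* The summand [1] guarantees [M <= q ^ n] as soon as [M <= q]; the other one pushes [k1 * q ^ n]
     above [/ k]. *)
  { set (M := 1 + / (k * k1)).
    assert (HM : 0 < / (k * k1)) by (apply Rinv_0_lt_compat; nra).
    set (s := - (M / dot v v / (2 * beta))).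
    assert (Hs : s < 0) by (unfold s; cut (0 < M / dot v v / (2 * beta)); [lra|];
      repeat apply Rdiv_lt_0_compat; unfold M; lra).
    exists s; split; [lra|].
    specialize (Hdec v s 0 ltac:(lra)); rewrite flow_0, Rmult_0_r, exp_0, Rmult_1_l in Hdec.
    pose proof (exp_ineq1_le (- (2 * beta * s))) as Hexp.
    replace (2 * beta * s) with (- (M / dot v v)) in * by (unfold s; field; lra).
    rewrite Ropp_involutive in Hexp.
    set (q := dot (flow B s v) (flow B s v)) in *.
    assert (HqM : M <= q).
    { rewrite exp_Ropp in Hdec.
      pose proof (exp_pos (M / dot v v)) as Hep.
      assert (exp (M / dot v v) * dot v v <= q).
      { apply Rmult_le_reg_l with (/ exp (M / dot v v)); [now apply Rinv_0_lt_compat|].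
        rewrite <- Rmult_assoc, Rinv_l by lra; lra. }
      assert (M / dot v v * dot v v = M) by (field; lra); nra. }
    assert (Hqn : M <= q ^ n).
    { replace n with (S (pred n)) by lia; simpl.
      assert (Hq1 : 1 <= q ^ pred n) by (apply pow_R1_Rle; unfold M in HqM; lra).
      assert (0 < M) by (unfold M; lra); nra. }
    destruct (Hb _ (flow_neq0 B s v Hv)) as [Hup _]; fold q in Hup.
    pose proof (timefun_pos _ (flow_neq0 B s v Hv)) as Hpos.
    assert (Hup' : / k <= / timefun (flow B s v)).
    { eapply Rle_trans; [|exact Hup].
      apply Rle_trans with (k1 * / (k * k1)); [right; field; lra|].
      apply Rmult_le_compat_l; [lra|]; unfold M in Hqn; lra. }
    rewrite <- (Rinv_inv k), <- (Rinv_inv (timefun _)).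
    apply Rinv_le_contravar; auto; now apply Rinv_0_lt_compat. }
  destruct Hhigh as [s1 [_ H1]]; destruct Hlow as [s0 [_ H0]].
  destruct (IVT_gen (fun s => timefun (flow B s v)) s0 s1 k) as [s [_ Hs]].
  - intros s; apply cont_pt, (derive_cont _ _ _ (timefun_derive v s Hv)).
  - rewrite Rmin_left, Rmax_right; lra.
  - now exists s.
Qed.

End TimeFunction.

(** * Solutions of the field *)

Lemma is_derive_sc (f : R -> R) (v : R -> plane) (t df : R) (dv : plane) :
  is_derive f t df -> is_derive v t dv ->
  is_derive (fun t => sc (f t) (v t)) t (plus (sc df (v t)) (sc (f t) dv)).
Proof.
  intros Hf Hv; destruct (is_derive_coords _ _ _ Hv) as [H1 H2].
  unfold sc; apply is_derive_plane; apply derive_mul; auto.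
Qed.

Lemma derive_zero_const_plane (f : R -> plane) (T : R) :
  (forall t, Rmin 0 T <= t <= Rmax 0 T -> is_derive f t ((0, 0) : plane)) -> f T = f 0.
Proof.
  intros H; apply plane_eq.
  - apply (derive_zero_const (fun t => fst (f t))); intros t Ht.
    exact (proj1 (is_derive_coords _ _ _ (H t Ht))).
  - apply (derive_zero_const (fun t => snd (f t))); intros t Ht.
    exact (proj2 (is_derive_coords _ _ _ (H t Ht))).
Qed.

(** In the frame moving with [flow B (s t)], the field
    [alpha t v + psi t B v] is scalar. *)
Lemma moving_frame (B : @matrix R 2 2) (a s alpha psi : R -> R) (v : R -> plane) (T : R) :
  (forall t, is_derive a t (alpha t)) -> (forall t, is_derive s t (psi t)) ->
  a 0 = 0 -> s 0 = 0 ->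
  (forall t, Rmin 0 T <= t <= Rmax 0 T ->
     is_derive v t (plus (sc (alpha t) (v t)) (sc (psi t) (mat_app B (v t))))) ->
  v T = sc (exp (a T)) (flow B (s T) (v 0)).
Proof.
  intros Ha Hs Ha0 Hs0 Hv.
  set (y := fun t => sc (exp (- a t)) (flow B (- s t) (v t))).
  assert (Hy : y T = y 0).
  { apply derive_zero_const_plane; intros t Ht.
    eapply is_derive_val_plane.
    - unfold y; apply is_derive_sc.
      + apply derive_exp, derive_opp, Ha.
      + apply derive_flow_along; [apply derive_opp, Hs|apply Hv, Ht].
    - rewrite <- flow_mat_app, mat_app_traceless.
      apply plane_eq; unfold flow, traceless, sc, plus; simpl; unfold plus; simpl; ring. }
  unfold y in Hy; rewrite Ha0, Hs0, Ropp_0, exp_0, flow_0, sc_1 in Hy.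
  rewrite <- Hy, flow_sc, sc_sc, <- exp_plus, Rplus_opp_r, exp_0, sc_1.
  rewrite <- flow_add, Rplus_opp_r; symmetry; apply flow_0.
Qed.

Section Solutions.

Variables (lambda : R) (B : @matrix R 2 2) (phi : plane -> R) (n : nat).
Hypothesis lambda_pos : 0 < lambda.
Hypothesis n_pos : (1 <= n)%nat.
Hypothesis phi_hom : homogeneous_poly (2 * n) phi.
Hypothesis phi_pos : positive_definite phi.
Hypothesis B_neg : negative_definite (quad_form B).

Notation field := (vector_field lambda B phi).
Notation K := (timefun lambda B phi n).

Lemma field_eq (v : plane) :
  field v = plus (sc lambda v) (sc (phi v) (mat_app B v)).
Proof. reflexivity. Qed.

(** The factor [e] will be [1] or [-1], for the field and its reversal; with [Rmin] and [Rmax] the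
    end [T] may lie on either side of [0]. *)
Definition solves (e : R) (v : R -> plane) (T : R) : Prop :=
  forall t, Rmin 0 T <= t <= Rmax 0 T -> is_derive v t (sc e (field (v t))).

Lemma Rmin_Rmax_0 (T : R) : Rmin 0 T <= 0 <= Rmax 0 T.
Proof. split; [apply Rmin_l|apply Rmax_l]. Qed.

Lemma Rmin_Rmax_T (T : R) : Rmin 0 T <= T <= Rmax 0 T.
Proof. split; [apply Rmin_r|apply Rmax_r]. Qed.

(** Along a given solution [phi (v t)] is a known function of time, so the equation is linear in [v]
    and [moving_frame] applies. *)
Lemma solves_form (e : R) (v : R -> plane) (T : R) :
  solves e v T ->
  exists s : R -> R, s 0 = 0 /\
    forall t, Rmin 0 T <= t <= Rmax 0 T ->
      is_derive s t (e * phi (v t)) /\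
      v t = sc (exp (e * lambda * t)) (flow B (s t) (v 0)).
Proof.
  intros Hv.
  assert (Hle := Rle_trans _ _ _ (proj1 (Rmin_Rmax_0 T)) (proj2 (Rmin_Rmax_0 T))).
  set (psi := fun t => e * phi (v (clamp (Rmin 0 T) (Rmax 0 T) t))).
  destruct (primitive_exists psi) as [s [Hs0 Hs]].
  { intros t; unfold psi; apply cont_mul; [apply cont_const|].
    apply (cont_comp_clamp (fun t => phi (v t))); auto.
    intros u Hu; apply (cont_comp_plane phi v).
    - apply (derive_cont_plane v u _ (Hv u Hu)).
    - apply (phi_cont phi n phi_hom). }
  exists s; split; auto; intros t Ht; split.
  { eapply is_derive_val; [apply Hs|]; unfold psi; now rewrite clamp_id. }
  apply (moving_frame B (fun t => e * lambda * t) s (fun _ => e * lambda) psi); auto.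
  - intros u; apply derive_lin.
  - ring.
  - intros u Hu; assert (Hu' : Rmin 0 T <= u <= Rmax 0 T).
    { revert Ht Hu; unfold Rmin, Rmax; repeat destruct Rle_dec; lra. }
    eapply is_derive_val_plane; [apply Hv, Hu'|].
    unfold psi; rewrite clamp_id by auto; rewrite field_eq.
    apply plane_eq; unfold sc, plus; simpl; unfold plus; simpl; ring.
Qed.

Lemma solves_origin (e : R) (v : R -> plane) (T : R) :
  solves e v T -> v 0 = (0, 0) -> v T = (0, 0).
Proof.
  intros Hv H0; destruct (solves_form e v T Hv) as [s [_ Hs]].
  destruct (Hs T (Rmin_Rmax_T T)) as [_ ->]; rewrite H0, flow_origin, sc_0; auto.
Qed.

Lemma exp_pow (x : R) (k : nat) : exp x ^ k = exp (INR k * x).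
Proof.
  rewrite <- Rpower_pow by apply exp_pos; unfold Rpower; rewrite ln_exp; auto.
Qed.

Lemma INR_2n : INR (2 * n) = 2 * INR n.
Proof. rewrite mult_INR; simpl; ring. Qed.

(** The time [s] of the linear flow has speed [e * phi (v t)], and homogeneity extracts the factor
    [exp (2 n e lambda t)] from it. The rest cancels against the denominator of [rate], so [K] grows
    along [s] exactly like this exponential. *)
Lemma solves_point (e : R) (v : R -> plane) (T : R) :
  solves e v T -> v 0 <> (0, 0) ->
  exists s, v T = sc (exp (e * lambda * T)) (flow B s (v 0)) /\
    K (flow B s (v 0)) = K (v 0) + exp (2 * INR n * lambda * e * T) - 1.
Proof.
  intros Hv H0; destruct (solves_form e v T Hv) as [s [Hs0 Hs]].
  exists (s T); split; [apply Hs, Rmin_Rmax_T|].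
  assert (H : K (flow B (s T) (v 0)) - exp (2 * INR n * lambda * e * T) =
              K (flow B (s 0) (v 0)) - exp (2 * INR n * lambda * e * 0)).
  { apply (derive_zero_const
      (fun t => K (flow B (s t) (v 0)) - exp (2 * INR n * lambda * e * t))).
    intros t Ht; destruct (Hs t Ht) as [Hd Hvt].
    eapply is_derive_val.
    - apply derive_sub.
      + apply (derive_comp (fun s => K (flow B s (v 0))) s); [|exact Hd].
        now apply timefun_derive.
      + apply derive_exp, derive_lin.
    - rewrite Hvt, (phi_sc phi n phi_hom), exp_pow, INR_2n.
      pose proof (phi_pos _ (flow_neq0 B (s t) (v 0) H0)).
      replace (2 * INR n * (e * lambda * t)) with (2 * INR n * lambda * e * t) by ring.
      unfold rate; field; lra. }
  rewrite Hs0, flow_0, Rmult_0_r, exp_0 in H; lra.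
Qed.

Lemma solves_neq0 (e : R) (v : R -> plane) (T : R) :
  solves e v T -> v 0 <> (0, 0) -> v T <> (0, 0).
Proof.
  intros Hv H0; destruct (solves_point e v T Hv H0) as [s [-> _]].
  apply sc_neq0; [apply Rgt_not_eq, exp_pos|now apply flow_neq0].
Qed.

Lemma solves_time (e : R) (v : R -> plane) (T : R) :
  solves e v T -> v 0 <> (0, 0) ->
  K (v T) = 1 + (K (v 0) - 1) * exp (- (2 * INR n * lambda * e * T)).
Proof.
  intros Hv H0; destruct (solves_point e v T Hv H0) as [s [-> Hs]].
  rewrite timefun_sc; auto using flow_neq0.
  2: apply Rgt_not_eq, exp_pos.
  rewrite Hs, exp_pow, INR_2n, exp_Ropp.
  replace (2 * INR n * (e * lambda * T)) with (2 * INR n * lambda * e * T) by ring.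
  pose proof (exp_pos (2 * INR n * lambda * e * T)); field; lra.
Qed.

(** By [solves_point] the value of [K] determines the parameter [s], because [K] is injective along
    the linear flow. *)
Lemma solves_unique (e : R) (v w : R -> plane) (T : R) :
  solves e v T -> solves e w T -> v 0 = w 0 -> v T = w T.
Proof.
  intros Hv Hw H; destruct (classic (v 0 = (0, 0))) as [H0|H0].
  - rewrite (solves_origin e v T Hv H0); symmetry; apply (solves_origin e w T Hw); congruence.
  - assert (H0' : w 0 <> (0, 0)) by congruence.
    destruct (solves_point e v T Hv H0) as [s [-> Hs]].
    destruct (solves_point e w T Hw H0') as [s' [-> Hs']].
    rewrite <- H in Hs' |- *; rewrite <- Hs in Hs'.
    now rewrite (timefun_flow_inj lambda B phi n) with (v := v 0) (s := s') (t := s).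
Qed.

(** For nonzero [p] such a time exists exactly when [k] is positive; otherwise [epsilon] returns an
    arbitrary value. *)
Definition clock_inverse (p : plane) (k : R) : R :=
  epsilon (inhabits 0) (fun s => K (flow B s p) = k).

Lemma clock_inverse_spec (p : plane) (k : R) :
  p <> (0, 0) -> 0 < k -> K (flow B (clock_inverse p k) p) = k.
Proof.
  intros Hp Hk; apply (epsilon_spec (inhabits 0) (fun s => K (flow B s p) = k)).
  now apply timefun_flow_surj.
Qed.

Lemma clock_inverse_unique (p : plane) (s : R) :
  p <> (0, 0) -> clock_inverse p (K (flow B s p)) = s.
Proof.
  intros Hp; apply (timefun_flow_inj lambda B phi n) with (v := p); auto.
  apply clock_inverse_spec; auto; now apply timefun_pos, flow_neq0.
Qed.

(** The formula of [solves_point] solved for [s]. It yields a solution while the argument of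
    [clock_inverse] is positive: for all times if [1 <= K p], and for all [t >= 0] in any case. *)
Definition trajectory (p : plane) (t : R) : plane :=
  sc (exp (lambda * t))
     (flow B (clock_inverse p (K p + exp (2 * INR n * lambda * t) - 1)) p).

Lemma trajectory_0 (p : plane) : p <> (0, 0) -> trajectory p 0 = p.
Proof.
  intros Hp; unfold trajectory; rewrite !Rmult_0_r, exp_0, sc_1.
  replace (K p + 1 - 1) with (K (flow B 0 p)) by (rewrite flow_0; ring).
  now rewrite clock_inverse_unique, flow_0.
Qed.

Lemma trajectory_derive (p : plane) (t : R) :
  p <> (0, 0) -> 0 < K p + exp (2 * INR n * lambda * t) - 1 ->
  is_derive (trajectory p) t (field (trajectory p t)).
Proof.
  intros Hp Hk; set (k := K p + exp (2 * INR n * lambda * t) - 1) in *.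
  assert (Hc : is_derive (clock_inverse p) k (/ rate lambda B phi n p (clock_inverse p k))).
  (* The radius [k] about [k] keeps the arguments positive. *)
  { apply (inverse_derive (fun s => K (flow B s p)) (rate lambda B phi n p)
      (clock_inverse p) k (mkposreal k Hk)).
    - intros s; now apply timefun_derive.
    - intros s; now apply rate_pos.
    - simpl; intros z Hz; apply clock_inverse_spec; auto.
      apply Rabs_def2 in Hz; lra. }
  assert (Hs := derive_comp (clock_inverse p) (fun t => K p + exp (2 * INR n * lambda * t) - 1) t _ _ Hc
    (derive_sub _ _ _ _ _ (derive_add _ _ _ _ _ (derive_const (K p) t)
       (derive_exp _ _ _ (derive_lin (2 * INR n * lambda) t))) (derive_const 1 t))).
  eapply is_derive_val_plane.
  - unfold trajectory; apply is_derive_sc; [apply derive_exp, derive_lin|].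
    apply (derive_flow_along B (fun t => clock_inverse p (K p + exp (2 * INR n * lambda * t) - 1))
      (fun _ => p)); [exact Hs|apply (is_derive_const p)].
  - unfold trajectory; fold k; change (zero : plane) with ((0, 0) : plane).
    rewrite flow_origin, field_eq, (phi_sc phi n phi_hom), exp_pow, INR_2n.
    pose proof (phi_pos _ (flow_neq0 B (clock_inverse p k) p Hp)).
    pose proof (rate_const_pos lambda n lambda_pos n_pos).
    replace (2 * INR n * (lambda * t)) with (2 * INR n * lambda * t) by ring.
    apply plane_eq; unfold rate, sc, plus, mat_app; simpl; unfold plus; simpl; field; nra.
Qed.

Lemma solves_opp (v : R -> plane) (T : R) :
  (forall t, Rmin 0 T <= t <= Rmax 0 T -> is_derive v t (opp (field (v t)))) <-> solves (-1) v T.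
Proof.
  assert (E : forall w : plane, opp w = sc (-1) w).
  { intros w; apply plane_eq; [change (- fst w = -1 * fst w)|change (- snd w = -1 * snd w)]; ring. }
  split; intros H t Ht; specialize (H t Ht); [rewrite <- E|rewrite E]; exact H.
Qed.

Lemma solves_plus (v : R -> plane) (T : R) :
  (forall t, Rmin 0 T <= t <= Rmax 0 T -> is_derive v t (field (v t))) <-> solves 1 v T.
Proof. split; intros H t Ht; specialize (H t Ht); [rewrite sc_1|rewrite sc_1 in H]; exact H. Qed.

Lemma derive_reverse (v : R -> plane) (t : R) (l : plane) :
  is_derive v (- t) l -> is_derive (fun t => v (- t)) t (opp l).
Proof.
  intros H; eapply is_derive_val_plane.
  - apply (derive_comp_plane v (fun t => - t) t (- 1) l); [exact H|].
    apply derive_opp, derive_id.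
  - apply plane_eq; [change (-1 * fst l = - fst l)|change (-1 * snd l = - snd l)]; ring.
Qed.

Lemma forward_exists (p : plane) : p <> (0, 0) -> forward_solution field p (trajectory p).
Proof.
  intros Hp; split; [now apply trajectory_0|]; intros t Ht; apply trajectory_derive; auto.
  pose proof (timefun_pos lambda B phi n lambda_pos n_pos phi_hom phi_pos B_neg p Hp).
  pose proof (rate_const_pos lambda n lambda_pos n_pos).
  pose proof (exp_ineq1_le (2 * INR n * lambda * t)); nra.
Qed.

Lemma global_exists (p : plane) :
  p <> (0, 0) -> 1 <= K p -> global_solution field (trajectory p).
Proof.
  intros Hp HK t _; apply trajectory_derive; auto.
  pose proof (exp_pos (2 * INR n * lambda * t)); lra.
Qed.

Lemma backward_exists (p : plane) :
  p <> (0, 0) -> 1 <= K p ->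
  forward_solution (fun v => opp (field v)) p (fun t => trajectory p (- t)).
Proof.
  intros Hp HK; split; [rewrite Ropp_0; now apply trajectory_0|].
  intros t _; apply derive_reverse, global_exists; auto.
Qed.

Lemma forward_solves (v : R -> plane) (p : plane) (T : R) :
  forward_solution field p v -> 0 <= T -> solves 1 v T.
Proof.
  intros [_ H] HT; apply solves_plus; intros t Ht; apply H.
  rewrite Rmin_left in Ht; lra.
Qed.

Lemma backward_solves (v : R -> plane) (p : plane) (T : R) :
  forward_solution (fun v => opp (field v)) p v -> 0 <= T -> solves (-1) v T.
Proof.
  intros [_ H] HT; apply solves_opp; intros t Ht; apply H.
  rewrite Rmin_left in Ht; lra.
Qed.

Lemma global_solves (v : R -> plane) (T : R) : global_solution field v -> solves 1 v T.
Proof. intros H; apply solves_plus; intros t Ht; now apply H. Qed.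

End Solutions.

(** * The invariant circle *)

Lemma pow_ge_self (x : R) (n : nat) : (1 <= n)%nat -> 1 <= x -> x <= x ^ n.
Proof.
  intros Hn Hx; replace n with (S (pred n)) by lia; simpl.
  pose proof (pow_R1_Rle x (pred n) Hx); nra.
Qed.

Lemma pow_le_self (x : R) (n : nat) : (1 <= n)%nat -> 0 <= x <= 1 -> x ^ n <= x.
Proof.
  intros Hn Hx; replace n with (S (pred n)) by lia; simpl.
  pose proof (pow_incr x 1 (pred n) Hx) as Hp; rewrite pow1 in Hp.
  pose proof (pow_le x (pred n) (proj1 Hx)); nra.
Qed.

Lemma pow_lt_inv (x y : R) (n : nat) : 0 <= y -> x ^ n < y ^ n -> x < y.
Proof.
  intros Hy H; apply Rnot_le_lt; intros Hle.
  pose proof (pow_incr y x n (conj Hy Hle)); lra.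
Qed.

Lemma pow_le_inv (x y : R) (n : nat) : (1 <= n)%nat -> 0 <= y -> x ^ n <= y ^ n -> x <= y.
Proof.
  intros Hn Hy H; apply Rnot_lt_le; intros Hlt.
  assert (H' : y ^ n < x ^ n); [|lra].
  replace n with (S (pred n)) by lia; clear H; simpl.
  pose proof (pow_incr y x (pred n) (conj Hy (Rlt_le _ _ Hlt))).
  pose proof (pow_lt x (pred n) ltac:(lra)); pose proof (pow_le y (pred n) Hy); nra.
Qed.

Lemma dot_ball (v : plane) (e : R) : 0 < e -> dot v v < e * e -> ball ((0, 0) : plane) e v.
Proof.
  intros He H; unfold dot in H.
  apply (proj2 (ball_plane _ _ _)); simpl.
  split; rewrite Rminus_0_r; apply Rabs_def1; nra.
Qed.

Lemma ball_dot (v : plane) (e : R) : ball ((0, 0) : plane) e v -> dot v v < 2 * (e * e).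
Proof.
  intros H; apply (proj1 (ball_plane _ _ _)) in H; simpl in H; rewrite !Rminus_0_r in H.
  destruct H as [H1 H2]; apply Rabs_def2 in H1; apply Rabs_def2 in H2; unfold dot; nra.
Qed.

Definition unit (v : plane) : plane := sc (/ sqrt (dot v v)) v.

Lemma sqrt_dot_pos (v : plane) : v <> (0, 0) -> 0 < sqrt (dot v v).
Proof. intros Hv; apply sqrt_lt_R0, dot_pos, Hv. Qed.

Lemma dot_unit (v : plane) : v <> (0, 0) -> dot (unit v) (unit v) = 1.
Proof.
  intros Hv; pose proof (sqrt_dot_pos v Hv) as Hs.
  pose proof (sqrt_sqrt (dot v v) (dot_nonneg v)) as Hq.
  unfold unit; rewrite dot_sc, <- Hq; rewrite Hq; field_simplify_eq; [|lra].
  rewrite <- Hq at 1; ring.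
Qed.

Lemma unit_neq0 (v : plane) : v <> (0, 0) -> unit v <> (0, 0).
Proof. intros Hv; apply dot_pos_neq0; rewrite dot_unit; auto; lra. Qed.

Lemma cont_unit (v : plane) : v <> (0, 0) -> continuous unit v.
Proof.
  intros Hv; unfold unit; apply cont_sc; [|apply continuous_id].
  apply cont_inv; [|apply Rgt_not_eq, sqrt_dot_pos, Hv].
  apply cont_sqrt, cont_dot; apply continuous_id.
Qed.

Lemma unit_sc (r : R) (v : plane) : 0 < r -> v <> (0, 0) -> unit (sc r v) = unit v.
Proof.
  intros Hr Hv; unfold unit; rewrite dot_sc, sc_sc.
  rewrite sqrt_mult_alt, sqrt_square by nra.
  pose proof (sqrt_dot_pos v Hv); f_equal; field; lra.
Qed.

Lemma unit_of_unit (v : plane) : dot v v = 1 -> unit v = v.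
Proof. intros H; unfold unit; rewrite H, sqrt_1, Rinv_1; apply sc_1. Qed.

(** For a unit vector, the component of [B u] orthogonal to [u]: the field that the linear flow
    induces on directions. *)
Definition tangential (B : @matrix R 2 2) (u : plane) : plane :=
  minus (mat_app B u) (sc (dot u (mat_app B u)) u).

Lemma mat_app_sc (B : @matrix R 2 2) (r : R) (v : plane) :
  mat_app B (sc r v) = sc r (mat_app B v).
Proof. unfold mat_app, sc; apply plane_eq; simpl; ring. Qed.

(** The radial term with coefficient [a] disappears under normalization, so [lambda] has no effect
    on directions. *)
Lemma derive_unit (B : @matrix R 2 2) (v : R -> plane) (t a p : R) :
  v t <> (0, 0) ->
  is_derive v t (plus (sc a (v t)) (sc p (mat_app B (v t)))) ->
  is_derive (fun t => unit (v t)) t (sc p (tangential B (unit (v t)))).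
Proof.
  intros H0 Hv; destruct (is_derive_coords _ _ _ Hv) as [H1 H2].
  pose proof (sqrt_dot_pos _ H0) as Hs; pose proof (dot_pos _ H0) as Hd.
  pose proof (sqrt_sqrt (dot (v t) (v t)) (Rlt_le _ _ Hd)) as Hq.
  assert (Hdd := derive_add _ _ _ _ _ (derive_mul _ _ _ _ _ H1 H1) (derive_mul _ _ _ _ _ H2 H2)).
  assert (Hr := derive_comp _ (fun t => dot (v t) (v t)) t _ _
    (is_derive_sqrt (fun x => x) _ 1 (derive_id _) Hd) Hdd).
  assert (Hi := is_derive_inv _ _ _ Hr (Rgt_not_eq _ _ Hs)).
  eapply is_derive_val_plane.
  - unfold unit; apply is_derive_sc; [exact Hi|exact Hv].
  - unfold tangential, unit; rewrite mat_app_sc.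
    set (S := sqrt (dot (v t) (v t))) in *.
    set (m := mat_app B (v t)); clearbody m.
    set (x := v t) in *; clearbody S x; clear - Hs Hq.
    assert (E : (fst x * fst x + snd x * snd x) / S ^ 2 = 1).
    { unfold dot in Hq; rewrite <- Hq; field; lra. }
    assert (E' : forall X M : R,
      - (((a * fst x + p * fst m) * fst x + fst x * (a * fst x + p * fst m) +
       ((a * snd x + p * snd m) * snd x + snd x * (a * snd x + p * snd m))) * (1 / (2 * S))) / S ^ 2 * X +
       / S * (a * X + p * M) =
       p * (/ S * M - (/ S * fst x * (/ S * fst m) + / S * snd x * (/ S * snd m)) * (/ S * X))).
    { intros X M.
      transitivity (- (a * ((fst x * fst x + snd x * snd x) / S ^ 2) +
        p * (fst x * fst m + snd x * snd m) / S ^ 2) / S * X + / S * (a * X + p * M)); [field; lra|].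
      rewrite E; field; lra. }
    apply plane_eq; [exact (E' (fst x) (fst m))|exact (E' (snd x) (snd m))].
Qed.

Lemma cont_continuous_on {V : UniformSpace} (S : plane -> Prop) (h : plane -> V) :
  (forall p, S p -> continuous h p) -> continuous_on S h.
Proof.
  intros H p Hp; apply filterlim_filter_le_1 with (2 := H p Hp).
  intros P [d Hd]; exists d; intros q Hq _; now apply Hd.
Qed.

Section Circle.

Variables (lambda : R) (B : @matrix R 2 2) (phi : plane -> R) (n : nat).
Hypothesis lambda_pos : 0 < lambda.
Hypothesis n_pos : (1 <= n)%nat.
Hypothesis phi_hom : homogeneous_poly (2 * n) phi.
Hypothesis phi_pos : positive_definite phi.
Hypothesis B_neg : negative_definite (quad_form B).

Notation field := (vector_field lambda B phi).
Notation K := (timefun lambda B phi n).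

Definition level_circle (v : plane) : Prop := v <> (0, 0) /\ K v = 1.

(** The root of order [2 n] of [K v]. By homogeneity it is the positive factor that carries [v] to
    the level [K = 1]. *)
Definition circle_radius (v : plane) : R := exp (ln (K v) / (2 * INR n)).

Lemma INR_n_pos : 0 < INR n.
Proof. apply lt_0_INR; lia. Qed.

Lemma K_pos (v : plane) : v <> (0, 0) -> 0 < K v.
Proof. intros; now apply timefun_pos. Qed.

Lemma radius_pow (v : plane) : v <> (0, 0) -> circle_radius v ^ (2 * n) = K v.
Proof.
  intros Hv; pose proof INR_n_pos; unfold circle_radius; rewrite exp_pow, INR_2n.
  replace (2 * INR n * (ln (K v) / (2 * INR n))) with (ln (K v)) by (field; lra).
  apply exp_ln, K_pos, Hv.
Qed.

Lemma radius_sc (r : R) (v : plane) : 0 < r -> v <> (0, 0) -> circle_radius (sc r v) = circle_radius v / r.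
Proof.
  intros Hr Hv; pose proof INR_n_pos; unfold circle_radius.
  rewrite timefun_sc by (auto; lra).
  unfold Rdiv at 2; rewrite ln_mult; [|now apply K_pos|apply Rinv_0_lt_compat, pow_lt, Hr].
  rewrite ln_Rinv, ln_pow, INR_2n by (auto using pow_lt).
  replace ((ln (K v) + - (2 * INR n * ln r)) / (2 * INR n)) with
    (ln (K v) / (2 * INR n) + - ln r) by (field; lra).
  rewrite exp_plus, exp_Ropp, exp_ln; auto.
Qed.

Lemma radius_circle (v : plane) : level_circle v -> circle_radius v = 1.
Proof. intros [_ H]; unfold circle_radius; rewrite H, ln_1; unfold Rdiv; rewrite Rmult_0_l; apply exp_0. Qed.

Lemma level_circle_sc (v : plane) : v <> (0, 0) -> level_circle (sc (circle_radius v) v).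
Proof.
  intros Hv; assert (Hr : circle_radius v <> 0) by apply Rgt_not_eq, exp_pos; split.
  - now apply sc_neq0.
  - rewrite timefun_sc, radius_pow by auto; pose proof (K_pos v Hv); field; lra.
Qed.

Lemma cont_radius (v : plane) : v <> (0, 0) -> continuous circle_radius v.
Proof.
  intros Hv; pose proof INR_n_pos; assert (Hc : continuous K v) by now apply timefun_cont.
  unfold circle_radius; cont; [now apply K_pos|lra].
Qed.

Definition circle_curve (t : R) : plane := sc (circle_radius (cos t, sin t)) (cos t, sin t).

Lemma circle_curve_neq0 (t : R) : circle_curve t <> (0, 0).
Proof. apply sc_neq0; [apply Rgt_not_eq, exp_pos|apply cos_sin_neq0]. Qed.

Lemma unit_circle_curve (t : R) : unit (circle_curve t) = (cos t, sin t).
Proof.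
  unfold circle_curve; rewrite unit_sc; [|apply exp_pos|apply cos_sin_neq0].
  apply unit_of_unit, dot_cos_sin.
Qed.

Lemma circle_curve_of (r t : R) :
  0 < r -> level_circle (sc r (cos t, sin t)) -> sc r (cos t, sin t) = circle_curve t.
Proof.
  intros Hr H; apply radius_circle in H.
  rewrite radius_sc in H by (auto using cos_sin_neq0).
  unfold circle_curve; f_equal; apply Rmult_eq_reg_r with (/ r); [|apply Rinv_neq_0_compat; lra].
  unfold Rdiv in H; rewrite H; field; lra.
Qed.

Lemma circle_curve_param : circle_param circle_curve level_circle.
Proof.
  split; [|split].
  - intros t; unfold circle_curve; apply cont_sc; [|cont].
    apply (cont_comp_plane circle_radius (fun t => (cos t, sin t) : plane)); [cont|].
    apply cont_radius, cos_sin_neq0.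
  - intros s t; split.
    + intros H; apply (f_equal unit) in H; rewrite !unit_circle_curve in H.
      injection H; intros; apply cos_sin_inj; auto.
    + intros [k Hk]; subst t; unfold circle_curve.
      destruct (cos_sin_period s k) as [-> ->]; auto.
  - intros p; split.
    + intros Hp; destruct (polar p (proj1 Hp)) as [r [t [Hr [_ ->]]]].
      exists t; symmetry; now apply circle_curve_of.
    + intros [t <-]; apply (level_circle_sc (cos t, sin t)), cos_sin_neq0.
Qed.

Lemma solves_level_circle (e : R) (v : R -> plane) (T : R) :
  solves lambda B phi e v T -> level_circle (v 0) -> level_circle (v T).
Proof.
  intros Hv [H0 H1]; split.
  - apply (solves_neq0 lambda B phi n) with (e := e); auto.
  - rewrite (solves_time lambda B phi n) with (e := e) by auto; rewrite H1; ring.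
Qed.

Lemma same_orbit_solves (p q : plane) :
  same_orbit field p q -> exists v t, solves lambda B phi 1 v t /\ v 0 = p /\ v t = q.
Proof.
  intros [v [a [b [t [H0 [Ht [Hv [Hp Hq]]]]]]]]; exists v, t; split; auto.
  apply solves_plus; intros s Hs; apply Hv; revert Hs.
  unfold Rmin, Rmax; repeat destruct Rle_dec; lra.
Qed.

Lemma level_circle_invariant : invariant field level_circle.
Proof.
  split.
  - intros p [Hp HK]; exists (trajectory lambda B phi n p); split.
    + apply global_exists; auto; lra.
    + now apply trajectory_0.
  - intros p q Hp Hpq; destruct (same_orbit_solves p q Hpq) as [v [t [Hv [<- <-]]]].
    now apply solves_level_circle with (e := 1).
Qed.

(** The reciprocal of [K] extends continuously by [0], so the intermediate value theorem applies to
    paths that start at the origin. *)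
Definition gauge (v : plane) : R :=
  if excluded_middle_informative (v = (0, 0)) then 0 else / K v.

Lemma gauge_neq0 (v : plane) : v <> (0, 0) -> gauge v = / K v.
Proof. intros Hv; unfold gauge; destruct excluded_middle_informative; tauto. Qed.

Lemma gauge_origin : gauge (0, 0) = 0.
Proof. unfold gauge; destruct excluded_middle_informative; tauto. Qed.

Lemma cont_gauge (v : plane) : continuous gauge v.
Proof.
  destruct (classic (v = (0, 0))) as [->|Hv].
  - destruct (timefun_bounds lambda B phi n) as [k1 [k2 [Hk1 [Hk2 Hb]]]]; auto.
    apply filterlim_locally; intros e; rewrite gauge_origin.
    set (d := Rmin (1 / 2) (e / (2 * k2))).
    assert (He := cond_pos e).
    assert (Hd : 0 < d) by (apply Rmin_glb_lt; [lra|apply Rdiv_lt_0_compat; lra]).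
    assert (Hd1 : d <= 1 / 2) by apply Rmin_l.
    assert (Hd2 : k2 * d <= e / 2).
    { replace (e / 2) with (k2 * (e / (2 * k2))) by (field; lra).
      apply Rmult_le_compat_l; [lra|apply Rmin_r]. }
    exists (mkposreal d Hd); intros w Hw; apply ball_dot in Hw; simpl in Hw.
    change (Rabs (gauge w - 0) < e); rewrite Rminus_0_r.
    destruct (classic (w = (0, 0))) as [->|Hw0]; [rewrite gauge_origin, Rabs_R0; auto|].
    rewrite gauge_neq0 by auto.
    pose proof (Rinv_0_lt_compat _ (K_pos w Hw0)); rewrite Rabs_right by lra.
    pose proof (dot_pos w Hw0).
    pose proof (pow_le_self (dot w w) n n_pos ltac:(nra)).
    specialize (Hb w Hw0); nra.
  - apply (continuous_ext_loc _ (fun v => / K v)).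
    + apply (filter_imp (fun w : plane => w <> (0, 0))); [|now apply locally_neq0].
      intros w Hw; symmetry; now apply gauge_neq0.
    + apply cont_inv; [now apply timefun_cont|apply Rgt_not_eq, K_pos, Hv].
Qed.

(** Along a path from the origin [gauge] starts at [0], and it exceeds [1] far out; in between it
    would take the value [1], which is the circle. *)
Lemma level_circle_surrounds : surrounds level_circle (0, 0).
Proof.
  split; [intros [H _]; auto|].
  destruct (timefun_bounds lambda B phi n) as [k1 [k2 [Hk1 [Hk2 Hb]]]]; auto.
  (* Beyond this bound the squared norm is at least [1], so its power [n] is still larger than
     [/ k1] and [gauge] exceeds [1]. *)
  exists (1 + / k1); intros sigma Hs H0 Hav.
  apply Rnot_lt_le; intros Hlt.
  assert (Hk : 0 < / k1) by now apply Rinv_0_lt_compat.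
  assert (Hs1 : sigma 1 <> (0, 0)) by (apply dot_pos_neq0; lra).
  assert (Hg1 : 1 < gauge (sigma 1)).
  { rewrite gauge_neq0 by auto; destruct (Hb _ Hs1) as [Hl _].
    pose proof (pow_ge_self (dot (sigma 1) (sigma 1)) n n_pos ltac:(lra)).
    assert (k1 * / k1 = 1) by (field; lra); nra. }
  destruct (IVT_gen (fun t => gauge (sigma t)) 0 1 1) as [t [Ht Hgt]].
  - intros t; apply cont_pt, (cont_comp_plane gauge sigma); auto using cont_gauge.
  - rewrite H0, gauge_origin, Rmin_left, Rmax_right; lra.
  - rewrite Rmin_left, Rmax_right in Ht by lra.
    apply (Hav t Ht); assert (Hn : sigma t <> (0, 0)).
    { intros E; rewrite E, gauge_origin in Hgt; lra. }
    split; auto; rewrite gauge_neq0 in Hgt by auto.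
    rewrite <- (Rinv_inv (K (sigma t))), Hgt; apply Rinv_1.
Qed.

Lemma level_circle_bounds :
  exists m M, 0 < m /\ 0 < M /\ forall v, level_circle v -> m <= dot v v <= M.
Proof.
  destruct (timefun_bounds lambda B phi n) as [k1 [k2 [Hk1 [Hk2 Hb]]]]; auto.
  assert (H1 := Rinv_0_lt_compat _ Hk1); assert (H2 := Rinv_0_lt_compat _ Hk2).
  exists (Rmin 1 (/ k2)), (1 + / k1); repeat split; try lra.
  - apply Rmin_glb_lt; lra.
  - destruct H as [Hv HK]; destruct (Hb v Hv) as [_ Hu]; rewrite HK, Rinv_1 in Hu.
    apply Rnot_lt_le; intros Hlt.
    assert (dot v v < 1) by (eapply Rlt_le_trans; [exact Hlt|apply Rmin_l]).
    assert (dot v v < / k2) by (eapply Rlt_le_trans; [exact Hlt|apply Rmin_r]).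
    pose proof (dot_nonneg v).
    pose proof (pow_le_self (dot v v) n n_pos ltac:(lra)).
    assert (k2 * / k2 = 1) by (field; lra); nra.
  - destruct H as [Hv HK]; destruct (Hb v Hv) as [Hl _]; rewrite HK, Rinv_1 in Hl.
    apply Rnot_lt_le; intros Hlt.
    pose proof (pow_ge_self (dot v v) n n_pos ltac:(lra)).
    assert (k1 * / k1 = 1) by (field; lra); nra.
Qed.

Lemma exp_opp_small (c d : R) :
  0 < c -> 0 < d -> exists T, 0 <= T /\ forall t, T <= t -> 0 < exp (- (c * t)) < d.
Proof.
  intros Hc Hd; exists (/ (c * d)).
  assert (H0 : 0 < / (c * d)) by (apply Rinv_0_lt_compat; nra).
  split; [lra|]; intros t Ht; split; [apply exp_pos|].
  rewrite exp_Ropp; pose proof (exp_ineq1_le (c * t)).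
  assert (Hct : / d <= c * t).
  { apply Rle_trans with (c * / (c * d)); [right; field; lra|nra]. }
  pose proof (Rinv_0_lt_compat d Hd).
  rewrite <- (Rinv_inv d); apply Rinv_lt_contravar; nra.
Qed.

(** The radial projection of [v t] to the circle serves as the nearby point. Their difference is
    [1 - / circle_radius (v t)] times a point of the bounded circle, and the factor tends to zero by
    [solves_time]. *)
Lemma level_circle_attracts : attracts_all_nonzero field level_circle.
Proof.
  intros p Hp; split.
  { exists (trajectory lambda B phi n p); now apply forward_exists. }
  intros v Hv eps; pose proof (cond_pos eps) as He.
  assert (H0 : v 0 = p) by apply Hv.
  pose proof INR_n_pos as Hn; pose proof (rate_const_pos lambda n lambda_pos n_pos) as Hc.
  set (c := 2 * INR n * lambda) in *.
  destruct level_circle_bounds as [m [M [Hm [HM Hb]]]].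
  (* At [x = exp (- (c * t))] this is [1 - / circle_radius (v t)]; continuity at [x = 0] gives the
     limit. *)
  set (g := fun x => 1 - exp (- (ln (1 + (K p - 1) * x) / (2 * INR n)))).
  assert (Hg : continuous g 0).
  { unfold g; cont; rewrite ?Rmult_0_r; lra. }
  assert (Hg0 : g 0 = 0).
  { unfold g; rewrite Rmult_0_r, Rplus_0_r, ln_1; unfold Rdiv; rewrite Rmult_0_l, Ropp_0, exp_0; ring. }
  assert (Hq : 0 < eps / (1 + M)) by (apply Rdiv_lt_0_compat; lra).
  destruct (proj1 (filterlim_locally _ _) Hg (mkposreal _ Hq)) as [d Hd].
  destruct (exp_opp_small c d Hc (cond_pos d)) as [T [HT0 HT]].
  exists T; intros t Ht; destruct (HT t Ht) as [Hx1 Hx2].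
  assert (Hs : solves lambda B phi 1 v t) by (apply forward_solves with (p := p); auto; lra).
  assert (Hv0 : v 0 <> (0, 0)) by congruence.
  assert (Hvt : v t <> (0, 0)) by (apply (solves_neq0 lambda B phi n) with (e := 1); auto).
  assert (HK : K (v t) = 1 + (K p - 1) * exp (- (c * t))).
  { rewrite (solves_time lambda B phi n) with (e := 1) by auto; rewrite H0, Rmult_1_r; auto. }
  specialize (Hd (exp (- (c * t)))); rewrite Hg0 in Hd.
  assert (Hgx : Rabs (g (exp (- (c * t)))) < eps / (1 + M)).
  { rewrite <- (Rminus_0_r (g _)); apply Hd.
    change (Rabs (exp (- (c * t)) - 0) < d); rewrite Rminus_0_r, Rabs_right; lra. }
  assert (Hrad : g (exp (- (c * t))) = 1 - / circle_radius (v t)).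
  { unfold g, circle_radius; rewrite <- HK, exp_Ropp; auto. }
  rewrite Hrad in Hgx.
  exists (sc (circle_radius (v t)) (v t)); assert (Hcq := level_circle_sc (v t) Hvt).
  split; auto; apply Hb in Hcq.
  assert (Hr : 0 < circle_radius (v t)) by apply exp_pos.
  assert (Hco : forall x, x * x <= M -> Rabs (/ circle_radius (v t) * x - x) < eps).
  { intros x Hx.
    replace (/ circle_radius (v t) * x - x) with (- ((1 - / circle_radius (v t)) * x)) by ring.
    rewrite Rabs_Ropp, Rabs_mult.
    assert (Hxa : Rabs x <= 1 + M) by (apply Rabs_le; nra).
    pose proof (Rabs_pos x); pose proof (Rabs_pos (1 - / circle_radius (v t))).
    apply Rle_lt_trans with (Rabs (1 - / circle_radius (v t)) * (1 + M)); [nra|].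
    apply Rlt_le_trans with (eps / (1 + M) * (1 + M)); [nra|right; field; lra]. }
  apply (proj2 (ball_plane _ _ _)).
  unfold dot, sc in Hcq; simpl in Hcq; simpl.
  split.
  - replace (fst (v t)) with (/ circle_radius (v t) * (circle_radius (v t) * fst (v t))) at 1 by (field; lra).
    apply Hco; nra.
  - replace (snd (v t)) with (/ circle_radius (v t) * (circle_radius (v t) * snd (v t))) at 1 by (field; lra).
    apply Hco; nra.
Qed.

Lemma poincare_field_boundary (w : plane) :
  dot w w = 1 -> poincare_field lambda B phi n w = sc (phi w) (tangential B w).
Proof.
  intros Hw; unfold poincare_field; rewrite Hw, Nat.add_1_r.
  replace (1 - 1) with 0 by ring; rewrite pow_i by lia.
  unfold nonlinearity, tangential; set (m := mat_app B w).
  apply plane_eq.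
  - change (lambda * 0 * fst w + (phi w * fst m - (fst w * (phi w * fst m) + snd w * (phi w * snd m)) * fst w)
      = phi w * (fst m - (fst w * fst m + snd w * snd m) * fst w)); ring.
  - change (lambda * 0 * snd w + (phi w * snd m - (fst w * (phi w * fst m) + snd w * (phi w * snd m)) * snd w)
      = phi w * (snd m - (fst w * fst m + snd w * snd m) * snd w)); ring.
Qed.

Lemma phi_unit (v : plane) : v <> (0, 0) -> phi v = dot v v ^ n * phi (unit v).
Proof.
  intros Hv; pose proof (sqrt_dot_pos v Hv); pose proof (sqrt_sqrt _ (dot_nonneg v)) as Hq.
  unfold unit; rewrite (phi_sc phi n phi_hom), pow_mult, pow_inv.
  replace (sqrt (dot v v) ^ 2) with (dot v v) by (rewrite <- Hq at 1; ring).
  rewrite pow_inv; pose proof (pow_lt _ n (dot_pos v Hv)); field; lra.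
Qed.

(** Under [unit] the velocity on the circle becomes [phi v] times [tangential], and at infinity it
    is [phi (unit v)] times the same vector. The quotient is the power [2 n] of the norm, bounded
    below on the circle, hence a legitimate time change. *)
Lemma level_circle_flow_equivalent :
  flow_equivalent field level_circle (poincare_field lambda B phi n) circle_at_infinity.
Proof.
  exists unit; split.
  - split; [apply cont_continuous_on; intros p [Hp _]; now apply cont_unit|split].
    { intros p [Hp _]; now apply dot_unit. }
    assert (Hne : forall q, circle_at_infinity q -> q <> (0, 0)).
    { intros q Hq; apply dot_pos_neq0; rewrite Hq; lra. }
    exists (fun q => sc (circle_radius q) q); split; [|split; [|split]].
    + apply cont_continuous_on; intros q Hq; apply cont_sc; [|apply continuous_id].
      apply cont_radius; auto.
    + intros q Hq; apply level_circle_sc; auto.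
    + intros p Hp; pose proof (radius_circle p Hp) as H1; destruct Hp as [Hp _].
      pose proof (sqrt_dot_pos p Hp); unfold unit.
      rewrite radius_sc, H1 by (auto using Rinv_0_lt_compat).
      rewrite sc_sc; replace (1 / / sqrt (dot p p) * / sqrt (dot p p)) with 1 by (field; lra).
      apply sc_1.
    + intros q Hq; rewrite unit_sc by (auto; apply exp_pos); now apply unit_of_unit.
  - intros v Hv Hv0.
    assert (HC : forall t, level_circle (v t)).
    { intros t; apply solves_level_circle with (e := 1); auto; now apply global_solves. }
    destruct level_circle_bounds as [m [M [Hm [HM Hb]]]].
    destruct (time_change (fun t => dot (v t) (v t) ^ n) (m ^ n))
      as [tau [iota [_ [_ [Htau [Hincr [Hti [Hit Hiota]]]]]]]].
    + intros t; apply cont_pow, cont_dot; apply (derive_cont_plane v t _ (Hv t I)).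
    + now apply pow_lt.
    + intros t; apply pow_incr; specialize (Hb _ (HC t)); lra.
    + exists (fun r => unit (v (iota r))), tau; split; [|split; [|split; [|split]]]; auto.
      * intros r _; destruct (HC (iota r)) as [Hne _].
        pose proof (pow_lt _ n (dot_pos _ Hne)) as Hd.
        assert (Hu := derive_unit B v (iota r) lambda (phi (v (iota r))) Hne (Hv _ I)).
        eapply is_derive_val_plane.
        -- apply (derive_comp_plane (fun t => unit (v t)) iota r _ _ Hu (Hiota r)).
        -- rewrite poincare_field_boundary by now apply dot_unit.
           rewrite (phi_unit _ Hne), scal_sc, sc_sc; f_equal; field; lra.
      * intros t; apply (derive_cont _ _ _ (Htau t)).
      * intros r; exists (iota r); apply Hti.
      * intros t; rewrite Hit; auto.
Qed.

Lemma field_origin : field (0, 0) = (0, 0).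
Proof. rewrite field_eq, mat_app_traceless; apply plane_eq; unfold traceless, sc, plus; simpl; unfold plus; simpl; ring. Qed.

(** In reversed time [K - 1] grows exponentially, and [K] is comparable to a negative power of the
    norm. Near the origin [K] exceeds [2], so reversed trajectories exist for all time and [K] is at
    least [exp (c * t)]. *)
Lemma origin_source : source field (0, 0).
Proof.
  destruct (timefun_bounds lambda B phi n) as [k1 [k2 [Hk1 [Hk2 Hb]]]]; auto.
  pose proof (rate_const_pos lambda n lambda_pos n_pos) as Hc.
  set (c := 2 * INR n * lambda) in *.
  assert (Hlarge : forall q, q <> (0, 0) -> dot q q < 1 -> 2 * k2 * dot q q < 1 -> 2 < K q).
  { intros q Hq H1 H2; destruct (Hb q Hq) as [_ Hu].
    pose proof (dot_pos q Hq); pose proof (K_pos q Hq).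
    pose proof (pow_le_self (dot q q) n n_pos ltac:(lra)).
    apply Rinv_lt_contravar in H2; [|nra].
    rewrite <- (Rinv_inv (K q)), <- (Rinv_inv 2).
    apply Rinv_lt_contravar; [apply Rmult_lt_0_compat; [now apply Rinv_0_lt_compat|lra]|].
    assert (H2' : 2 * (k2 * dot q q) < 1).
    { rewrite Rinv_1 in H2; apply Rnot_le_lt; intros Hle.
      assert (/ (2 * k2 * dot q q) <= 1); [|lra].
      rewrite <- Rinv_1; apply Rinv_le_contravar; lra. }
    nra. }
  (* The two bounds on [/ K] compare powers of squared norms with the quotient [k2 / k1]. Because
     [1 <= kap <= kap ^ n], the power can be removed from both sides. *)
  set (kap := 1 + k2 / k1).
  assert (Hkap : 1 <= kap) by (unfold kap; pose proof (Rdiv_lt_0_compat _ _ Hk2 Hk1); lra).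
  assert (Hback : forall q v t, q <> (0, 0) -> 2 < K q ->
     forward_solution (fun v => opp (field v)) q v -> 0 <= t ->
     v t <> (0, 0) /\ K (v t) = 1 + (K q - 1) * exp (c * t)).
  { intros q v t Hq HK Hv Ht; assert (H0 : v 0 = q) by apply Hv.
    assert (Hs : solves lambda B phi (-1) v t) by (apply backward_solves with (p := q); auto).
    assert (Hv0 : v 0 <> (0, 0)) by congruence.
    split; [apply (solves_neq0 lambda B phi n) with (e := -1); auto|].
    rewrite (solves_time lambda B phi n) with (e := -1) by auto; fold c.
    rewrite H0; do 3 f_equal; ring. }
  assert (Hzero : forall v t, forward_solution (fun v => opp (field v)) (0, 0) v -> 0 <= t ->
     v t = (0, 0)).
  { intros v t Hv Ht; apply (solves_origin lambda B phi n) with (e := -1); auto.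
    - apply backward_solves with (p := (0, 0)); auto.
    - apply Hv. }
  assert (Hopp0 : opp ((0, 0) : plane) = (0, 0)).
  { apply plane_eq; [change (- 0 = 0)|change (- 0 = 0)]; ring. }
  set (d := Rmin (1 / 2) (/ (2 * (1 + k2)))).
  assert (Hd0 : 0 < d) by (apply Rmin_glb_lt; [lra|apply Rinv_0_lt_compat; lra]).
  assert (Hd1 : d <= 1 / 2) by apply Rmin_l.
  assert (Hd2 : 2 * k2 * d < 1).
  { assert (d <= / (2 * (1 + k2))) by apply Rmin_r.
    assert (/ (2 * (1 + k2)) * (2 * (1 + k2)) = 1) by (field; lra); nra. }
  assert (Hsmall : forall q, q <> (0, 0) -> ball ((0, 0) : plane) d q -> 2 < K q).
  { intros q Hq Hbq; apply ball_dot in Hbq; apply Hlarge; auto; nra. }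
  split; [|split].
  - rewrite field_origin; exact Hopp0.
  - intros eps; pose proof (cond_pos eps) as He.
    set (d' := Rmin d (eps / (2 * kap))).
    assert (Hd' : 0 < d') by (apply Rmin_glb_lt; auto; apply Rdiv_lt_0_compat; lra).
    exists (mkposreal d' Hd'); intros q v _ Hq Hv t Ht; simpl in Hq.
    destruct (classic (q = (0, 0))) as [->|Hq0].
    { rewrite (Hzero v t); auto; apply ball_center. }
    assert (HKq : 2 < K q) by (apply Hsmall; auto; eapply ball_le; [apply Rmin_l|exact Hq]).
    destruct (Hback q v t Hq0 HKq Hv Ht) as [Hvt HKt].
    assert (HKge : K q <= K (v t)).
    { pose proof (exp_ineq1_le (c * t)); pose proof (Rmult_le_pos c t ltac:(lra) Ht).
      rewrite HKt; nra. }
    destruct (Hb q Hq0) as [_ Hu]; destruct (Hb _ Hvt) as [Hl _].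
    pose proof (Rinv_le_contravar _ _ (K_pos q Hq0) HKge) as Hinv.
    pose proof (dot_pos q Hq0) as Hdq; pose proof (pow_lt _ n Hdq) as Hdqn.
    assert (Hpow : dot (v t) (v t) ^ n <= (kap * dot q q) ^ n).
    { rewrite Rpow_mult_distr; pose proof (pow_ge_self kap n n_pos Hkap).
      apply Rle_trans with (kap * dot q q ^ n); [|nra].
      apply Rmult_le_reg_l with k1; auto.
      replace (k1 * (kap * dot q q ^ n)) with ((k1 + k2) * dot q q ^ n) by (unfold kap; field; lra).
      nra. }
    apply pow_le_inv in Hpow; auto; [|nra].
    apply ball_dot in Hq; apply dot_ball; auto.
    assert (Hd'' : kap * d' <= eps / 2).
    { apply Rle_trans with (kap * (eps / (2 * kap))); [apply Rmult_le_compat_l; [lra|apply Rmin_r]|].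
      right; field; lra. }
    assert (d' <= eps / 2) by nra.
    assert (kap * dot q q < kap * (2 * (d' * d'))) by (apply Rmult_lt_compat_l; lra).
    assert (kap * (2 * (d' * d')) <= eps * (eps / 2)) by nra.
    nra.
  - exists (mkposreal d Hd0); intros q _ Hq; simpl in Hq.
    destruct (classic (q = (0, 0))) as [->|Hq0].
    { split.
      - exists (fun _ => (0, 0)); split; auto; intros t _; rewrite field_origin, Hopp0.
        apply (is_derive_const ((0, 0) : plane)).
      - intros v Hv; apply filterlim_locally; intros eps; exists 0; intros t Ht.
        rewrite (Hzero v t); auto; [apply ball_center|lra]. }
    assert (HKq : 2 < K q) by (apply Hsmall; auto).
    split.
    { exists (fun t => trajectory lambda B phi n q (- t)); apply backward_exists; auto; lra. }
    intros v Hv; apply filterlim_locally; intros eps; pose proof (cond_pos eps) as He.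
    assert (He2 : 0 < eps * eps) by nra.
    pose proof (pow_lt _ n He2) as Hen.
    destruct (exp_opp_small c (k1 * (eps * eps) ^ n) Hc ltac:(nra)) as [T [HT0 HT]].
    exists T; intros t Ht; destruct (HT t (Rlt_le _ _ Ht)) as [_ Hexp].
    destruct (Hback q v t Hq0 HKq Hv ltac:(lra)) as [Hvt HKt].
    apply dot_ball; auto.
    apply pow_lt_inv with n; [lra|].
    destruct (Hb _ Hvt) as [Hl _].
    pose proof (exp_pos (c * t)) as Hep.
    assert (HKinv : / K (v t) <= exp (- (c * t))).
    { rewrite exp_Ropp; apply Rinv_le_contravar; auto; rewrite HKt; nra. }
    apply Rmult_lt_reg_l with k1; auto; lra.
Qed.

End Circle.

(** * Equilibria and the discriminant *)

(** [det v (B v)], whose zeros are the invariant lines of [B]. *)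
Definition angular_form (B : @matrix R 2 2) (v : plane) : R :=
  dot (- snd v, fst v) (mat_app B v).

Lemma angular_form_sc (B : @matrix R 2 2) (r : R) (v : plane) :
  angular_form B (sc r v) = r * r * angular_form B v.
Proof. unfold angular_form, dot, mat_app, sc; simpl; ring. Qed.

Lemma angular_eq (B : @matrix R 2 2) (phi : plane -> R) (t : R) :
  angular B phi t = phi (cos t, sin t) * angular_form B (cos t, sin t).
Proof.
  unfold angular, angular_form, nonlinearity; rewrite scal_sc.
  unfold dot, sc; simpl; ring.
Qed.

Lemma angular_form_line (B : @matrix R 2 2) (v : plane) :
  v <> (0, 0) -> angular_form B v = 0 -> exists nu, mat_app B v = sc nu v.
Proof.
  intros Hv H; pose proof (dot_pos v Hv) as Hd.
  exists (dot v (mat_app B v) / dot v v).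
  unfold angular_form in H; destruct (mat_app B v) as [x y]; destruct v as [a b].
  unfold dot, sc in *; simpl in *.
  apply plane_eq; simpl; (apply Rmult_eq_reg_r with (a * a + b * b); [|lra]).
  - transitivity ((a * x + b * y) * a - b * (- b * x + a * y)); [ring|rewrite H; field; lra].
  - transitivity ((a * x + b * y) * b + a * (- b * x + a * y)); [ring|rewrite H; field; lra].
Qed.

Lemma flow_eigenvector (B : @matrix R 2 2) (v : plane) (nu s : R) :
  mat_app B v = sc nu v -> flow B s v = sc (exp (nu * s)) v.
Proof.
  intros H.
  assert (H' := moving_frame B (fun _ => 0) (fun t => t) (fun _ => 0) (fun _ => 1)
    (fun t => sc (exp (nu * t)) v) s (derive_const 0) derive_id eq_refl eq_refl).
  cbv beta in H'; rewrite exp_0, Rmult_0_r, exp_0, !sc_1 in H'.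
  symmetry; apply H'; intros t _.
  eapply is_derive_val_plane.
  - apply (is_derive_sc (fun t => exp (nu * t)) (fun _ => v)).
    + apply derive_exp, derive_lin.
    + apply (is_derive_const v).
  - rewrite mat_app_sc, H; apply plane_eq; unfold sc, plus, zero; simpl; unfold plus, zero; simpl; ring.
Qed.

(** Coordinates in the basis [e], [traceless B e]. *)
Definition frame_x (B : @matrix R 2 2) (e v : plane) : R :=
  dot (- snd v, fst v) (traceless B e) / angular_form B e.

Definition frame_y (B : @matrix R 2 2) (e v : plane) : R :=
  dot (- snd e, fst e) v / angular_form B e.

(** * Coordinates adapted to the matrix *)

Section Frame.

Variables (B : @matrix R 2 2) (e : plane).
Hypothesis e_regular : angular_form B e <> 0.

Notation X := (frame_x B e).
Notation Y := (frame_y B e).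

Lemma angular_form_traceless (v : plane) :
  angular_form B v = dot (- snd v, fst v) (traceless B v).
Proof. unfold angular_form; rewrite mat_app_traceless; unfold dot; simpl; ring. Qed.

Lemma frame_x_sc (r : R) (v : plane) : X (sc r v) = r * X v.
Proof. unfold frame_x, sc, dot; simpl; field; auto. Qed.

Lemma frame_y_sc (r : R) (v : plane) : Y (sc r v) = r * Y v.
Proof. unfold frame_y, sc, dot; simpl; field; auto. Qed.

Lemma frame_x_plus (v w : plane) : X (plus v w) = X v + X w.
Proof.
  change (plus v w) with ((fst v + fst w, snd v + snd w) : plane).
  unfold frame_x, dot; simpl; field; auto.
Qed.

Lemma frame_y_plus (v w : plane) : Y (plus v w) = Y v + Y w.
Proof.
  change (plus v w) with ((fst v + fst w, snd v + snd w) : plane).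
  unfold frame_y, dot; simpl; field; auto.
Qed.

Lemma frame_decomposition (v : plane) : v = plus (sc (X v) e) (sc (Y v) (traceless B e)).
Proof.
  change (v = (X v * fst e + Y v * fst (traceless B e), X v * snd e + Y v * snd (traceless B e))).
  pose proof e_regular as H; unfold frame_x, frame_y; rewrite angular_form_traceless in H |- *.
  set (f := traceless B e) in *; clearbody f.
  unfold dot in *; simpl in *; apply plane_eq; simpl; field; lra.
Qed.

Lemma frame_inj (v w : plane) : X v = X w -> Y v = Y w -> v = w.
Proof. intros H1 H2; rewrite (frame_decomposition v), (frame_decomposition w); congruence. Qed.

Lemma frame_x_origin : X (0, 0) = 0.
Proof. unfold frame_x, dot; simpl; field; auto. Qed.

Lemma frame_y_origin : Y (0, 0) = 0.
Proof. unfold frame_y, dot; simpl; field; auto. Qed.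

(** Since [traceless B] squares to [discr B], it is a companion matrix in this basis, and the flow
    depends on [B] only through [half_trace B] and [discr B]. *)
Lemma frame_x_traceless (v : plane) : X (traceless B v) = discr B * Y v.
Proof.
  unfold frame_x, frame_y, traceless, discr, dot; simpl; field; auto.
Qed.

Lemma frame_y_traceless (v : plane) : Y (traceless B v) = X v.
Proof. unfold frame_x, frame_y, traceless, dot; simpl; field; auto. Qed.

Lemma frame_x_surj (x y : R) : exists v, X v = x /\ Y v = y.
Proof.
  exists (plus (sc x e) (sc y (traceless B e))).
  rewrite frame_x_plus, frame_y_plus, !frame_x_sc, !frame_y_sc, frame_x_traceless, frame_y_traceless.
  assert (H1 : X e = 1) by (unfold frame_x; rewrite <- angular_form_traceless; field; auto).
  assert (H2 : Y e = 0) by (unfold frame_y, dot; simpl; field; auto).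
  rewrite H1, H2; split; ring.
Qed.

(** Up to a constant the form is [X^2 - discr Y^2], so the sign of [discr B] tells the number of
    invariant lines. *)
Lemma frame_angular_form (v : plane) :
  angular_form B v = (X v * X v - discr B * (Y v * Y v)) * angular_form B e.
Proof.
  pose proof e_regular as H; rewrite !angular_form_traceless in *.
  unfold frame_x, frame_y; rewrite !angular_form_traceless.
  unfold traceless, discr, dot in *; simpl in *; field; auto.
Qed.

Lemma frame_flow (s : R) (v : plane) :
  X (flow B s v) = exp (half_trace B * s) * (gcos (discr B) s * X v + discr B * gsin (discr B) s * Y v) /\
  Y (flow B s v) = exp (half_trace B * s) * (gcos (discr B) s * Y v + gsin (discr B) s * X v).
Proof.
  assert (E : flow B s v = sc (exp (half_trace B * s))
    (plus (sc (gcos (discr B) s) v) (sc (gsin (discr B) s) (traceless B v)))) by reflexivity.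
  rewrite E, frame_x_sc, frame_y_sc, frame_x_plus, frame_y_plus, !frame_x_sc, !frame_y_sc,
    frame_x_traceless, frame_y_traceless; split; ring.
Qed.

Lemma cont_frame_x {U : UniformSpace} (v : U -> plane) (x : U) :
  continuous v x -> continuous (fun y => X (v y)) x.
Proof. intros; unfold frame_x, dot; simpl; cont; auto. Qed.

Lemma cont_frame_y {U : UniformSpace} (v : U -> plane) (x : U) :
  continuous v x -> continuous (fun y => Y (v y)) x.
Proof. intros; unfold frame_y, dot; simpl; cont; auto. Qed.

End Frame.

(** If the form vanishes at [(1, 0)], [(0, 1)] and [(1, 1)], the matrix is scalar and its
    discriminant is zero. *)
Lemma discr_regular (B : @matrix R 2 2) : discr B <> 0 -> exists e, angular_form B e <> 0.
Proof.
  intros H; apply NNPP; intros N; apply H.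
  assert (Hz : forall v, angular_form B v = 0).
  { intros v; apply NNPP; intros Hv; apply N; now exists v. }
  pose proof (Hz (1, 0)) as H1; pose proof (Hz (0, 1)) as H2; pose proof (Hz (1, 1)) as H3.
  unfold angular_form, dot, mat_app in H1, H2, H3; simpl in H1, H2, H3.
  unfold discr, half_diff.
  replace (coeff_mat 0 B 0 1) with 0 by lra; replace (coeff_mat 0 B 1 0) with 0 by lra.
  replace (coeff_mat 0 B 0 0) with (coeff_mat 0 B 1 1) by lra; field.
Qed.

(** The real Jordan types: complex eigenvalues, two real eigenvalues, a nontrivial Jordan block, a
    scalar matrix. *)
Definition algebraic_type (T : portrait_type) (B : @matrix R 2 2) : Prop :=
  match T with
  | LimitCycle => discr B < 0
  | FourEquilibria => 0 < discr B
  | TwoSaddleNodes => discr B = 0 /\ exists e, angular_form B e <> 0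
  | CircleOfEquilibria => forall v, angular_form B v = 0
  end.

Lemma algebraic_type_exists (B : @matrix R 2 2) : exists T, algebraic_type T B.
Proof.
  destruct (Rtotal_order (discr B) 0) as [H|[H|H]].
  - now exists LimitCycle.
  - destruct (classic (exists e, angular_form B e <> 0)) as [He|He].
    + now exists TwoSaddleNodes.
    + exists CircleOfEquilibria; intros v; apply NNPP; intros Hv; apply He; now exists v.
  - now exists FourEquilibria.
Qed.

(** * Equilibria as the points of the circle on invariant lines *)

Section Equilibria.

Variables (lambda : R) (B : @matrix R 2 2) (phi : plane -> R) (n : nat).
Hypothesis lambda_pos : 0 < lambda.
Hypothesis n_pos : (1 <= n)%nat.
Hypothesis phi_hom : homogeneous_poly (2 * n) phi.
Hypothesis phi_pos : positive_definite phi.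
Hypothesis B_neg : negative_definite (quad_form B).

Notation field := (vector_field lambda B phi).
Notation K := (timefun lambda B phi n).
Notation circle := (level_circle lambda B phi n).
Notation radius := (circle_radius lambda B phi n).
Notation curve := (circle_curve lambda B phi n).

(** On an eigenvector the flow is a scaling, so [K] along it is an explicit exponential; its
    derivative at [0] is compared with [rate]. Consequently [lambda + phi v * nu = 0], the condition
    for an equilibrium, says the same as [K v = 1]. *)
Lemma eigenvector_timefun (v : plane) (nu : R) :
  v <> (0, 0) -> mat_app B v = sc nu v -> - nu * K v * phi v = lambda.
Proof.
  intros Hv H; pose proof (phi_pos v Hv) as Hp; pose proof (INR_n_pos n n_pos) as Hn.
  assert (Hd := timefun_derive lambda B phi n lambda_pos n_pos phi_hom phi_pos B_neg v 0 Hv).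
  assert (He : is_derive (fun s => K (flow B s v)) 0 (- (2 * INR n * nu) * K v)).
  { apply (is_derive_ext (fun s => exp (- (2 * INR n * nu) * s) * K v)).
    - intros s; rewrite (flow_eigenvector B v nu s H), timefun_sc; auto.
      2: apply Rgt_not_eq, exp_pos.
      rewrite exp_pow, INR_2n.
      replace (- (2 * INR n * nu) * s) with (- (2 * INR n * (nu * s))) by ring.
      match goal with |- ?a = ?b => change (@eq R a b) end.
      rewrite exp_Ropp; pose proof (exp_pos (2 * INR n * (nu * s))); field; lra.
    - eapply is_derive_val.
      + apply (derive_mul _ (fun _ => K v)); [apply derive_exp, derive_lin|apply derive_const].
      + cbv beta; rewrite Rmult_0_r, exp_0; ring. }
  apply is_derive_unique in Hd; apply is_derive_unique in He.
  rewrite Hd in He; unfold rate in He; rewrite flow_0 in He.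
  apply Rmult_eq_reg_l with (2 * INR n); [|lra].
  transitivity (2 * INR n * lambda / phi v * phi v); [rewrite He; ring|field; lra].
Qed.

Lemma field_eigenvector (v : plane) (nu : R) :
  mat_app B v = sc nu v -> field v = sc (lambda + phi v * nu) v.
Proof.
  intros H; rewrite field_eq, H.
  apply plane_eq; unfold sc, plus; simpl; unfold plus; simpl; ring.
Qed.

Lemma equilibrium_angular_form (v : plane) :
  v <> (0, 0) -> equilibrium field v -> angular_form B v = 0.
Proof.
  intros Hv H; unfold equilibrium in H; rewrite field_eq in H.
  pose proof (phi_pos v Hv) as Hp; unfold angular_form.
  destruct (mat_app B v) as [x y]; destruct v as [a b].
  change ((lambda * a + phi (a, b) * x, lambda * b + phi (a, b) * y) = (0, 0)) in H.
  injection H; intros H2 H1; unfold dot; simpl.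
  apply Rmult_eq_reg_l with (phi (a, b)); [|lra].
  transitivity (a * (lambda * b + phi (a, b) * y) - b * (lambda * a + phi (a, b) * x)); [ring|].
  rewrite H1, H2; ring.
Qed.

Lemma equilibrium_iff (v : plane) :
  v <> (0, 0) -> (equilibrium field v <-> circle v /\ angular_form B v = 0).
Proof.
  intros Hv; pose proof (phi_pos v Hv) as Hp; split.
  - intros H; assert (Ha := equilibrium_angular_form v Hv H).
    destruct (angular_form_line B v Hv Ha) as [nu Hnu].
    assert (Hk := eigenvector_timefun v nu Hv Hnu).
    unfold equilibrium in H; rewrite (field_eigenvector v nu Hnu) in H.
    repeat split; auto.
    assert (Hz : lambda + phi v * nu = 0).
    { apply NNPP; intros N; now apply (sc_neq0 _ v N Hv). }
    assert (Hnu0 : nu <> 0) by (intros ->; lra).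
    apply Rmult_eq_reg_l with (- nu * phi v); [nra|].
    apply Rmult_integral_contrapositive; split; lra.
  - intros [[_ HK] Ha]; destruct (angular_form_line B v Hv Ha) as [nu Hnu].
    assert (Hk := eigenvector_timefun v nu Hv Hnu).
    unfold equilibrium; rewrite (field_eigenvector v nu Hnu).
    rewrite HK in Hk; replace (lambda + phi v * nu) with 0 by lra.
    unfold sc; f_equal; ring.
Qed.

Lemma equilibrium_on_ray (v : plane) :
  v <> (0, 0) -> angular_form B v = 0 -> equilibrium field (sc (radius v) v).
Proof.
  intros Hv Ha; assert (Hr := exp_pos (ln (K v) / (2 * INR n))); fold (radius v) in Hr.
  apply equilibrium_iff; [apply sc_neq0; auto; lra|].
  split; [now apply level_circle_sc|rewrite angular_form_sc, Ha; ring].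
Qed.

Lemma circle_equilibrium (v : plane) :
  circle v -> (equilibrium field v <-> angular_form B v = 0).
Proof. intros Hv; rewrite equilibrium_iff by apply Hv; tauto. Qed.

Lemma timefun_opp (v : plane) : v <> (0, 0) -> K (sc (-1) v) = K v.
Proof.
  intros Hv; rewrite timefun_sc by (auto; lra).
  rewrite pow_mult; replace ((-1) ^ 2) with 1 by ring; rewrite pow1; field.
Qed.

Lemma circle_opp (v : plane) : circle v -> circle (sc (-1) v).
Proof. intros [Hv HK]; split; [apply sc_neq0; auto; lra|rewrite timefun_opp; auto]. Qed.

Lemma circle_ray_unique (r : R) (v : plane) : 0 < r -> circle v -> circle (sc r v) -> r = 1.
Proof.
  intros Hr Hv H; apply radius_circle in H; assert (H1 := radius_circle _ _ _ _ v Hv).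
  rewrite radius_sc, H1 in H by (auto; apply Hv).
  apply Rmult_eq_reg_l with (/ r); [|apply Rinv_neq_0_compat; lra].
  rewrite Rinv_l, Rmult_1_r by lra; unfold Rdiv in H; lra.
Qed.

Lemma circle_line (r : R) (v : plane) :
  circle v -> circle (sc r v) -> sc r v = v \/ sc r v = sc (-1) v.
Proof.
  intros Hv H; destruct (Rtotal_order r 0) as [Hr|[->|Hr]].
  - right; apply circle_opp in H; rewrite sc_sc in H.
    apply circle_ray_unique in H; auto; [|lra]; f_equal; lra.
  - destruct H as [H _]; destruct H; unfold sc; f_equal; ring.
  - left; rewrite (circle_ray_unique r v), sc_1; auto.
Qed.

Lemma curve_opp (t : R) : curve (t + PI) = sc (-1) (curve t).
Proof.
  unfold circle_curve; rewrite neg_cos, neg_sin.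
  replace (- cos t, - sin t) with (sc (-1) (cos t, sin t)) by (unfold sc; simpl; f_equal; ring).
  assert (E : radius (sc (-1) (cos t, sin t)) = radius (cos t, sin t)).
  { unfold circle_radius; rewrite timefun_opp; auto using cos_sin_neq0. }
  rewrite E, !sc_sc; f_equal; ring.
Qed.

End Equilibria.

(** * The type is determined by the discriminant *)

Lemma angle_mod (t : R) : exists k : Z, 0 <= t + 2 * PI * IZR k <= 2 * PI.
Proof.
  pose proof PI_RGT_0 as HPI.
  destruct (base_Int_part (t / (2 * PI))) as [H1 H2].
  exists (- Int_part (t / (2 * PI)))%Z; rewrite opp_IZR.
  set (z := IZR (Int_part (t / (2 * PI)))) in *.
  assert (E : t = t / (2 * PI) * (2 * PI)) by (field; lra).
  set (q := t / (2 * PI)) in *; split; nra.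
Qed.

(** A topological circle is compact, hence closed. *)
Lemma circle_param_closed (gamma : R -> plane) (C : plane -> Prop) (p : plane) :
  circle_param gamma C ->
  (forall eps : posreal, exists q, C q /\ ball q eps p) -> C p.
Proof.
  intros [Hc [Hg HC]] Hp; pose proof PI_RGT_0 as HPI.
  set (h := fun t => dot (minus (gamma t) p) (minus (gamma t) p)).
  assert (Hh : forall t, continuity_pt h t).
  { intros t; apply cont_pt; unfold h; apply cont_dot; apply (continuous_minus gamma (fun _ => p));
      auto; apply continuous_const. }
  destruct (continuity_ab_min h 0 (2 * PI)) as [t0 [Hmin Ht0]]; [lra|auto|].
  assert (Hall : forall t, h t0 <= h t).
  { intros t; destruct (angle_mod t) as [k Hk].
    assert (E : gamma t = gamma (t + 2 * PI * IZR k)).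
    { apply Hg; now exists k. }
    unfold h at 2; rewrite E; now apply Hmin. }
  assert (Hz : h t0 = 0).
  { apply NNPP; intros N; assert (H0 : 0 < h t0) by (pose proof (dot_nonneg (minus (gamma t0) p)); unfold h in *; lra).
    assert (He : 0 < Rmin 1 (h t0 / 4)) by (apply Rmin_glb_lt; lra).
    destruct (Hp (mkposreal _ He)) as [q [Hq Hb]].
    destruct (proj1 (HC q) Hq) as [t <-]; specialize (Hall t).
    apply (proj1 (ball_plane _ _ _)) in Hb; simpl in Hb; destruct Hb as [Hb1 Hb2].
    set (e := Rmin 1 (h t0 / 4)) in *.
    assert (e <= 1) by apply Rmin_l; assert (e <= h t0 / 4) by apply Rmin_r.
    apply Rabs_def2 in Hb1; apply Rabs_def2 in Hb2.
    assert (h t = (fst p - fst (gamma t)) * (fst p - fst (gamma t)) +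
                  (snd p - snd (gamma t)) * (snd p - snd (gamma t))).
    { unfold h, dot; change (minus (gamma t) p) with
        ((fst (gamma t) - fst p, snd (gamma t) - snd p) : plane); simpl; ring. }
    nra. }
  apply HC; exists t0; apply dot_eq0 in Hz.
  change ((fst (gamma t0) - fst p, snd (gamma t0) - snd p) = (0, 0)) in Hz.
  injection Hz; intros H2 H1; apply plane_eq; lra.
Qed.

(** Otherwise the straight path along the ray would avoid [C] and end beyond the bound [M]; the
    length [R1] is chosen for that. *)
Lemma surrounds_ray (C : plane -> Prop) (v : plane) :
  surrounds C (0, 0) -> v <> (0, 0) -> exists r, 0 < r /\ C (sc r v).
Proof.
  intros [H0 [M HM]] Hv; apply NNPP; intros N.
  set (R0 := (1 + Rabs M) / dot v v).
  pose proof (dot_pos v Hv) as Hd; pose proof (Rabs_pos M); pose proof (Rle_abs M).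
  assert (HR : 0 < R0) by (apply Rdiv_lt_0_compat; lra).
  set (R1 := 1 + R0).
  assert (Hle := HM (fun t => sc (t * R1) v)).
  cbv beta in Hle; rewrite Rmult_1_l, dot_sc in Hle.
  assert (E : R0 * dot v v = 1 + Rabs M) by (unfold R0; field; lra).
  assert (R1 * R1 * dot v v <= M); [|unfold R1 in *; nra].
  apply Hle.
  - intros t; apply cont_sc; cont.
  - rewrite Rmult_0_l; unfold sc; f_equal; ring.
  - intros t [Ht _] HC; destruct (Req_dec t 0) as [->|Hne].
    + apply H0; rewrite Rmult_0_l in HC; unfold sc in HC; rewrite !Rmult_0_l in HC; exact HC.
    + apply N; exists (t * R1); split; auto; unfold R1; nra.
Qed.

Lemma definite_form_zero (d x y : R) : d < 0 -> x * x - d * (y * y) = 0 -> x = 0 /\ y = 0.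
Proof.
  intros Hd H; assert (Hy : y * y = 0) by nra; assert (Hx : x * x = 0) by nra.
  split; apply Rsqr_0_uniq; auto.
Qed.

Section TypeFromPortrait.

Variables (lambda : R) (B : @matrix R 2 2) (phi : plane -> R) (n : nat).
Hypothesis lambda_pos : 0 < lambda.
Hypothesis n_pos : (1 <= n)%nat.
Hypothesis phi_hom : homogeneous_poly (2 * n) phi.
Hypothesis phi_pos : positive_definite phi.
Hypothesis B_neg : negative_definite (quad_form B).

Notation field := (vector_field lambda B phi).
Notation K := (timefun lambda B phi n).
Notation circle := (level_circle lambda B phi n).
Notation radius := (circle_radius lambda B phi n).
Notation curve := (circle_curve lambda B phi n).

(** The constant solution at [p] has to approach [C], so [p] is in the closure of [C], which is
    closed. *)
Lemma attracting_circle_equilibria (C : plane -> Prop) (p : plane) :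
  topological_circle C -> attracts_all_nonzero field C ->
  p <> (0, 0) -> equilibrium field p -> C p.
Proof.
  intros [gamma Hg] HC Hp He; apply (circle_param_closed gamma C); auto.
  intros eps; destruct (HC p Hp) as [_ H].
  destruct (H (fun _ => p)) with (eps := eps) as [T HT].
  - split; auto; intros t _; rewrite He; apply (is_derive_const p).
  - apply (HT T); lra.
Qed.

(** With a nonnegative discriminant the vector with coordinates [sqrt (discr B)] and [1] is a zero
    of the form. *)
Lemma form_neq0_discr (e : plane) :
  angular_form B e <> 0 ->
  (forall v, v <> (0, 0) -> angular_form B v <> 0) -> discr B < 0.
Proof.
  intros He H; apply Rnot_le_lt; intros Hd.
  destruct (frame_x_surj B e He (sqrt (discr B)) 1) as [v [Hx Hy]].
  apply (H v).
  - intros E; rewrite E, frame_y_origin in Hy by auto; lra.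
  - rewrite (frame_angular_form B e), Hx, Hy by auto; rewrite sqrt_sqrt by auto; ring.
Qed.

(** [algebraic_type] counts the equilibria other than the origin, and all of them
    lie on any circle with the properties required by [has_type]. *)
Lemma has_type_algebraic (T : portrait_type) : has_type T lambda B phi n -> algebraic_type T B.
Proof.
  intros [_ [C [Htop [_ [Hsur [Hatt [_ Hdyn]]]]]]].
  assert (HC0 : ~ C (0, 0)) by apply Hsur.
  assert (Hin : forall p, p <> (0, 0) -> equilibrium field p -> C p).
  { intros p; now apply attracting_circle_equilibria. }
  assert (HCn : forall p, C p -> p <> (0, 0)) by (intros p Hp ->; auto).
  assert (Hform : forall p, C p -> equilibrium field p -> circle p /\ angular_form B p = 0).
  { intros p Hp He; apply equilibrium_iff; auto. }
  assert (Hmany : forall v, v <> (0, 0) -> angular_form B v = 0 ->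
     equilibrium field (sc (radius v) v) /\ sc (radius v) v <> (0, 0)).
  { intros v Hv Hf; split; [now apply equilibrium_on_ray|].
    apply sc_neq0; auto; apply Rgt_not_eq, exp_pos. }
  destruct (algebraic_type_exists B) as [T' HT'].
  destruct T; simpl in Hdyn |- *.
  - destruct Hdyn as [_ Hno].
    assert (Hnz : forall v, v <> (0, 0) -> angular_form B v <> 0).
    { intros v Hv Hf; destruct (Hmany v Hv Hf) as [He Hne].
      exact (Hno _ (Hin _ Hne He) He). }
    apply (form_neq0_discr (1, 0)); auto; apply Hnz; intros E; injection E; lra.
  - destruct Hdyn as [gamma [t1 [t2 [t3 [t4 [[_ [Hg HgC]] [H12 [H23 [H34 [H41 [Heq _]]]]]]]]]]].
    pose proof PI_RGT_0 as HPI.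
    assert (Hinj : forall s t, s < t < s + 2 * PI -> gamma s <> gamma t).
    { intros s t Hst E; apply Hg in E; destruct E as [k Hk].
      assert (0 < IZR k < 1) by (split; nra).
      assert (Hk1 : (0 < k < 1)%Z) by (split; apply lt_IZR; tauto). lia. }
    assert (HeqC : forall t, C (gamma t)) by (intros t; apply HgC; now exists t).
    assert (E1 : circle (gamma t1) /\ angular_form B (gamma t1) = 0) by (apply Hform, Heq; auto).
    assert (E2 : circle (gamma t2) /\ angular_form B (gamma t2) = 0) by (apply Hform, Heq; auto).
    assert (E3 : circle (gamma t3) /\ angular_form B (gamma t3) = 0) by (apply Hform, Heq; auto).
    assert (N12 : gamma t1 <> gamma t2) by (apply Hinj; lra).
    assert (N13 : gamma t1 <> gamma t3) by (apply Hinj; lra).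
    assert (N23 : gamma t2 <> gamma t3) by (apply Hinj; lra).
    destruct T'; simpl in HT'; auto; exfalso.
    + destruct (discr_regular B) as [e He]; [lra|].
      destruct E1 as [[Hne _] E1]; rewrite (frame_angular_form B e He) in E1.
      apply Rmult_integral in E1; destruct E1 as [E1|]; auto.
      apply definite_form_zero in E1; auto.
      apply Hne, (frame_inj B e He); [rewrite frame_x_origin by auto|rewrite frame_y_origin by auto]; tauto.
    (* For a Jordan block all equilibria lie on one line, which meets the level circle in an
       antipodal pair; three distinct ones are too many. *)
    + destruct HT' as [Hd [e He]].
      assert (Hline : forall p, circle p /\ angular_form B p = 0 -> frame_x B e p = 0).
      { intros p [_ Hp]; rewrite (frame_angular_form B e He), Hd in Hp.
        apply Rmult_integral in Hp; destruct Hp; [nra|tauto]. }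
      assert (Hpair : forall p, circle p /\ angular_form B p = 0 ->
         p = gamma t1 \/ p = sc (-1) (gamma t1)).
      { intros p Hp; assert (Hp0 := Hline p Hp); assert (H10 := Hline _ E1).
        assert (Hy1 : frame_y B e (gamma t1) <> 0).
        { intros Hy; apply (proj1 (proj1 E1)), (frame_inj B e He);
            [rewrite frame_x_origin by auto|rewrite frame_y_origin by auto]; auto. }
        assert (E : p = sc (frame_y B e p / frame_y B e (gamma t1)) (gamma t1)).
        { apply (frame_inj B e He).
          - rewrite frame_x_sc, Hp0, H10 by auto; ring.
          - rewrite frame_y_sc by auto; field; auto. }
        rewrite E; rewrite E in Hp; apply (circle_line lambda B phi n); tauto. }
      destruct (Hpair _ E2) as [h2|h2]; [congruence|].
      destruct (Hpair _ E3) as [h3|h3]; congruence.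
    + assert (Hcurve : forall s, curve s = gamma t1 \/ curve s = gamma t2 \/
         curve s = gamma t3 \/ curve s = gamma t4).
      { intros s; assert (Hne := circle_curve_neq0 lambda B phi n s).
        assert (He : equilibrium field (curve s)).
        { apply circle_equilibrium with (n := n); auto.
          apply (proj2 (proj2 (circle_curve_param lambda B phi n lambda_pos n_pos phi_hom phi_pos B_neg))).
          now exists s. }
        apply (Heq _ (Hin _ Hne He)), He. }
      assert (Hci : forall s t, s < t < s + 2 * PI -> curve s <> curve t).
      { intros s t Hst E.
        apply (proj1 (proj2 (circle_curve_param lambda B phi n lambda_pos n_pos phi_hom phi_pos B_neg))) in E.
        destruct E as [k Hk]; assert (0 < IZR k < 1) by (split; nra).
        assert (Hk1 : (0 < k < 1)%Z) by (split; apply lt_IZR; tauto). lia. }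
      pose proof PI2_3_2 as Hpi.
      (* For a scalar matrix every point of the level circle is an equilibrium; five parameters
         within one period contradict the presence of only four. *)
      assert (D : forall i j, 0 <= i -> i < j -> j <= 2 -> curve i <> curve j)
        by (intros i j Hi Hij Hj; apply Hci; lra).
      pose proof (D 0 (1/2) ltac:(lra) ltac:(lra) ltac:(lra)).
      pose proof (D 0 1 ltac:(lra) ltac:(lra) ltac:(lra)).
      pose proof (D 0 (3/2) ltac:(lra) ltac:(lra) ltac:(lra)).
      pose proof (D 0 2 ltac:(lra) ltac:(lra) ltac:(lra)).
      pose proof (D (1/2) 1 ltac:(lra) ltac:(lra) ltac:(lra)).
      pose proof (D (1/2) (3/2) ltac:(lra) ltac:(lra) ltac:(lra)).
      pose proof (D (1/2) 2 ltac:(lra) ltac:(lra) ltac:(lra)).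
      pose proof (D 1 (3/2) ltac:(lra) ltac:(lra) ltac:(lra)).
      pose proof (D 1 2 ltac:(lra) ltac:(lra) ltac:(lra)).
      pose proof (D (3/2) 2 ltac:(lra) ltac:(lra) ltac:(lra)).
      destruct (Hcurve 0) as [h1|[h1|[h1|h1]]]; destruct (Hcurve (1/2)) as [h2|[h2|[h2|h2]]];
        try congruence; destruct (Hcurve 1) as [h3|[h3|[h3|h3]]]; try congruence;
        destruct (Hcurve (3/2)) as [h4|[h4|[h4|h4]]]; try congruence;
        destruct (Hcurve 2) as [h5|[h5|[h5|h5]]]; congruence.
  - destruct Hdyn as [p [q [Hp [Hq [Hpq [Heq _]]]]]].
    assert (Ep : circle p /\ angular_form B p = 0) by (apply Hform, Heq; auto).
    destruct T'; simpl in HT'; auto; exfalso.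
    + destruct (discr_regular B) as [e He]; [lra|].
      destruct Ep as [[Hne _] E1]; rewrite (frame_angular_form B e He) in E1.
      apply Rmult_integral in E1; destruct E1 as [E1|]; auto.
      apply definite_form_zero in E1; auto.
      apply Hne, (frame_inj B e He); [rewrite frame_x_origin by auto|rewrite frame_y_origin by auto]; tauto.
    + destruct (discr_regular B) as [e He]; [lra|].
      assert (Hs := sqrt_lt_R0 _ HT'); assert (Hss := sqrt_sqrt _ (Rlt_le _ _ HT')).
      (* Both lines [X = sqrt (discr B) * Y] and [X = - sqrt (discr B) * Y] carry equilibria. Three
         sign patterns of [(X, Y)] survive the positive rescaling to the circle and give three
         distinct points. *)
      assert (Hv : forall a b, a * a = discr B -> b * b = 1 ->
         exists v, C v /\ equilibrium field v /\ 0 < frame_x B e v * a /\ 0 < frame_y B e v * b).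
      { intros a b Ha Hb; destruct (frame_x_surj B e He a b) as [v [Hx Hy]].
        assert (Hv0 : v <> (0, 0)).
        { intros E; rewrite E, frame_y_origin in Hy by auto; nra. }
        assert (Hf : angular_form B v = 0).
        { rewrite (frame_angular_form B e He), Hx, Hy, Ha, Hb; ring. }
        destruct (Hmany v Hv0 Hf) as [He1 Hne].
        assert (Hr : 0 < radius v) by apply exp_pos.
        exists (sc (radius v) v); repeat split; auto.
        - rewrite frame_x_sc, Hx by auto; nra.
        - rewrite frame_y_sc, Hy by auto; nra. }
      destruct (Hv (sqrt (discr B)) 1) as [v1 [HC1 [He1 [Hx1 Hy1]]]]; try nra.
      destruct (Hv (sqrt (discr B)) (-1)) as [v2 [HC2 [He2 [Hx2 Hy2]]]]; try nra.
      destruct (Hv (- sqrt (discr B)) 1) as [v3 [HC3 [He3 [Hx3 Hy3]]]]; try nra.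
      assert (v1 <> v2) by (intros E; rewrite E in Hy1; lra).
      assert (v1 <> v3) by (intros E; rewrite E in Hx1; nra).
      assert (v2 <> v3) by (intros E; rewrite E in Hy2; lra).
      apply (Heq v1 HC1) in He1; apply (Heq v2 HC2) in He2; apply (Heq v3 HC3) in He3.
      destruct He1 as [h1|h1]; destruct He2 as [h2|h2]; destruct He3 as [h3|h3]; congruence.
    + assert (Hcurve : forall s, curve s = p \/ curve s = q).
      { intros s; assert (Hne := circle_curve_neq0 lambda B phi n s).
        assert (He : equilibrium field (curve s)).
        { apply circle_equilibrium with (n := n); auto.
          apply (proj2 (proj2 (circle_curve_param lambda B phi n lambda_pos n_pos phi_hom phi_pos B_neg))).
          now exists s. }
        apply (Heq _ (Hin _ Hne He)), He. }
      assert (Hci : forall s t, s < t < s + 2 * PI -> curve s <> curve t).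
      { intros s t Hst E.
        apply (proj1 (proj2 (circle_curve_param lambda B phi n lambda_pos n_pos phi_hom phi_pos B_neg))) in E.
        destruct E as [k Hk]; pose proof PI_RGT_0; assert (0 < IZR k < 1) by (split; nra).
        assert (Hk1 : (0 < k < 1)%Z) by (split; apply lt_IZR; tauto). lia. }
      pose proof PI2_3_2 as Hpi.
      assert (D : forall i j, 0 <= i -> i < j -> j <= 2 -> curve i <> curve j)
        by (intros i j Hi Hij Hj; apply Hci; lra).
      pose proof (D 0 1 ltac:(lra) ltac:(lra) ltac:(lra)).
      pose proof (D 0 2 ltac:(lra) ltac:(lra) ltac:(lra)).
      pose proof (D 1 2 ltac:(lra) ltac:(lra) ltac:(lra)).
      destruct (Hcurve 0) as [h1|h1]; destruct (Hcurve 1) as [h2|h2];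
        destruct (Hcurve 2) as [h3|h3]; congruence.
  - intros v; destruct (classic (v = (0, 0))) as [->|Hv].
    + unfold angular_form, dot; simpl; ring.
    (* Every ray meets [C], and each such point is an equilibrium, so the form vanishes in every
       direction. *)
    + destruct (surrounds_ray C v Hsur Hv) as [r [Hr HCr]].
      destruct (Hform _ HCr (Hdyn _ HCr)) as [_ H]; rewrite angular_form_sc in H.
      apply Rmult_integral in H; destruct H; [nra|auto].
Qed.

End TypeFromPortrait.

(** * The portrait of each type *)

Lemma gcos_neg (d s : R) : d < 0 -> gcos d s = cos (sqrt (- d) * s).
Proof. intros H; unfold gcos; repeat destruct Rlt_dec; auto; lra. Qed.

Lemma gsin_neg (d s : R) : d < 0 -> gsin d s = sin (sqrt (- d) * s) / sqrt (- d).
Proof. intros H; unfold gsin; repeat destruct Rlt_dec; auto; lra. Qed.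

Lemma gcos_pos (d s : R) : 0 < d -> gcos d s = cosh (sqrt d * s).
Proof. intros H; unfold gcos; repeat destruct Rlt_dec; auto; lra. Qed.

Lemma gsin_pos (d s : R) : 0 < d -> gsin d s = sinh (sqrt d * s) / sqrt d.
Proof. intros H; unfold gsin; repeat destruct Rlt_dec; auto; lra. Qed.

Lemma gcos_zero (s : R) : gcos 0 s = 1.
Proof. unfold gcos; repeat destruct Rlt_dec; auto; lra. Qed.

Lemma gsin_zero (s : R) : gsin 0 s = s.
Proof. unfold gsin; repeat destruct Rlt_dec; auto; lra. Qed.

(** * Complex eigenvalues: the linear flow as a rotation with scaling *)

Section EllipticFrame.

Variables (B : @matrix R 2 2) (e : plane).
Hypothesis e_regular : angular_form B e <> 0.
Hypothesis discr_neg : discr B < 0.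

(** The imaginary part of the eigenvalues for a negative discriminant, half their distance for a
    positive one; the absolute value lets both cases share it. *)
Definition omega : R := sqrt (Rabs (discr B)).

Lemma omega_pos : 0 < omega.
Proof. apply sqrt_lt_R0, Rabs_pos_lt; lra. Qed.

Lemma omega_sqr_neg : omega * omega = - discr B.
Proof. unfold omega; rewrite Rabs_left by auto; apply sqrt_sqrt; lra. Qed.

Lemma elliptic_flow (s : R) (v : plane) :
  frame_x B e (flow B s v) = exp (half_trace B * s) *
    (cos (omega * s) * frame_x B e v - sin (omega * s) * (omega * frame_y B e v)) /\
  omega * frame_y B e (flow B s v) = exp (half_trace B * s) *
    (sin (omega * s) * frame_x B e v + cos (omega * s) * (omega * frame_y B e v)).
Proof.
  destruct (frame_flow B e e_regular s v) as [-> ->].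
  rewrite gcos_neg, gsin_neg by auto.
  replace (sqrt (- discr B)) with omega by (unfold omega; rewrite Rabs_left; auto).
  pose proof omega_pos; pose proof omega_sqr_neg.
  replace (discr B) with (- (omega * omega)) by lra; split; field; lra.
Qed.

Lemma elliptic_reach (p r : plane) :
  p <> (0, 0) -> r <> (0, 0) -> exists s rho, 0 < rho /\ r = sc rho (flow B s p).
Proof.
  intros Hp Hr; pose proof omega_pos as Hw.
  assert (Hpol : forall v, v <> (0, 0) -> exists q t, 0 < q /\
    frame_x B e v = q * cos t /\ omega * frame_y B e v = q * sin t).
  { intros v Hv; destruct (polar (frame_x B e v, omega * frame_y B e v)) as [q [t [Hq [_ E]]]].
    - intros E; injection E; intros H2 H1; apply Hv, (frame_inj B e e_regular);
        [rewrite frame_x_origin by auto|rewrite frame_y_origin by auto]; nra.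
    - unfold sc in E; simpl in E; injection E; intros; exists q, t; auto. }
  destruct (Hpol p Hp) as [q1 [a [Hq1 [Hx1 Hy1]]]].
  destruct (Hpol r Hr) as [q2 [b [Hq2 [Hx2 Hy2]]]].
  set (s := (b - a) / omega).
  exists s, (q2 / q1 / exp (half_trace B * s)).
  pose proof (exp_pos (half_trace B * s)).
  split; [repeat apply Rdiv_lt_0_compat; auto|].
  destruct (elliptic_flow s p) as [Hfx Hfy].
  rewrite Hx1, Hy1 in Hfx, Hfy.
  replace (omega * s) with (b - a) in Hfx, Hfy by (unfold s; field; lra).
  replace (cos (b - a) * (q1 * cos a) - sin (b - a) * (q1 * sin a)) with (q1 * cos b) in Hfx.
  2: { replace b with ((b - a) + a) at 1 by ring; rewrite cos_plus; ring. }
  replace (sin (b - a) * (q1 * cos a) + cos (b - a) * (q1 * sin a)) with (q1 * sin b) in Hfy.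
  2: { replace b with ((b - a) + a) at 1 by ring; rewrite sin_plus; ring. }
  apply (frame_inj B e e_regular).
  - rewrite frame_x_sc, Hfx, Hx2 by auto; field; lra.
  - apply Rmult_eq_reg_l with omega; [|lra]; rewrite frame_y_sc by auto.
    replace (omega * (q2 / q1 / exp (half_trace B * s) * frame_y B e (flow B s p))) with
      (q2 / q1 / exp (half_trace B * s) * (omega * frame_y B e (flow B s p))) by ring.
    rewrite Hfy, Hy2; field; lra.
Qed.

Lemma elliptic_half_turn (v : plane) :
  flow B (PI / omega) v = sc (- exp (half_trace B * (PI / omega))) v.
Proof.
  pose proof omega_pos; destruct (elliptic_flow (PI / omega) v) as [Hx Hy].
  replace (omega * (PI / omega)) with PI in Hx, Hy by (field; lra).
  rewrite cos_PI, sin_PI in Hx, Hy.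
  apply (frame_inj B e e_regular).
  - rewrite frame_x_sc, Hx by auto; ring.
  - apply Rmult_eq_reg_l with omega; [|lra]; rewrite Hy, frame_y_sc by auto; ring.
Qed.

Lemma elliptic_full_turn (v : plane) :
  exists r, 0 < r /\ flow B (2 * (PI / omega)) v = sc r v.
Proof.
  pose proof (exp_pos (half_trace B * (PI / omega))) as Hx.
  set (x := exp (half_trace B * (PI / omega))) in *.
  exists (x * x); split; [nra|].
  replace (2 * (PI / omega)) with (PI / omega + PI / omega) by ring.
  rewrite flow_add, !elliptic_half_turn, sc_sc; fold x; f_equal; ring.
Qed.

End EllipticFrame.

(** * Distinct real eigenvalues: eigencoordinates *)

Section HyperbolicFrame.

Variables (B : @matrix R 2 2) (e : plane).
Hypothesis e_regular : angular_form B e <> 0.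
Hypothesis discr_pos : 0 < discr B.

Lemma omega_sqr_pos : omega B * omega B = discr B.
Proof. unfold omega; rewrite Rabs_right by lra; apply sqrt_sqrt; lra. Qed.

Lemma omega_pos' : 0 < omega B.
Proof. apply sqrt_lt_R0, Rabs_pos_lt; lra. Qed.

(** Together with [fast] an eigencoordinate of the flow. For negative definite [B] both exponents
    are negative, and [half_trace B + omega B] is the one nearer to zero. *)
Definition slow (v : plane) : R := frame_x B e v + omega B * frame_y B e v.

Definition fast (v : plane) : R := frame_x B e v - omega B * frame_y B e v.

Lemma hyperbolic_flow (s : R) (v : plane) :
  slow (flow B s v) = exp ((half_trace B + omega B) * s) * slow v /\
  fast (flow B s v) = exp ((half_trace B - omega B) * s) * fast v.
Proof.
  unfold slow, fast; destruct (frame_flow B e e_regular s v) as [-> ->].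
  rewrite gcos_pos, gsin_pos by auto.
  pose proof omega_pos' as Hw; pose proof omega_sqr_pos as Hww.
  replace (sqrt (discr B)) with (omega B) by (unfold omega; rewrite Rabs_right; lra).
  rewrite <- Hww; set (w := omega B) in *; unfold cosh, sinh.
  replace ((half_trace B + w) * s) with (half_trace B * s + w * s) by ring.
  replace ((half_trace B - w) * s) with (half_trace B * s + - (w * s)) by ring.
  rewrite !exp_plus; split; field; lra.
Qed.

Lemma slow_sc (r : R) (v : plane) : slow (sc r v) = r * slow v.
Proof. unfold slow; rewrite frame_x_sc, frame_y_sc by auto; ring. Qed.

Lemma fast_sc (r : R) (v : plane) : fast (sc r v) = r * fast v.
Proof. unfold fast; rewrite frame_x_sc, frame_y_sc by auto; ring. Qed.

Lemma slow_plus (v w : plane) : slow (plus v w) = slow v + slow w.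
Proof. unfold slow; rewrite frame_x_plus, frame_y_plus by auto; ring. Qed.

Lemma fast_plus (v w : plane) : fast (plus v w) = fast v + fast w.
Proof. unfold fast; rewrite frame_x_plus, frame_y_plus by auto; ring. Qed.

Lemma slow_fast_inj (v w : plane) : slow v = slow w -> fast v = fast w -> v = w.
Proof.
  unfold slow, fast; intros H1 H2; pose proof omega_pos'.
  apply (frame_inj B e e_regular); nra.
Qed.

Lemma slow_fast_surj (x y : R) : exists v, slow v = x /\ fast v = y.
Proof.
  pose proof omega_pos' as Hw.
  destruct (frame_x_surj B e e_regular ((x + y) / 2) ((x - y) / (2 * omega B))) as [v [Hx Hy]].
  exists v; unfold slow, fast; rewrite Hx, Hy; split; field; lra.
Qed.

Lemma slow_origin : slow (0, 0) = 0.
Proof. unfold slow; rewrite frame_x_origin, frame_y_origin by auto; ring. Qed.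

Lemma fast_origin : fast (0, 0) = 0.
Proof. unfold fast; rewrite frame_x_origin, frame_y_origin by auto; ring. Qed.

Lemma slow_fast_form (v : plane) : angular_form B v = slow v * fast v * angular_form B e.
Proof.
  rewrite (frame_angular_form B e e_regular v); unfold slow, fast; rewrite <- omega_sqr_pos; ring.
Qed.

Lemma cont_slow {U : UniformSpace} (v : U -> plane) (x : U) :
  continuous v x -> continuous (fun y => slow (v y)) x.
Proof.
  intros Hv; unfold slow; apply cont_add; [now apply cont_frame_x|].
  apply cont_mul; [apply cont_const|now apply cont_frame_y].
Qed.

Lemma cont_fast {U : UniformSpace} (v : U -> plane) (x : U) :
  continuous v x -> continuous (fun y => fast (v y)) x.
Proof.
  intros Hv; unfold fast; apply cont_sub; [now apply cont_frame_x|].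
  apply cont_mul; [apply cont_const|now apply cont_frame_y].
Qed.

End HyperbolicFrame.

Lemma half_trace_neg (B : @matrix R 2 2) :
  negative_definite (quad_form B) -> half_trace B < 0.
Proof.
  intros H; assert (H1 := H (1, 0) ltac:(intros E; injection E; lra)).
  assert (H2 := H (0, 1) ltac:(intros E; injection E; lra)).
  unfold quad_form, dot, mat_app in *; simpl in *; unfold half_trace; lra.
Qed.

(** Obtained by applying [flow_decay] over unit time to an eigenvector on which [fast] vanishes. *)
Lemma slow_rate_neg (B : @matrix R 2 2) :
  negative_definite (quad_form B) -> 0 < discr B -> half_trace B + omega B < 0.
Proof.
  intros H Hd; destruct (discr_regular B) as [e He]; [lra|].
  destruct (slow_fast_surj B e He Hd 1 0) as [v [Hs Hf]].
  destruct (flow_decay B H) as [beta [Hb Hdec]].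
  assert (Hv : v <> (0, 0)) by (intros E; rewrite E, slow_origin in Hs; auto; lra).
  assert (E : flow B 1 v = sc (exp ((half_trace B + omega B) * 1)) v).
  { destruct (hyperbolic_flow B e He Hd 1 v) as [H1 H2].
    apply (slow_fast_inj B e He Hd); rewrite ?slow_sc, ?fast_sc, ?H1, ?H2, ?Hf by auto; ring. }
  specialize (Hdec v 0 1 ltac:(lra)).
  rewrite E, flow_0, Rmult_0_r, exp_0, Rmult_1_l, dot_sc in Hdec.
  rewrite <- Rmult_assoc, <- !exp_plus in Hdec.
  pose proof (dot_pos v Hv) as Hdp.
  pose proof (exp_ineq1_le (2 * beta * 1 + ((half_trace B + omega B) * 1 + (half_trace B + omega B) * 1))).
  nra.
Qed.

(** * Dynamics on the invariant circle *)

Section PortraitFromType.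

Variables (lambda : R) (B : @matrix R 2 2) (phi : plane -> R) (n : nat).
Hypothesis lambda_pos : 0 < lambda.
Hypothesis n_pos : (1 <= n)%nat.
Hypothesis phi_hom : homogeneous_poly (2 * n) phi.
Hypothesis phi_pos : positive_definite phi.
Hypothesis B_neg : negative_definite (quad_form B).

Notation field := (vector_field lambda B phi).
Notation K := (timefun lambda B phi n).
Notation circle := (level_circle lambda B phi n).
Notation radius := (circle_radius lambda B phi n).
Notation curve := (circle_curve lambda B phi n).

Lemma curve_on_circle (t : R) : circle (curve t).
Proof.
  apply (proj2 (proj2 (circle_curve_param lambda B phi n lambda_pos n_pos phi_hom phi_pos B_neg))).
  now exists t.
Qed.

(** On the circle [K p = 1], so the relation between [s] and the time reads
    [K (flow B s p) = exp (2 n lambda t)]; the logarithm gives the time at which the direction of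
    [flow B s p] is reached. *)
Lemma trajectory_at (p : plane) (s : R) :
  circle p ->
  trajectory lambda B phi n p (ln (K (flow B s p)) / (2 * INR n * lambda)) =
  sc (exp (lambda * (ln (K (flow B s p)) / (2 * INR n * lambda)))) (flow B s p).
Proof.
  intros [Hp HK]; pose proof (rate_const_pos lambda n lambda_pos n_pos) as Hc.
  unfold trajectory; f_equal; f_equal.
  replace (2 * INR n * lambda * (ln (K (flow B s p)) / (2 * INR n * lambda))) with
    (ln (K (flow B s p))) by (field; repeat split; intros E; rewrite E in Hc; lra).
  rewrite exp_ln, HK by now apply timefun_pos, flow_neq0.
  replace (1 + K (flow B s p) - 1) with (K (flow B s p)) by ring.
  now apply clock_inverse_unique.
Qed.

(** The period is the time of a full turn of the linear flow: the trajectory is then back on its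
    ray, which meets the circle only once. After half a turn it is on the opposite ray, so it is not
    constant. *)
Lemma limit_cycle_portrait : discr B < 0 -> circle_dynamics LimitCycle field (angular B phi) circle.
Proof.
  intros Hd; destruct (discr_regular B) as [e He]; [lra|].
  pose proof (rate_const_pos lambda n lambda_pos n_pos) as Hc.
  pose proof PI_RGT_0 as HPI; pose proof (omega_pos B Hd) as Hw.
  set (p := curve 0); assert (Hp : circle p) by apply curve_on_circle.
  assert (Hp0 := proj1 Hp); assert (HKp := proj2 Hp).
  set (v := trajectory lambda B phi n p).
  assert (Hv : global_solution field v) by (apply global_exists; auto; lra).
  assert (Hv0 : v 0 = p) by now apply trajectory_0.
  assert (HvC : forall t, circle (v t)).
  { intros t; apply solves_level_circle with (e := 1); auto.
    - now apply global_solves.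
    - now rewrite Hv0. }
  set (time := fun s => ln (K (flow B s p)) / (2 * INR n * lambda)).
  assert (Htime : forall s, exists r, 0 < r /\ v (time s) = sc r (flow B s p)).
  { intros s; exists (exp (lambda * time s)); split; [apply exp_pos|exact (trajectory_at p s Hp)]. }
  simpl; split; [split|].
  - exists v; split; [split; [auto|split]|].
    + exists (time (2 * (PI / omega B))).
      assert (Hs : 0 < PI / omega B) by (apply Rdiv_lt_0_compat; lra).
      split.
      { apply Rdiv_lt_0_compat; auto; rewrite <- ln_1; apply ln_increasing; [lra|].
        rewrite <- HKp, <- (flow_0 B p) at 1; apply timefun_flow_incr; auto; lra. }
      destruct (Htime (2 * (PI / omega B))) as [r [Hr E]].
      destruct (elliptic_full_turn B e He Hd p) as [r' [Hr' E']].
      rewrite E', sc_sc in E.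
      assert (H1 : r * r' = 1).
      { apply (circle_ray_unique lambda B phi n) with (v := p); auto; [nra|].
        rewrite <- E; apply HvC. }
      rewrite H1, sc_1 in E.
      intros t; set (T := time (2 * (PI / omega B))) in *.
      apply (solves_unique lambda B phi n lambda_pos n_pos phi_hom phi_pos B_neg 1
        (fun t => v (t + T)) v t).
      * apply solves_plus; intros s _.
        eapply is_derive_val_plane.
        -- apply (derive_comp_plane v (fun t => t + T)); [apply Hv; auto|].
           apply derive_add; [apply derive_id|apply derive_const].
        -- rewrite scal_sc, Rplus_0_r; apply sc_1.
      * now apply global_solves.
      * now rewrite Rplus_0_l, E, Hv0.
    + destruct (Htime (PI / omega B)) as [r [Hr E]].
      exists (time (PI / omega B)); rewrite E, elliptic_half_turn with (e := e), sc_sc, Hv0 by auto.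
      pose proof (exp_pos (half_trace B * (PI / omega B))) as Hx.
      intros E'; assert (Hz : dot p (sc (r * - exp (half_trace B * (PI / omega B))) p) = dot p p) by now rewrite E'.
      pose proof (dot_pos p Hp0).
      replace (dot p (sc (r * - exp (half_trace B * (PI / omega B))) p)) with
        (- (r * exp (half_trace B * (PI / omega B))) * dot p p) in Hz by (unfold dot, sc; simpl; ring).
      pose proof (Rmult_lt_0_compat _ _ (Rmult_lt_0_compat _ _ Hr Hx) H); lra.
    + intros q; split.
      * intros Hq; destruct (elliptic_reach B e He Hd p q Hp0 (proj1 Hq)) as [s [r [Hr E]]].
        destruct (Htime s) as [r' [Hr' E']].
        exists (time s).
        assert (Hrr : 0 < r / r') by (apply Rdiv_lt_0_compat; auto).
        assert (E2 : q = sc (r / r') (v (time s))).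
        { rewrite E, E', sc_sc; f_equal; field; lra. }
        rewrite E2 in Hq |- *.
        rewrite (circle_ray_unique lambda B phi n lambda_pos n_pos phi_hom phi_pos B_neg
          (r / r') (v (time s))), sc_1; auto.
      * intros [t <-]; apply HvC.
  (* Along a solution of period [T] the value [K - 1] is contracted by a factor below [1] and yet
     returns, so it is zero: the cycle is isolated in the whole punctured plane. *)
  - exists (fun q => q <> (0, 0)); split; [|split].
    + intros q Hq; now apply locally_neq0.
    + intros q [Hq _]; exact Hq.
    + intros w [Hws [[T [HT Hper]] _]] Hne t.
      assert (Hs : forall u, solves lambda B phi 1 w u) by (intros u; now apply global_solves).
      apply solves_level_circle with (e := 1); auto; split; auto.
      assert (E := solves_time lambda B phi n lambda_pos n_pos phi_hom phi_pos B_neg 1 w T (Hs T) (Hne 0)).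
      rewrite <- (Rplus_0_l T) in E at 1; rewrite Hper in E.
      assert (Hx : exp (- (2 * INR n * lambda * 1 * T)) < 1).
      { apply Rlt_le_trans with (exp 0); [|rewrite exp_0; lra].
        apply exp_increasing; pose proof (Rmult_lt_0_compat _ _ Hc HT); lra. }
      assert (Hz : (K (w 0) - 1) * (1 - exp (- (2 * INR n * lambda * 1 * T))) = 0) by lra.
      apply Rmult_integral in Hz; destruct Hz; lra.
  - intros q Hq Heq; apply (circle_equilibrium lambda B phi n) in Heq; auto.
    rewrite (frame_angular_form B e He) in Heq; apply Rmult_integral in Heq.
    destruct Heq as [Heq|Heq]; auto; apply definite_form_zero in Heq; auto.
    apply (proj1 Hq), (frame_inj B e He);
      [rewrite frame_x_origin by auto|rewrite frame_y_origin by auto]; tauto.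
Qed.

Lemma circle_of_equilibria_portrait :
  (forall v, angular_form B v = 0) ->
  circle_dynamics CircleOfEquilibria field (angular B phi) circle.
Proof. intros H p Hp; apply (circle_equilibrium lambda B phi n); auto. Qed.

(** The angular form is a constant times the square of [X], so [angular] keeps its sign. Two of its
    zeros at [s] and [t] have parallel directions, hence [sin (s - t) = 0], and at distance below
    [1] they coincide. *)
Lemma saddle_node_portrait (e : plane) :
  discr B = 0 -> angular_form B e <> 0 ->
  circle_dynamics TwoSaddleNodes field (angular B phi) circle.
Proof.
  intros Hd He; simpl.
  destruct (frame_x_surj B e He 0 1) as [f [Hfx Hfy]].
  assert (Hf : f <> (0, 0)) by (intros E; rewrite E, frame_y_origin in Hfy; auto; lra).
  assert (Hform : forall v, angular_form B v = frame_x B e v * frame_x B e v * angular_form B e).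
  { intros v; rewrite (frame_angular_form B e He v), Hd; ring. }
  set (p := sc (radius f) f).
  assert (Hp : circle p) by now apply level_circle_sc.
  assert (Hpx : frame_x B e p = 0) by (unfold p; rewrite frame_x_sc, Hfx by auto; ring).
  assert (Hpy : 0 < frame_y B e p).
  { unfold p; rewrite frame_y_sc, Hfy by auto; assert (0 < radius f) by apply exp_pos; lra. }
  assert (Hsn : forall q, circle q -> frame_x B e q = 0 -> saddle_node (angular B phi) q).
  { intros q [Hq _] Hqx; destruct (polar q Hq) as [r [t [Hr [_ E]]]].
    exists r, t; split; auto; split; [exact E|].
    assert (Hxt : frame_x B e (cos t, sin t) = 0).
    { rewrite E, frame_x_sc in Hqx by auto; apply Rmult_integral in Hqx; destruct Hqx; auto; lra. }
    split; [rewrite angular_eq, Hform, Hxt; ring|].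
    exists (mkposreal 1 Rlt_0_1); simpl; split.
    - intros s Hs Hz; rewrite angular_eq, Hform in Hz.
      pose proof (phi_pos _ (cos_sin_neq0 s)) as Hph.
      assert (Hxs : frame_x B e (cos s, sin s) = 0).
      { apply Rmult_integral in Hz; destruct Hz as [Hz|Hz]; [lra|].
        apply Rmult_integral in Hz; destruct Hz as [Hz|Hz]; [nra|tauto]. }
      assert (Hsin : sin (s - t) = 0).
      { assert (Hys : forall u, frame_x B e u = 0 -> exists a, u = sc a f).
        { intros u Hu; exists (frame_y B e u); apply (frame_inj B e He);
            rewrite ?frame_x_sc, ?frame_y_sc, ?Hfx, ?Hfy by auto; lra. }
        rewrite sin_minus; destruct (Hys _ Hxs) as [y1 E1]; destruct (Hys _ Hxt) as [y2 E2].
        unfold sc in E1, E2; injection E1; injection E2; intros -> -> -> ->; ring. }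
      destruct (sin_eq_0_0 _ Hsin) as [k Hk]; rewrite Hk in Hs.
      pose proof PI2_3_2 as HPI.
      assert (Hk1 : (k = 0)%Z).
      { assert (Hlt : -1 < IZR k < 1).
        { destruct Hs as [_ Hs]; apply Rabs_def2 in Hs; split; nra. }
        assert ((-1 < k < 1)%Z) by (split; apply lt_IZR; tauto); lia. }
      rewrite Hk1, Rmult_0_l, Rabs_R0 in Hs; lra.
    - destruct (Rle_lt_dec 0 (angular_form B e)) as [Hs|Hs]; [left|right]; intros s _;
        rewrite angular_eq, Hform; pose proof (phi_pos _ (cos_sin_neq0 s));
        pose proof (Rle_0_sqr (frame_x B e (cos s, sin s))) as Hsq; unfold Rsqr in Hsq.
      + apply Rmult_le_pos; [lra|]; apply Rmult_le_pos; auto.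
      + assert (frame_x B e (cos s, sin s) * frame_x B e (cos s, sin s) * angular_form B e <= 0) by nra.
        nra. }
  assert (Hmx : frame_x B e (sc (-1) p) = 0) by (rewrite frame_x_sc, Hpx by auto; ring).
  assert (Hmp : circle (sc (-1) p)) by now apply circle_opp.
  exists p, (sc (-1) p); repeat (split; [now auto|]); split; [|split; [|split]]; auto.
  - intros E; apply (f_equal (frame_y B e)) in E; rewrite frame_y_sc in E by auto; lra.
  - intros r Hr; rewrite (circle_equilibrium lambda B phi n) by auto; rewrite Hform; split.
    + intros Hz; assert (Hrx : frame_x B e r = 0).
      { apply Rmult_integral in Hz; destruct Hz as [Hz|Hz]; [nra|tauto]. }
      assert (E : r = sc (frame_y B e r / frame_y B e p) p).
      { apply (frame_inj B e He); rewrite ?frame_x_sc, ?frame_y_sc, ?Hrx, ?Hpx by auto; field; lra. }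
      rewrite E in Hr |- *; now apply (circle_line lambda B phi n).
    + intros [->| ->]; [rewrite Hpx|rewrite Hmx]; ring.
Qed.

(** [L1] dominates: [L2 / L1] decays along the flow, and it parametrizes
    [circle] near [p]. *)
Lemma dominated_attracting (F : plane -> plane) (L1 L2 : plane -> R) (m1 m2 e : R) (p z : plane) :
  (e = 1 \/ e = -1) -> e * (m2 - m1) < 0 ->
  (forall q v T, forward_solution F q v -> 0 <= T -> solves lambda B phi e v T) ->
  (forall q, circle q -> exists v, forward_solution F q v) ->
  F p = (0, 0) ->
  (forall v, continuous L1 v) -> (forall v, continuous L2 v) ->
  (forall r v, L1 (sc r v) = r * L1 v) -> (forall r v, L2 (sc r v) = r * L2 v) ->
  (forall v w, L1 (plus v w) = L1 v + L1 w) -> (forall v w, L2 (plus v w) = L2 v + L2 w) ->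
  (forall v w, L1 v = L1 w -> L2 v = L2 w -> v = w) ->
  (forall s v, L1 (flow B s v) = exp (m1 * s) * L1 v) ->
  (forall s v, L2 (flow B s v) = exp (m2 * s) * L2 v) ->
  circle p -> L2 p = 0 -> L1 z = 0 -> L2 z = L1 p -> L1 p <> 0 ->
  attracting_in circle F p.
Proof.
  intros He Hm Hsol Hex HFp C1 C2 S1 S2 P1 P2 Hinj F1 F2 Hp Hp2 Hz1 Hz2 Hp1.
  pose proof (rate_const_pos lambda n lambda_pos n_pos) as Hc.
  (* A line on which [L1] is constant and [x] is the quotient [L2 / L1]. Scaled to the level [K = 1]
     in [c], it becomes a chart of the circle by this quotient. *)
  set (w := fun x => plus p (sc x z)).
  assert (Hw1 : forall x, L1 (w x) = L1 p) by (intros x; unfold w; rewrite P1, S1, Hz1; ring).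
  assert (Hw2 : forall x, L2 (w x) = x * L1 p) by (intros x; unfold w; rewrite P2, S2, Hz2, Hp2; ring).
  assert (L10 : L1 (0, 0) = 0).
  { rewrite <- (sc_0 0), S1; ring. }
  assert (Hw0 : forall x, w x <> (0, 0)).
  { intros x E; apply Hp1; rewrite <- (Hw1 x), E; auto. }
  set (c := fun x => sc (radius (w x)) (w x)).
  assert (Hcont : continuous c 0).
  { assert (Hwc : continuous w 0).
    { apply (continuous_plus (fun _ => p) (fun x => sc x z)); [apply continuous_const|].
      apply cont_sc; cont. }
    apply cont_sc; auto; apply (cont_comp_plane radius w); auto; now apply cont_radius. }
  assert (Hc0 : c 0 = p).
  { assert (E : w 0 = p) by (apply Hinj; rewrite ?Hw1, ?Hw2, ?Hp2; ring).
    unfold c; rewrite E, (radius_circle lambda B phi n p Hp); apply sc_1. }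
  assert (Hpar : forall v, circle v -> 0 < L1 v * L1 p -> v = c (L2 v / L1 v)).
  { intros v Hv Hs; assert (Hv1 : L1 v <> 0) by (intros E; rewrite E in Hs; lra).
    assert (Hr : 0 < L1 p / L1 v).
    { replace (L1 p / L1 v) with (L1 v * L1 p / (L1 v * L1 v)) by (field; auto).
      apply Rdiv_lt_0_compat; auto; nra. }
    assert (E : w (L2 v / L1 v) = sc (L1 p / L1 v) v).
    { apply Hinj; rewrite ?Hw1, ?Hw2, ?S1, ?S2; field; auto. }
    unfold c; rewrite E, radius_sc, (radius_circle lambda B phi n v Hv), sc_sc
      by (auto; apply Hv).
    replace (1 / (L1 p / L1 v) * (L1 p / L1 v)) with 1 by (field; auto); now rewrite sc_1. }
  assert (Hnear : forall eta, 0 < eta -> exists delta : posreal, forall q, ball p delta q ->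
    0 < L1 q * L1 p /\ Rabs (L2 q / L1 q) < eta).
  { intros eta Heta.
    assert (HA : locally p (fun q => 0 < L1 q * L1 p)).
    { assert (Hcc : continuous (fun q => L1 q * L1 p) p) by (apply cont_mul; auto; apply cont_const).
      apply (Hcc (fun r => 0 < r)), open_gt; nra. }
    assert (HB : locally p (fun q => ball (L2 p / L1 p) (mkposreal eta Heta) (L2 q / L1 q))).
    { assert (Hcc : continuous (fun q => L2 q / L1 q) p) by (apply cont_div; auto).
      apply (proj1 (filterlim_locally _ _) Hcc). }
    destruct (filter_and _ _ HA HB) as [d Hd]; exists d; intros q Hq.
    destruct (Hd q Hq) as [H1 H2]; split; auto.
    assert (E : L2 p / L1 p = 0) by (rewrite Hp2; unfold Rdiv; ring).
    rewrite E in H2.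
    rewrite <- (Rminus_0_r (L2 q / L1 q)); exact H2. }
  (* In this chart a solution multiplies the quotient by [exp ((m2 - m1) * s)], with [s] of the sign
     of [e]. The last clause allows [s] to be recognized later by its value of [K]. *)
  assert (Hflow : forall q v T, circle q -> 0 < L1 q * L1 p -> forward_solution F q v -> 0 <= T ->
    exists s, 0 <= e * s /\ v T = c (exp ((m2 - m1) * s) * (L2 q / L1 q)) /\
      forall S, 0 <= e * S -> K (flow B S q) = exp (2 * INR n * lambda * e * T) -> S = s).
  { intros q v T Hq Hs Hv HT.
    assert (H0 : v 0 = q) by apply Hv.
    assert (Hsv := Hsol q v T Hv HT).
    assert (Hne : v 0 <> (0, 0)) by (rewrite H0; apply Hq).
    destruct (solves_point lambda B phi n lambda_pos n_pos phi_hom phi_pos B_neg e v T Hsv Hne)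
      as [s [E EK]].
    rewrite H0, (proj2 Hq) in EK; rewrite H0 in E.
    assert (EK' : K (flow B s q) = exp (2 * INR n * lambda * e * T)) by lra.
    exists s; split; [|split].
    - apply Rnot_lt_le; intros Hlt.
      assert (Hk0 : K (flow B 0 q) = 1) by (rewrite flow_0; apply Hq).
      destruct He as [-> | ->].
      + assert (Hk1 := timefun_flow_incr lambda B phi n lambda_pos n_pos phi_hom phi_pos B_neg q s 0
          (proj1 Hq) ltac:(lra)).
        pose proof (exp_ineq1_le (2 * INR n * lambda * 1 * T)).
        pose proof (Rmult_le_pos _ _ (Rlt_le _ _ Hc) HT); lra.
      + assert (Hk1 := timefun_flow_incr lambda B phi n lambda_pos n_pos phi_hom phi_pos B_neg q 0 s
          (proj1 Hq) ltac:(lra)).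
        assert (exp (2 * INR n * lambda * -1 * T) <= exp 0).
        { pose proof (Rmult_le_pos _ _ (Rlt_le _ _ Hc) HT).
          destruct (Req_dec (2 * INR n * lambda * T) 0) as [Ez|Ez].
          - replace (2 * INR n * lambda * -1 * T) with (- (2 * INR n * lambda * T)) by ring.
            rewrite Ez, Ropp_0; lra.
          - apply Rlt_le, exp_increasing; lra. }
        rewrite exp_0 in *; lra.
    - assert (HvC : circle (v T)).
      { apply solves_level_circle with (e := e); auto; now rewrite H0. }
      assert (HL1 : L1 (v T) = exp (e * lambda * T) * (exp (m1 * s) * L1 q)) by (rewrite E, S1, F1; auto).
      assert (HL2 : L2 (v T) = exp (e * lambda * T) * (exp (m2 * s) * L2 q)) by (rewrite E, S2, F2; auto).
      pose proof (exp_pos (e * lambda * T)); pose proof (exp_pos (m1 * s)).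
      assert (Hq1 : L1 q <> 0) by (intros Ez; rewrite Ez in Hs; lra).
      rewrite (Hpar (v T) HvC).
      + f_equal; rewrite HL1, HL2.
        replace ((m2 - m1) * s) with (m2 * s + - (m1 * s)) by ring.
        rewrite exp_plus, exp_Ropp; field; repeat split; auto; lra.
      + rewrite HL1.
        replace (exp (e * lambda * T) * (exp (m1 * s) * L1 q) * L1 p) with
          (exp (e * lambda * T) * exp (m1 * s) * (L1 q * L1 p)) by ring.
        apply Rmult_lt_0_compat; auto; now apply Rmult_lt_0_compat.
    - intros S _ HS; apply (timefun_flow_inj lambda B phi n) with (v := q); auto; [apply Hq|congruence]. }
  assert (Hball : forall eps : posreal, exists eta : posreal, forall x, Rabs x < eta -> ball p eps (c x)).
  { intros eps; destruct (proj1 (filterlim_locally _ _) Hcont eps) as [eta Heta].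
    exists eta; intros x Hx; rewrite <- Hc0 at 1; apply Heta.
    change (Rabs (x - 0) < eta); now rewrite Rminus_0_r. }
  split; [|split]; auto.
  - intros eps; destruct (Hball eps) as [eta Heta].
    destruct (Hnear eta (cond_pos eta)) as [delta Hdelta].
    exists delta; intros q v Hq Hb Hv t Ht; destruct (Hdelta q Hb) as [Hs Hr].
    destruct (Hflow q v t Hq Hs Hv Ht) as [s [Hes [-> _]]].
    apply Heta; rewrite Rabs_mult, (Rabs_right (exp _)) by (left; apply exp_pos).
    assert (exp ((m2 - m1) * s) <= 1).
    { destruct (Req_dec s 0) as [-> |Hs0]; [rewrite Rmult_0_r, exp_0; lra|].
      rewrite <- exp_0; apply Rlt_le, exp_increasing; destruct He as [-> | ->]; nra. }
    pose proof (Rabs_pos (L2 q / L1 q)); nra.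
  - destruct (Hnear 1 Rlt_0_1) as [delta Hdelta].
    exists delta; intros q Hq Hb; split; auto; intros v Hv.
    destruct (Hdelta q Hb) as [Hs _].
    apply filterlim_locally; intros eps; destruct (Hball eps) as [eta Heta].
    assert (Hrat : 0 < eta / (1 + Rabs (L2 q / L1 q))).
    { pose proof (Rabs_pos (L2 q / L1 q)); apply Rdiv_lt_0_compat; [apply cond_pos|lra]. }
    set (g := - (e * (m2 - m1))).
    destruct (exp_opp_small g _ ltac:(unfold g; lra) Hrat) as [S0 [HS0 HS]].
    (* The value of [K] when the linear flow has run for [S0] in the direction [e]; once
       [2 n lambda t] exceeds its absolute logarithm, the parameter has passed that point. *)
    set (kap := K (flow B (e * S0) q)).
    assert (Hkap : 0 < kap) by (apply timefun_pos, flow_neq0; auto; apply Hq).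
    exists (Rabs (ln kap) / (2 * INR n * lambda)); intros t Ht.
    assert (Ht' : Rabs (ln kap) < 2 * INR n * lambda * t).
    { apply Rmult_lt_reg_r with (/ (2 * INR n * lambda)); [now apply Rinv_0_lt_compat|].
      replace (2 * INR n * lambda * t * / (2 * INR n * lambda)) with t; auto.
      field; repeat split; intros Ez; rewrite Ez in Hc; lra. }
    assert (Ht0 : 0 <= t).
    { pose proof (Rabs_pos (ln kap)); apply Rnot_lt_le; intros Hlt; nra. }
    destruct (Hflow q v t Hq Hs Hv Ht0) as [s [Hes [-> Huniq]]].
    assert (Hne : q <> (0, 0)) by apply Hq.
    destruct (timefun_flow_surj lambda B phi n lambda_pos n_pos phi_hom phi_pos B_neg q
      (exp (2 * INR n * lambda * e * t)) Hne (exp_pos _)) as [S HS1].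
    assert (HSge : S0 <= e * S).
    { pose proof (Rle_abs (ln kap)); pose proof (Rle_abs (- ln kap)) as Hab; rewrite Rabs_Ropp in Hab.
      apply Rnot_lt_le; intros Hlt; destruct He as [-> | ->].
      - assert (Hk := timefun_flow_incr lambda B phi n lambda_pos n_pos phi_hom phi_pos B_neg q S (1 * S0)
          Hne ltac:(lra)); fold kap in Hk.
        rewrite HS1 in Hk; apply ln_increasing in Hk; [|apply exp_pos].
        rewrite ln_exp in Hk; lra.
      - assert (Hk := timefun_flow_incr lambda B phi n lambda_pos n_pos phi_hom phi_pos B_neg q (-1 * S0) S
          Hne ltac:(lra)); fold kap in Hk.
        rewrite HS1 in Hk; apply ln_increasing in Hk; auto.
        rewrite ln_exp in Hk; lra. }
    rewrite <- (Huniq S ltac:(lra) HS1).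
    apply Heta; rewrite Rabs_mult, (Rabs_right (exp _)) by (left; apply exp_pos).
    destruct (HS (e * S) HSge) as [_ Hsm].
    replace (- (g * (e * S))) with ((m2 - m1) * S) in Hsm by (unfold g; destruct He as [-> | ->]; ring).
    pose proof (Rabs_pos (L2 q / L1 q)); pose proof (cond_pos eta).
    apply Rle_lt_trans with (eta / (1 + Rabs (L2 q / L1 q)) * Rabs (L2 q / L1 q)); [nra|].
    apply Rmult_lt_reg_r with (1 + Rabs (L2 q / L1 q)); [lra|].
    replace (eta / (1 + Rabs (L2 q / L1 q)) * Rabs (L2 q / L1 q) * (1 + Rabs (L2 q / L1 q))) with
      (eta * Rabs (L2 q / L1 q)) by (field; lra).
    nra.
Qed.

(** The equilibria lie on the two eigenlines. On directions the slow coordinate dominates forwards,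
    so the points with [Q = 0] attract; in reversed time the roles are exchanged and those with
    [P = 0] attract. *)
Lemma four_equilibria_portrait :
  0 < discr B -> circle_dynamics FourEquilibria field (angular B phi) circle.
Proof.
  intros Hd; destruct (discr_regular B) as [e He]; [lra|].
  pose proof PI_RGT_0 as HPI; pose proof (omega_pos' B Hd) as Hw.
  set (P := slow B e); set (Q := fast B e).
  assert (Hlin : forall L : plane -> R, (forall r v, L (sc r v) = r * L v) ->
    forall t, L (cos (t + PI), sin (t + PI)) = - L (cos t, sin t)).
  { intros L HL t; rewrite neg_cos, neg_sin.
    replace (- cos t, - sin t) with (sc (-1) (cos t, sin t)) by (unfold sc; simpl; f_equal; ring).
    rewrite HL; ring. }
  assert (HPs : forall r v, P (sc r v) = r * P v) by (intros; now apply slow_sc).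
  assert (HQs : forall r v, Q (sc r v) = r * Q v) by (intros; now apply fast_sc).
  destruct (slow_fast_surj B e He Hd 1 0) as [f [Hf1 Hf2]].
  assert (Hf : f <> (0, 0)) by (intros E; rewrite E, slow_origin in Hf1; auto; lra).
  destruct (polar f Hf) as [r [t1 [Hr [_ Ef]]]].
  assert (HP1 : 0 < P (cos t1, sin t1)).
  { rewrite Ef in Hf1; fold P in Hf1; rewrite HPs in Hf1; nra. }
  assert (HQ1 : Q (cos t1, sin t1) = 0).
  { rewrite Ef in Hf2; fold Q in Hf2; rewrite HQs in Hf2; apply Rmult_integral in Hf2; destruct Hf2; auto; lra. }
  (* Being odd under a half turn, [P] has a zero between [t1] and [t1 + PI]. This produces the
     alternating order. *)
  destruct (IVT_gen (fun t => P (cos t, sin t)) t1 (t1 + PI) 0) as [t2 [Ht2 HP2]].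
  { intros t; apply cont_pt, (cont_slow B e He (fun t => (cos t, sin t) : plane)); cont. }
  { rewrite Hlin by auto; rewrite Rmin_right, Rmax_left; lra. }
  rewrite Rmin_left, Rmax_right in Ht2 by lra.
  assert (H12 : t1 <> t2) by (intros E; rewrite <- E in HP2; lra).
  assert (H21 : t2 <> t1 + PI) by (intros E; rewrite E, Hlin in HP2; auto; lra).
  assert (HPc : forall t, exists r, 0 < r /\ P (curve t) = r * P (cos t, sin t) /\ Q (curve t) = r * Q (cos t, sin t)).
  { intros t; exists (radius (cos t, sin t)); unfold circle_curve; split; [apply exp_pos|]; auto. }
  assert (Hc1 : Q (curve t1) = 0 /\ P (curve t1) <> 0).
  { destruct (HPc t1) as [k [Hk [-> ->]]]; rewrite HQ1; split; nra. }
  assert (HQ2 : Q (cos t2, sin t2) <> 0).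
  { intros E; apply (cos_sin_neq0 t2), (slow_fast_inj B e He Hd);
      [rewrite slow_origin by auto|rewrite fast_origin by auto]; auto. }
  assert (Hc2 : P (curve t2) = 0 /\ Q (curve t2) <> 0).
  { destruct (HPc t2) as [k [Hk [-> ->]]]; rewrite HP2; split; [ring|].
    apply Rmult_integral_contrapositive; split; auto; lra. }
  assert (Hop : forall t, curve (t + PI) = sc (-1) (curve t)) by (intros t; now apply curve_opp).
  assert (Heq : forall p, circle p -> (equilibrium field p <->
     p = curve t1 \/ p = curve t2 \/ p = curve (t1 + PI) \/ p = curve (t2 + PI))).
  { intros p Hp; rewrite (circle_equilibrium lambda B phi n) by auto.
    rewrite (slow_fast_form B e He Hd); fold P Q; split.
    - intros Hz; apply Rmult_integral in Hz; destruct Hz as [Hz|]; [|tauto].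
      apply Rmult_integral in Hz; destruct Hz as [Hz|Hz].
      + assert (E : p = sc (Q p / Q (curve t2)) (curve t2)).
        { apply (slow_fast_inj B e He Hd); fold P Q.
          - rewrite HPs, (proj1 Hc2), Hz; ring.
          - rewrite HQs; field; tauto. }
        rewrite Hop; rewrite E in Hp |- *.
        destruct (circle_line lambda B phi n lambda_pos n_pos phi_hom phi_pos B_neg _ _
          (curve_on_circle t2) Hp) as [h|h]; rewrite h; auto.
      + assert (E : p = sc (P p / P (curve t1)) (curve t1)).
        { apply (slow_fast_inj B e He Hd); fold P Q.
          - rewrite HPs; field; tauto.
          - rewrite HQs, (proj1 Hc1), Hz; ring. }
        rewrite (Hop t1); rewrite E in Hp |- *.
        destruct (circle_line lambda B phi n lambda_pos n_pos phi_hom phi_pos B_neg _ _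
          (curve_on_circle t1) Hp) as [h|h]; rewrite h; auto.
    - destruct Hc1 as [H1 _]; destruct Hc2 as [H2 _].
      intros [->|[->|[->| ->]]]; rewrite ?Hop, ?HPs, ?HQs, ?H1, ?H2; ring. }
  assert (Hatt : forall t, Q (curve t) = 0 -> P (curve t) <> 0 -> attracting_in circle field (curve t)).
  { intros t H1 H2; destruct (slow_fast_surj B e He Hd 0 (P (curve t))) as [z [Hz1 Hz2]].
    apply (dominated_attracting field P Q (half_trace B + omega B) (half_trace B - omega B) 1
      (curve t) z); auto; try lra.
    - intros q v T Hv HT; now apply forward_solves with (p := q).
    - intros q [Hq _]; exists (trajectory lambda B phi n q); now apply forward_exists.
    - apply (circle_equilibrium lambda B phi n); auto using curve_on_circle.
      rewrite (slow_fast_form B e He Hd); fold P Q; rewrite H1; ring.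
    - intros v; apply (cont_slow B e He (fun v => v)), continuous_id.
    - intros v; apply (cont_fast B e He (fun v => v)), continuous_id.
    - intros; now apply slow_plus.
    - intros; now apply fast_plus.
    - intros v w; now apply (slow_fast_inj B e He Hd).
    - intros s v; now apply hyperbolic_flow.
    - intros s v; now apply hyperbolic_flow.
    - apply curve_on_circle. }
  assert (Hrep : forall t, P (curve t) = 0 -> Q (curve t) <> 0 -> repelling_in circle field (curve t)).
  { intros t H1 H2; destruct (slow_fast_surj B e He Hd (Q (curve t)) 0) as [z [Hz1 Hz2]].
    apply (dominated_attracting (fun v => opp (field v)) Q P (half_trace B - omega B)
      (half_trace B + omega B) (-1) (curve t) z); auto; try lra.
    - intros q v T Hv HT; now apply backward_solves with (p := q).
    - intros q [Hq HK]; exists (fun t => trajectory lambda B phi n q (- t)).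
      apply backward_exists; auto; lra.
    - assert (E : equilibrium field (curve t)).
      { apply (circle_equilibrium lambda B phi n); auto using curve_on_circle.
        rewrite (slow_fast_form B e He Hd); fold P Q; rewrite H1; ring. }
      rewrite E; apply plane_eq; [change (- 0 = 0)|change (- 0 = 0)]; ring.
    - intros v; apply (cont_fast B e He (fun v => v)), continuous_id.
    - intros v; apply (cont_slow B e He (fun v => v)), continuous_id.
    - intros; now apply fast_plus.
    - intros; now apply slow_plus.
    - intros v w Hq Hp; now apply (slow_fast_inj B e He Hd).
    - intros s v; now apply hyperbolic_flow.
    - intros s v; now apply hyperbolic_flow.
    - apply curve_on_circle. }
  exists curve, t1, t2, (t1 + PI), (t2 + PI).
  split; [now apply circle_curve_param|].
  repeat (split; [lra|]); split; [exact Heq|].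
  destruct Hc1 as [H1 H1']; destruct Hc2 as [H2 H2'].
  split; [now apply Hatt|split; [now apply Hrep|split]].
  - apply Hatt; rewrite Hop, ?HPs, ?HQs; [rewrite H1; ring|lra].
  - apply Hrep; rewrite Hop, ?HPs, ?HQs; [rewrite H2; ring|lra].
Qed.

Lemma algebraic_has_type (T : portrait_type) :
  algebraic_type T B -> has_type T lambda B phi n.
Proof.
  intros HT; split; [now apply origin_source with (n := n)|].
  exists circle; split; [|split; [|split; [|split; [|split]]]].
  - exists curve; now apply circle_curve_param.
  - now apply level_circle_invariant.
  - now apply level_circle_surrounds.
  - now apply level_circle_attracts.
  - now apply level_circle_flow_equivalent.
  - destruct T; simpl in HT.
    + now apply limit_cycle_portrait.
    + now apply four_equilibria_portrait.
    + destruct HT as [Hd [e He]]; now apply saddle_node_portrait with (e := e).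
    + now apply circle_of_equilibria_portrait.
Qed.

End PortraitFromType.

(** * Orbits in the Poincare disc *)

(** A positive factor of the speed is removed by a change of time. It is controlled only on the
    compact interval, hence the clamp and the restriction to the open interval at the end. *)
Lemma reparametrized_orbit (G : plane -> plane) (u : R -> plane) (c : R -> R) (a b t : R) :
  a < 0 < b -> a < t < b ->
  (forall s, a <= s <= b -> is_derive u s (sc (c s) (G (u s)))) ->
  (forall s, a <= s <= b -> continuous c s) -> (forall s, a <= s <= b -> 0 < c s) ->
  same_orbit G (u 0) (u t).
Proof.
  intros H0 Ht Hu Hc Hp.
  destruct (continuity_ab_min c a b) as [m [Hm Hmab]]; [lra|intros; now apply cont_pt, Hc|].
  destruct (time_change (fun s => c (clamp a b s)) (c m))
    as [tau [iota [Htau0 [Hi0 [Htau [Hincr [Hti [Hit Hiota]]]]]]]].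
  - intros s; apply cont_comp_clamp; auto; lra.
  - now apply Hp.
  - intros s; apply Hm, clamp_bounds; lra.
  - exists (fun r => u (iota r)), (tau a), (tau b), (tau t).
    rewrite <- Htau0.
    split; [split; apply Hincr; lra|]; split; [split; apply Hincr; lra|].
    rewrite Htau0, Hi0, Hit; split; auto.
    intros r Hr.
    assert (Hir : a < iota r < b).
    { rewrite <- (Hti r) in Hr; split; apply (incr_lt_inv tau Hincr); tauto. }
    eapply is_derive_val_plane.
    + apply (derive_comp_plane u iota r _ _ (Hu (iota r) ltac:(lra)) (Hiota r)).
    + cbv beta; rewrite clamp_id by lra.
      assert (Hpos := Hp (iota r) ltac:(lra)).
      rewrite scal_sc, sc_sc, Rinv_l, sc_1; auto; lra.
Qed.

Section DiscOrbits.

Variables (lambda : R) (B : @matrix R 2 2) (phi : plane -> R) (n : nat).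
Hypothesis lambda_pos : 0 < lambda.
Hypothesis n_pos : (1 <= n)%nat.
Hypothesis phi_hom : homogeneous_poly (2 * n) phi.
Hypothesis phi_pos : positive_definite phi.
Hypothesis B_neg : negative_definite (quad_form B).

Notation field := (vector_field lambda B phi).
Notation disc_field := (poincare_field lambda B phi n).
Notation K := (timefun lambda B phi n).

Definition depth (w : plane) : R := 1 - dot w w.

Definition disc_growth (w : plane) : R :=
  lambda * depth w ^ (n + 1) - phi w * quad_form B w.

(** The correction tangent to the sphere only alters the multiple of [w], so the field again has the
    shape that [moving_frame] handles. *)
Lemma disc_field_eq (w : plane) :
  disc_field w = plus (sc (disc_growth w) w) (sc (phi w) (mat_app B w)).
Proof.
  unfold poincare_field, disc_growth, quad_form, nonlinearity, depth; set (m := mat_app B w).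
  apply plane_eq.
  - change (lambda * (1 - dot w w) ^ (n + 1) * fst w +
      (phi w * fst m - (fst w * (phi w * fst m) + snd w * (phi w * snd m)) * fst w) =
      (lambda * (1 - dot w w) ^ (n + 1) - phi w * (fst w * fst m + snd w * snd m)) * fst w + phi w * fst m).
    ring.
  - change (lambda * (1 - dot w w) ^ (n + 1) * snd w +
      (phi w * snd m - (fst w * (phi w * fst m) + snd w * (phi w * snd m)) * snd w) =
      (lambda * (1 - dot w w) ^ (n + 1) - phi w * (fst w * fst m + snd w * snd m)) * snd w + phi w * snd m).
    ring.
Qed.

Lemma cont_disc_growth (w : plane) : continuous disc_growth w.
Proof.
  assert (H : continuous phi w) by exact (phi_cont phi n phi_hom w).
  unfold disc_growth, depth, quad_form, dot, mat_app; simpl; cont.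
Qed.

Definition disc_solves (w : R -> plane) (T : R) : Prop :=
  forall t, Rmin 0 T <= t <= Rmax 0 T -> is_derive w t (disc_field (w t)).

Lemma disc_solves_form (w : R -> plane) (T : R) :
  disc_solves w T ->
  exists a s : R -> R, a 0 = 0 /\ s 0 = 0 /\
    forall t, Rmin 0 T <= t <= Rmax 0 T ->
      is_derive a t (disc_growth (w t)) /\ is_derive s t (phi (w t)) /\
      w t = sc (exp (a t)) (flow B (s t) (w 0)).
Proof.
  intros Hw.
  assert (Hle := Rle_trans _ _ _ (proj1 (Rmin_Rmax_0 T)) (proj2 (Rmin_Rmax_0 T))).
  set (cl := clamp (Rmin 0 T) (Rmax 0 T)).
  assert (Hwc : forall u, Rmin 0 T <= u <= Rmax 0 T -> continuous w u).
  { intros u Hu; apply (derive_cont_plane w u _ (Hw u Hu)). }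
  destruct (primitive_exists (fun t => disc_growth (w (cl t)))) as [a [Ha0 Ha]].
  { apply (cont_comp_clamp (fun t => disc_growth (w t))); auto.
    intros u Hu; apply (cont_comp_plane disc_growth w); auto using cont_disc_growth. }
  destruct (primitive_exists (fun t => phi (w (cl t)))) as [s [Hs0 Hs]].
  { apply (cont_comp_clamp (fun t => phi (w t))); auto.
    intros u Hu; apply (cont_comp_plane phi w); auto; apply (phi_cont phi n phi_hom). }
  exists a, s; split; [|split]; auto; intros t Ht.
  assert (Hcl : forall u, Rmin 0 T <= u <= Rmax 0 T -> cl u = u) by (intros; now apply clamp_id).
  split; [|split].
  - rewrite <- (Hcl t Ht) at 2; apply Ha.
  - rewrite <- (Hcl t Ht) at 2; apply Hs.
  - apply (moving_frame B a s (fun t => disc_growth (w (cl t))) (fun t => phi (w (cl t)))); auto.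
    intros u Hu; assert (Hu' : Rmin 0 T <= u <= Rmax 0 T).
    { revert Ht Hu; unfold Rmin, Rmax; repeat destruct Rle_dec; lra. }
    rewrite (Hcl u Hu'), <- disc_field_eq; now apply Hw.
Qed.

Lemma derive_depth (w : R -> plane) (t : R) :
  is_derive w t (disc_field (w t)) ->
  is_derive (fun t => depth (w t)) t
    (-2 * (lambda * depth (w t) ^ n * dot (w t) (w t) + phi (w t) * quad_form B (w t)) * depth (w t)).
Proof.
  intros Hw; destruct (is_derive_coords _ _ _ Hw) as [H1 H2]; rewrite disc_field_eq in H1, H2.
  eapply is_derive_val.
  - unfold depth, dot; apply derive_sub; [apply derive_const|].
    apply derive_add; apply derive_mul; eassumption.
  - unfold disc_growth; rewrite Nat.add_1_r; simpl.
    set (d := depth (w t) ^ n); unfold quad_form, depth, dot, sc; simpl; unfold plus; simpl.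
    ring.
Qed.

(** The derivative of [depth] has [depth] as a factor, so the circle at infinity and the open disc
    are both invariant. *)
Lemma depth_sign (w : R -> plane) (T : R) :
  disc_solves w T -> exists r, 0 < r /\ depth (w T) = r * depth (w 0).
Proof.
  intros Hw.
  assert (Hle := Rle_trans _ _ _ (proj1 (Rmin_Rmax_0 T)) (proj2 (Rmin_Rmax_0 T))).
  set (f := fun t => -2 * (lambda * depth (w t) ^ n * dot (w t) (w t) + phi (w t) * quad_form B (w t))).
  apply (linear_scalar_ode (fun t => depth (w t)) (fun t => f (clamp (Rmin 0 T) (Rmax 0 T) t))).
  - apply cont_comp_clamp; auto; intros u Hu.
    assert (Hwu : continuous w u) by apply (derive_cont_plane w u _ (Hw u Hu)).
    assert (Hph : continuous (fun t => phi (w t)) u).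
    { apply (cont_comp_plane phi w); auto; apply (phi_cont phi n phi_hom). }
    unfold f, depth, quad_form, dot, mat_app; simpl; cont.
  - intros t Ht; rewrite clamp_id by auto; unfold f; apply derive_depth, Hw, Ht.
Qed.

(** The counterpart of [solves_point] in the chart: there [v = w / sqrt (depth w)], so the
    exponential of time becomes [(A^2 / depth)^n] up to the constant [depth (w 0) ^ n]. *)
Lemma disc_solves_point (w : R -> plane) (T : R) :
  disc_solves w T -> w 0 <> (0, 0) ->
  exists s A, 0 < A /\ w T = sc A (flow B s (w 0)) /\
    (0 < depth (w 0) -> K (flow B s (w 0)) - (A * A / depth (w T)) ^ n =
       K (w 0) - (/ depth (w 0)) ^ n).
Proof.
  intros Hw H0; destruct (disc_solves_form w T Hw) as [a [s [Ha0 [Hs0 Has]]]].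
  exists (s T), (exp (a T)); split; [apply exp_pos|].
  split; [apply Has, Rmin_Rmax_T|]; intros Hd.
  assert (Hdt : forall t, Rmin 0 T <= t <= Rmax 0 T -> 0 < depth (w t)).
  { intros t Ht; destruct (depth_sign w t) as [r [Hr ->]]; [|nra].
    intros u Hu; apply Hw; revert Ht Hu; unfold Rmin, Rmax; repeat destruct Rle_dec; lra. }
  set (h := fun t => K (flow B (s t) (w 0)) - (exp (2 * a t) * / depth (w t)) ^ n).
  assert (H : h T = h 0).
  { apply derive_zero_const; intros t Ht; destruct (Has t Ht) as [H1 [H2 H3]].
    assert (Hpos := Hdt t Ht).
    eapply is_derive_val.
    - unfold h; apply derive_sub.
      + apply (derive_comp (fun s => K (flow B s (w 0))) s t _ _
          (timefun_derive lambda B phi n lambda_pos n_pos phi_hom phi_pos B_neg (w 0) (s t) H0) H2).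
      + apply derive_pow, derive_mul; [apply derive_exp, derive_scal, H1|].
        apply (is_derive_inv (fun t => depth (w t))); [apply derive_depth, Hw, Ht|lra].
    - assert (Hp : phi (w t) = exp (2 * a t) ^ n * phi (flow B (s t) (w 0))).
      { rewrite H3, (phi_sc phi n phi_hom), pow_mult; f_equal; f_equal.
        simpl; rewrite Rmult_1_r, <- exp_plus; f_equal; ring. }
      unfold rate; rewrite Hp at 1.
      pose proof (phi_pos _ (flow_neq0 B (s t) (w 0) H0)) as Hphi.
      set (E := exp (2 * a t)) in *; unfold disc_growth; rewrite Nat.add_1_r.
      replace n with (S (pred n)) in * by lia; simpl Nat.pred.
      rewrite !(Rpow_mult_distr E (/ depth (w t))), !pow_inv.
      set (m := pred n) in *.
      assert (Hdm := pow_lt _ m Hpos).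
      assert (Hdot : dot (w t) (w t) = 1 - depth (w t)) by (unfold depth; ring).
      rewrite Hdot; set (D := depth (w t)) in *.
      rewrite <- !tech_pow_Rmult, pow_O; field; repeat split; lra. }
  unfold h in H; rewrite Ha0, Hs0, flow_0, Rmult_0_r, exp_0, Rmult_1_l in H.
  replace (exp (2 * a T)) with (exp (a T) * exp (a T)) in H by (rewrite <- exp_plus; f_equal; ring).
  exact H.
Qed.

Lemma disc_solves_origin (w : R -> plane) (T : R) :
  disc_solves w T -> w 0 = (0, 0) -> w T = (0, 0).
Proof.
  intros Hw H0; destruct (disc_solves_form w T Hw) as [a [s [_ [_ Has]]]].
  destruct (Has T (Rmin_Rmax_T T)) as [_ [_ ->]]; rewrite H0, flow_origin; apply sc_0.
Qed.

Lemma same_orbit_disc_solves (p q : plane) :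
  same_orbit disc_field p q -> exists w t, disc_solves w t /\ w 0 = p /\ w t = q.
Proof.
  intros [w [a [b [t [H0 [Ht [Hw [Hp Hq]]]]]]]]; exists w, t; split; auto.
  intros s Hs; apply Hw; revert Hs; unfold Rmin, Rmax; repeat destruct Rle_dec; lra.
Qed.

Lemma poincare_chart_inverse (p : plane) :
  0 < depth p -> poincare_chart (sc (/ sqrt (depth p)) p) = p.
Proof.
  intros Hd; pose proof (sqrt_lt_R0 _ Hd) as Hs; pose proof (sqrt_sqrt _ (Rlt_le _ _ Hd)) as Hss.
  unfold poincare_chart; rewrite scal_sc, dot_sc, sc_sc.
  replace (1 + / sqrt (depth p) * / sqrt (depth p) * dot p p) with (Rsqr (/ sqrt (depth p))).
  - rewrite sqrt_Rsqr by (left; now apply Rinv_0_lt_compat).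
    rewrite Rinv_inv, Rinv_r by lra; apply sc_1.
  - unfold Rsqr; replace (dot p p) with (1 - depth p) by (unfold depth; ring).
    set (x := sqrt (depth p)) in *; rewrite <- Hss; field; lra.
Qed.

(** Pulled back to the plane, the conserved quantity says that the explicit trajectory through the
    preimage of [p] passes through that of the second point; its image under the chart is an orbit
    up to a time change. *)
Lemma interior_orbit (p : plane) (s A : R) :
  p <> (0, 0) -> 0 < A -> 0 < depth p -> 0 < depth (sc A (flow B s p)) ->
  K (flow B s p) - (A * A / depth (sc A (flow B s p))) ^ n = K p - (/ depth p) ^ n ->
  same_orbit disc_field p (sc A (flow B s p)).
Proof.
  intros Hp HA Hdp Hdq HK; set (q := sc A (flow B s p)) in *.
  pose proof (sqrt_lt_R0 _ Hdp) as Hsp; pose proof (sqrt_sqrt _ (Rlt_le _ _ Hdp)) as Hssp.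
  pose proof (sqrt_lt_R0 _ Hdq) as Hsq; pose proof (sqrt_sqrt _ (Rlt_le _ _ Hdq)) as Hssq.
  set (x := sqrt (depth p)) in *; set (y := sqrt (depth q)) in *.
  set (v0 := sc (/ x) p).
  assert (Hv0 : v0 <> (0, 0)) by (apply sc_neq0; auto; apply Rinv_neq_0_compat; lra).
  (* The scale factor measured in the plane. Since solutions scale by [exp (lambda * t)], it fixes
     the time [t1]. *)
  set (rho := A * x / y).
  assert (Hrho : 0 < rho) by (apply Rdiv_lt_0_compat; nra).
  set (t1 := ln rho / lambda).
  assert (Hscale : forall v, v <> (0, 0) -> K (sc (/ x) v) = depth p ^ n * K v).
  { intros v Hv; rewrite timefun_sc by (auto; apply Rinv_neq_0_compat; lra).
    rewrite pow_mult, pow_inv.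
    replace (x ^ 2) with (depth p) by (rewrite <- Hssp; ring).
    rewrite pow_inv; pose proof (pow_lt _ n Hdp); field; lra. }
  assert (Hexp : exp (2 * INR n * lambda * t1) = (rho * rho) ^ n).
  { replace (2 * INR n * lambda * t1) with (INR n * (ln rho + ln rho)) by (unfold t1; field; lra).
    rewrite <- exp_pow, exp_plus, exp_ln; auto. }
  assert (HKs : K (flow B s v0) = K v0 + exp (2 * INR n * lambda * t1) - 1).
  { unfold v0; rewrite flow_sc, !Hscale, Hexp by auto using flow_neq0.
    replace (K (flow B s p)) with (K p - (/ depth p) ^ n + (A * A / depth q) ^ n) by lra.
    rewrite !Rmult_plus_distr_l, Rmult_minus_distr_l, <- !Rpow_mult_distr, Rinv_r, pow1 by lra.
    replace (depth p * (A * A / depth q)) with (rho * rho); [ring|].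
    unfold rho; rewrite <- Hssp, <- Hssq; field; lra. }
  pose proof (rate_const_pos lambda n lambda_pos n_pos) as Hc.
  set (h := fun t => K v0 + exp (2 * INR n * lambda * t) - 1).
  assert (Hinc : forall u v, u <= v -> h u <= h v).
  { intros u v Huv; unfold h; destruct (Req_dec u v) as [->|]; [lra|].
    assert (exp (2 * INR n * lambda * u) < exp (2 * INR n * lambda * v)); [|lra].
    apply exp_increasing, Rmult_lt_compat_l; lra. }
  assert (Hh0 : 0 < h (Rmin 0 t1)).
  { unfold Rmin; destruct Rle_dec; unfold h.
    - rewrite Rmult_0_r, exp_0; pose proof (timefun_pos lambda B phi n lambda_pos n_pos phi_hom
        phi_pos B_neg v0 Hv0); lra.
    - rewrite <- HKs; now apply timefun_pos, flow_neq0. }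
  (* An orbit needs an open time interval. As [h] is increasing, the trajectory can only end on the
     left, and continuity keeps [h] positive slightly before both [0] and [t1]. *)
  assert (Hhc : continuous h (Rmin 0 t1)) by (unfold h; cont).
  destruct (Hhc (fun r => 0 < r) (open_gt 0 _ Hh0)) as [d Hd].
  set (a := Rmin 0 t1 - d / 2); pose proof (cond_pos d) as Hdpos.
  assert (Ha : 0 < h a).
  { apply Hd; change (Rabs (a - Rmin 0 t1) < d); unfold a.
    replace (Rmin 0 t1 - d / 2 - Rmin 0 t1) with (- (d / 2)) by ring.
    rewrite Rabs_Ropp, Rabs_right; lra. }
  set (v := trajectory lambda B phi n v0).
  assert (Hv : forall t, a <= t -> is_derive v t (field (v t))).
  { intros t Ht; apply trajectory_derive; auto; apply Rlt_le_trans with (h a); auto; now apply Hinc. }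
  assert (Hvt1 : v t1 = sc rho (flow B s v0)).
  { unfold v, trajectory; rewrite <- HKs, clock_inverse_unique by auto.
    replace (lambda * t1) with (ln rho) by (unfold t1; field; lra); now rewrite exp_ln. }
  assert (Hpq : q = poincare_chart (v t1)).
  { rewrite Hvt1; unfold v0; rewrite flow_sc, sc_sc.
    rewrite <- (poincare_chart_inverse q Hdq) at 1; fold y; f_equal.
    unfold q; rewrite sc_sc; f_equal; unfold rho; field; lra. }
  assert (Hpp : p = poincare_chart (v 0)).
  { unfold v; rewrite trajectory_0 by auto; symmetry; now apply poincare_chart_inverse. }
  rewrite Hpq, Hpp at 1.
  pose proof (Rmin_l 0 t1); pose proof (Rmin_r 0 t1).
  pose proof (Rmax_l 0 t1); pose proof (Rmax_r 0 t1).
  apply (reparametrized_orbit disc_field (fun t => poincare_chart (v t))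
    (fun t => (1 + dot (v t) (v t)) ^ n) a (Rmax 0 t1 + 1)).
  - unfold a; lra.
  - unfold a; lra.
  - intros u Hu; apply poincare_chart_solution; auto; apply Hv; lra.
  - intros u Hu; assert (continuous v u) by apply (derive_cont_plane v u _ (Hv u (proj1 Hu))).
    unfold dot; cont.
  - intros u _; apply pow_lt; pose proof (dot_nonneg (v u)); lra.
Qed.

Lemma boundary_orbit (p : plane) (s A : R) :
  0 < A -> dot p p = 1 -> dot (sc A (flow B s p)) (sc A (flow B s p)) = 1 ->
  same_orbit disc_field p (sc A (flow B s p)).
Proof.
  intros HA Hp Hq.
  assert (Hp0 : p <> (0, 0)) by (apply dot_pos_neq0; lra).
  assert (Hne : forall t, flow B t p <> (0, 0)) by (intros; now apply flow_neq0).
  rewrite <- (unit_of_unit _ Hq), unit_sc by auto.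
  rewrite <- (unit_of_unit _ Hp) at 1; rewrite <- (flow_0 B p) at 1.
  set (M := Rabs s + 1); pose proof (Rle_abs s); pose proof (Rle_abs (- s)) as Hs.
  rewrite Rabs_Ropp in Hs; pose proof (Rabs_pos s).
  assert (Hu : forall t, is_derive (fun t => unit (flow B t p)) t (sc 1 (tangential B (unit (flow B t p))))).
  { intros t; apply (derive_unit B (fun t => flow B t p) t 0 1); auto.
    eapply is_derive_val_plane; [apply derive_flow|].
    apply plane_eq; unfold sc, plus; simpl; unfold plus; simpl; ring. }
  assert (Hph : forall t, 0 < phi (unit (flow B t p))) by (intros; now apply phi_pos, unit_neq0).
  apply (reparametrized_orbit disc_field (fun t => unit (flow B t p))
    (fun t => / phi (unit (flow B t p))) (- M) M).
  - unfold M; lra.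
  - unfold M; lra.
  - intros t _; eapply is_derive_val_plane; [apply Hu|].
    rewrite poincare_field_boundary by (auto; now apply dot_unit).
    specialize (Hph t); rewrite sc_sc; f_equal; field; lra.
  - intros t _; specialize (Hph t); apply cont_inv; [|lra].
    apply (cont_comp_plane phi (fun t => unit (flow B t p))); [|apply (phi_cont phi n phi_hom)].
    apply (derive_cont_plane _ _ _ (Hu t)).
  - intros t _; now apply Rinv_0_lt_compat.
Qed.

Lemma same_orbit_origin (q : plane) : same_orbit disc_field (0, 0) q <-> q = (0, 0).
Proof.
  split.
  - intros H; destruct (same_orbit_disc_solves _ _ H) as [w [t [Hw [H0 <-]]]].
    now apply disc_solves_origin.
  - intros ->; exists (fun _ => (0, 0)), (-1), 1, 0; repeat (split; [lra|]); split; auto.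
    intros t _; eapply is_derive_val_plane; [apply (is_derive_const ((0, 0) : plane))|].
    rewrite disc_field_eq, mat_app_traceless; apply plane_eq; unfold traceless, sc, plus; simpl;
      unfold plus; simpl; unfold zero; simpl; ring.
Qed.

(** [K] transported to the disc: it vanishes on the circle at infinity, and equals
    [1] on the image of the invariant circle. *)
Definition disc_time (w : plane) : R := K w * depth w ^ n.

Lemma disc_time_nonneg (w : plane) : w <> (0, 0) -> poincare_disc w -> 0 <= disc_time w.
Proof.
  intros Hw Hd; apply Rmult_le_pos; [now apply Rlt_le, timefun_pos|].
  apply pow_le; unfold depth; unfold poincare_disc in Hd; lra.
Qed.

(** The conserved quantity with its denominators cleared. At infinity [disc_time] vanishes: the
    equation then holds trivially for two boundary points and excludes a boundary point paired with
    an interior one. *)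
Lemma same_orbit_disc (p q : plane) :
  p <> (0, 0) -> poincare_disc p -> poincare_disc q ->
  (same_orbit disc_field p q <-> exists s A, 0 < A /\ q = sc A (flow B s p) /\
     K (flow B s p) * (disc_time q - 1) * disc_time p =
     K p * (disc_time p - 1) * disc_time q).
Proof.
  intros Hp Hdp Hdq.
  assert (HKp := timefun_pos lambda B phi n lambda_pos n_pos phi_hom phi_pos B_neg p Hp).
  assert (Hexpand : forall s A, 0 < A -> q = sc A (flow B s p) ->
    disc_time q = K (flow B s p) / (A * A) ^ n * depth q ^ n).
  { intros s A HA ->; unfold disc_time; rewrite timefun_sc by (auto using flow_neq0; lra).
    rewrite pow_mult; replace (A ^ 2) with (A * A) by ring; reflexivity. }
  assert (Hkey : forall s A, 0 < A -> q = sc A (flow B s p) -> 0 < depth p -> 0 < depth q ->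
    (K (flow B s p) * (disc_time q - 1) * disc_time p = K p * (disc_time p - 1) * disc_time q <->
     K (flow B s p) - (A * A / depth q) ^ n = K p - (/ depth p) ^ n)).
  { intros s A HA Hq Hdp' Hdq'; rewrite (Hexpand s A HA Hq); unfold disc_time.
    assert (HKs := timefun_pos lambda B phi n lambda_pos n_pos phi_hom phi_pos B_neg _
      (flow_neq0 B s p Hp)).
    replace ((A * A / depth q) ^ n) with ((A * A) ^ n * / depth q ^ n)
      by (rewrite <- pow_inv, <- Rpow_mult_distr; reflexivity).
    rewrite !pow_inv.
    pose proof (pow_lt _ n Hdp') as H1; pose proof (pow_lt _ n Hdq') as H2.
    pose proof (pow_lt (A * A) n ltac:(nra)) as H3.
    set (kp := K p) in *; set (ks := K (flow B s p)) in *; set (x := depth p ^ n) in *;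
      set (y := depth q ^ n) in *; set (z := (A * A) ^ n) in *; clearbody kp ks x y z.
    (* The cleared equation is the original one multiplied by this factor. *)
    assert (Hf : 0 < ks * kp * x * y / z).
    { apply Rdiv_lt_0_compat; auto; repeat apply Rmult_lt_0_compat; auto. }
    split; intros E.
    - apply Rmult_eq_reg_l with (ks * kp * x * y / z); [|lra].
      transitivity (ks * (ks / z * y - 1) * (kp * x)); [field; lra|].
      rewrite E; field; lra.
    - transitivity (ks * kp * x * y / z * (ks - z * / y)); [field; lra|].
      rewrite E; field; lra. }
  assert (Hdp' : 0 <= depth p) by (unfold depth; unfold poincare_disc in Hdp; lra).
  assert (Hdq' : 0 <= depth q) by (unfold depth; unfold poincare_disc in Hdq; lra).
  assert (Hz : forall w, depth w = 0 -> disc_time w = 0).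
  { intros w Hw; unfold disc_time; rewrite Hw, pow_i by lia; ring. }
  split.
  - intros H; destruct (same_orbit_disc_solves _ _ H) as [w [t [Hw [H0 Ht]]]].
    assert (Hw0 : w 0 <> (0, 0)) by congruence.
    destruct (disc_solves_point w t Hw Hw0) as [s [A [HA [Hq Hc]]]].
    destruct (depth_sign w t Hw) as [r [Hr Hdr]].
    rewrite H0, Ht in *.
    exists s, A; split; [|split]; auto.
    destruct (Req_dec (depth p) 0) as [E|E].
    + assert (E' : depth q = 0) by (rewrite Hdr, E; ring).
      rewrite (Hz p E), (Hz q E'); ring.
    + assert (Hdq0 : 0 < depth q) by (rewrite Hdr; apply Rmult_lt_0_compat; lra).
      apply (Hkey s A HA Hq ltac:(lra) Hdq0), Hc; lra.
  - intros [s [A [HA [Hq Hc]]]].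
    assert (HKs := timefun_pos lambda B phi n lambda_pos n_pos phi_hom phi_pos B_neg _
      (flow_neq0 B s p Hp)).
    assert (Hq0 : q <> (0, 0)) by (rewrite Hq; apply sc_neq0; [lra|now apply flow_neq0]).
    assert (Hpt : forall w, w <> (0, 0) -> 0 < depth w -> 0 < disc_time w).
    { intros w Hw Hd; apply Rmult_lt_0_compat; [now apply timefun_pos|now apply pow_lt]. }
    destruct (Req_dec (depth p) 0) as [E|E].
    + rewrite (Hz p E) in Hc.
      assert (E' : depth q = 0).
      { apply NNPP; intros N; assert (0 < disc_time q) by (apply Hpt; auto; lra); nra. }
      rewrite Hq; apply boundary_orbit; auto; unfold depth in E, E'; rewrite <- ?Hq; lra.
    + assert (E' : depth q <> 0).
      { intros E'; rewrite (Hz q E') in Hc; assert (0 < disc_time p) by (apply Hpt; auto; lra); nra. }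
      rewrite Hq; apply interior_orbit; auto; rewrite <- ?Hq; try lra.
      apply (Hkey s A HA Hq ltac:(lra) ltac:(lra)), Hc.
Qed.

End DiscOrbits.

(** * Conjugacies of the disc *)

(** The odd extension of [x => x ^ c]. *)
Definition odd_power (c x : R) : R :=
  if Rlt_dec 0 x then exp (c * ln x) else if Rlt_dec x 0 then - exp (c * ln (- x)) else 0.

Section OddPower.

Variable c : R.
Hypothesis c_pos : 0 < c.

Lemma odd_power_pos (x : R) : 0 < x -> odd_power c x = exp (c * ln x).
Proof. intros H; unfold odd_power; destruct Rlt_dec; auto; lra. Qed.

Lemma odd_power_0 : odd_power c 0 = 0.
Proof. unfold odd_power; repeat destruct Rlt_dec; lra. Qed.

Lemma odd_power_opp (x : R) : odd_power c (- x) = - odd_power c x.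
Proof.
  unfold odd_power; repeat destruct Rlt_dec; try lra; rewrite ?Ropp_involutive; ring.
Qed.

Lemma odd_power_1 : odd_power c 1 = 1.
Proof. rewrite odd_power_pos by lra; rewrite ln_1, Rmult_0_r; apply exp_0. Qed.

Lemma odd_power_gt0 (x : R) : 0 < x -> 0 < odd_power c x.
Proof. intros H; rewrite odd_power_pos by auto; apply exp_pos. Qed.

Lemma odd_power_mult_pos (r x : R) : 0 < r -> odd_power c (r * x) = odd_power c r * odd_power c x.
Proof.
  intros Hr.
  assert (Hpos : forall y, 0 < y -> odd_power c (r * y) = odd_power c r * odd_power c y).
  { intros y Hy; rewrite !odd_power_pos by nra; rewrite ln_mult, Rmult_plus_distr_l, exp_plus; auto. }
  destruct (Rtotal_order x 0) as [Hx|[->|Hx]]; auto.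
  - replace (r * x) with (- (r * - x)) by ring.
    rewrite odd_power_opp, Hpos, odd_power_opp by lra; ring.
  - rewrite Rmult_0_r, odd_power_0; ring.
Qed.

Lemma odd_power_incr (x y : R) : x < y -> odd_power c x < odd_power c y.
Proof.
  assert (Hpos : forall x y, 0 < x -> x < y -> odd_power c x < odd_power c y).
  { intros a b Ha Hab; rewrite !odd_power_pos by lra.
    apply exp_increasing, Rmult_lt_compat_l; auto; now apply ln_increasing. }
  intros Hxy; destruct (Rlt_le_dec 0 x) as [Hx|Hx]; [now apply Hpos|].
  destruct (Rlt_le_dec 0 y) as [Hy|Hy].
  - pose proof (odd_power_gt0 y Hy); destruct Hx as [Hx|Hx].
    + pose proof (odd_power_gt0 (- x) ltac:(lra)); rewrite odd_power_opp in *; lra.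
    + subst; rewrite odd_power_0; lra.
  - destruct Hy as [Hy|Hy].
    + pose proof (Hpos (- y) (- x) ltac:(lra) ltac:(lra)) as H; rewrite !odd_power_opp in H; lra.
    + subst; rewrite odd_power_0; pose proof (odd_power_gt0 (- x) ltac:(lra)) as H.
      rewrite odd_power_opp in H; lra.
Qed.

Lemma odd_power_inj (x y : R) : odd_power c x = odd_power c y -> x = y.
Proof. apply (incr_inj (odd_power c)), odd_power_incr. Qed.

Lemma cont_odd_power_pos (x : R) : 0 < x -> continuous (odd_power c) x.
Proof.
  intros Hx; apply (continuous_ext_loc _ (fun x => exp (c * ln x))).
  - apply (filter_imp (fun y => 0 < y)); [intros; now rewrite odd_power_pos|].
    apply open_gt, Hx.
  - cont; auto.
Qed.

Lemma cont_odd_power (x : R) : continuous (odd_power c) x.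
Proof.
  destruct (Rtotal_order x 0) as [Hx|[->|Hx]].
  - apply (continuous_ext (fun x => - odd_power c (- x))).
    { intros y; rewrite odd_power_opp; apply Ropp_involutive. }
    apply cont_opp, (cont_real (odd_power c) (fun x => - x)); cont.
    apply cont_odd_power_pos; lra.
  - apply filterlim_locally; intros e; rewrite odd_power_0; assert (He := cond_pos e).
    set (d := exp (ln e / c)); assert (Hd : 0 < d) by apply exp_pos.
    assert (Hde : odd_power c d = e).
    { rewrite odd_power_pos by auto; unfold d; rewrite ln_exp.
      replace (c * (ln e / c)) with (ln e) by (field; lra); now apply exp_ln. }
    exists (mkposreal d Hd); intros y Hy.
    change (Rabs (y - 0) < d) in Hy; change (Rabs (odd_power c y - 0) < e).
    rewrite Rminus_0_r in *; apply Rabs_def2 in Hy; destruct Hy as [H1 H2].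
    apply odd_power_incr in H1; apply odd_power_incr in H2; rewrite odd_power_opp in H2.
    apply Rabs_def1; lra.
  - now apply cont_odd_power_pos.
Qed.

End OddPower.

(** * Conjugacy of relations on the disc *)

Lemma continuous_on_comp (S T : plane -> Prop) (f g : plane -> plane) :
  continuous_on S f -> (forall p, S p -> T (f p)) -> continuous_on T g ->
  continuous_on S (fun p => g (f p)).
Proof.
  intros Hf HST Hg; apply within_ball; intros p Hp e.
  destruct (proj1 (within_ball T g) Hg (f p) (HST p Hp) e) as [d Hd].
  destruct (proj1 (within_ball S f) Hf p Hp d) as [d' Hd'].
  exists d'; intros q Hq HSq; apply Hd; auto.
Qed.

Definition conjugate (R1 R2 : plane -> plane -> Prop) : Prop :=
  exists h, homeomorphism poincare_disc poincare_disc h /\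
    forall p q, poincare_disc p -> poincare_disc q -> (R1 p q <-> R2 (h p) (h q)).

Lemma conjugate_trans (R1 R2 R3 : plane -> plane -> Prop) :
  conjugate R1 R2 -> conjugate R2 R3 -> conjugate R1 R3.
Proof.
  intros [h [[Hc [Hd [k [Kc [Kd [Hkh Hhk]]]]]] H]] [h' [[Hc' [Hd' [k' [Kc' [Kd' [Hkh' Hhk']]]]]] H']].
  exists (fun p => h' (h p)); split.
  - split; [now apply (continuous_on_comp _ poincare_disc)|split; [auto|]].
    exists (fun q => k (k' q)); split; [now apply (continuous_on_comp _ poincare_disc)|].
    split; [auto|split].
    + intros p Hp; rewrite Hkh'; auto.
    + intros q Hq; rewrite Hhk; auto.
  - intros p q Hp Hq; rewrite H, H'; auto; reflexivity.
Qed.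

Lemma conjugate_sym (R1 R2 : plane -> plane -> Prop) : conjugate R1 R2 -> conjugate R2 R1.
Proof.
  intros [h [[Hc [Hd [k [Kc [Kd [Hkh Hhk]]]]]] H]]; exists k; split.
  - split; [auto|split; [auto|]]; exists h; auto.
  - intros p q Hp Hq; rewrite (H (k p) (k q)), !Hhk; auto; reflexivity.
Qed.

Lemma unit_origin : unit (0, 0) = (0, 0).
Proof. apply sc_0. Qed.

Lemma unit_form (v : plane) : v <> (0, 0) -> v = sc (sqrt (dot v v)) (unit v).
Proof.
  intros Hv; pose proof (sqrt_dot_pos v Hv).
  unfold unit; rewrite sc_sc, Rinv_r, sc_1; auto; lra.
Qed.

Lemma unit_eq_ray (v w : plane) :
  v <> (0, 0) -> w <> (0, 0) -> unit v = unit w -> exists r, 0 < r /\ v = sc r w.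
Proof.
  intros Hv Hw E; pose proof (sqrt_dot_pos v Hv) as Hs; pose proof (sqrt_dot_pos w Hw) as Hs'.
  exists (sqrt (dot v v) * / sqrt (dot w w)); split.
  - apply Rmult_lt_0_compat; auto; now apply Rinv_0_lt_compat.
  - rewrite (unit_form v Hv) at 1; rewrite E; unfold unit; rewrite sc_sc; auto.
Qed.

(** The maps below are built from [unit], which is discontinuous at the origin; there continuity
    comes from the squared norm of the image. *)
Lemma cont_at_origin_of_dot (h : plane -> plane) (f : plane -> R) :
  h (0, 0) = (0, 0) -> continuous f (0, 0) -> f (0, 0) = 0 ->
  (forall w, poincare_disc w -> dot (h w) (h w) = f w) ->
  forall e : posreal, exists d : posreal, forall q : plane,
    ball ((0, 0) : plane) d q -> poincare_disc q -> ball (h (0, 0)) e (h q).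
Proof.
  intros Hh Hf H0 Hd e; rewrite Hh; assert (He := cond_pos e).
  assert (He2 : 0 < e * e) by nra.
  destruct (proj1 (filterlim_locally _ _) Hf (mkposreal _ He2)) as [d Hdd].
  exists d; intros q Hq Hdq; apply dot_ball; auto; rewrite Hd by auto.
  specialize (Hdd q Hq); change (Rabs (f q - f (0, 0)) < e * e) in Hdd.
  rewrite H0, Rminus_0_r in Hdd; apply Rabs_def2 in Hdd; tauto.
Qed.

Section RadialChange.

Variable f : plane -> R.
Hypothesis f_cont : forall w, poincare_disc w -> continuous f w.
Hypothesis f_origin : f (0, 0) = 0.
Hypothesis f_bounds : forall w, w <> (0, 0) -> poincare_disc w -> 0 < f w <= 1.
Hypothesis f_boundary : forall w, dot w w = 1 -> f w = 1.
Hypothesis f_incr : forall u r s, dot u u = 1 -> 0 < r -> r < s -> s <= 1 -> f (sc r u) < f (sc s u).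

Definition radial_change (w : plane) : plane := sc (sqrt (f w)) (unit w).

Lemma f_nonneg (w : plane) : poincare_disc w -> 0 <= f w.
Proof.
  intros Hw; destruct (classic (w = (0, 0))) as [->|H]; [lra|].
  destruct (f_bounds w H Hw); lra.
Qed.

Lemma radial_change_origin : radial_change (0, 0) = (0, 0).
Proof. unfold radial_change; rewrite unit_origin; apply sc_0. Qed.

Lemma dot_radial_change (w : plane) :
  poincare_disc w -> dot (radial_change w) (radial_change w) = f w.
Proof.
  intros Hw; destruct (classic (w = (0, 0))) as [->|H].
  - rewrite radial_change_origin, f_origin; unfold dot; simpl; ring.
  - unfold radial_change; rewrite dot_sc, dot_unit, sqrt_sqrt by (auto using f_nonneg); ring.
Qed.

Lemma radial_change_ray (w : plane) :
  w <> (0, 0) -> poincare_disc w -> exists r, 0 < r /\ radial_change w = sc r w.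
Proof.
  intros Hw Hd; exists (sqrt (f w) * / sqrt (dot w w)); split.
  - apply Rmult_lt_0_compat; [apply sqrt_lt_R0, f_bounds; auto|].
    apply Rinv_0_lt_compat, sqrt_dot_pos, Hw.
  - unfold radial_change, unit; now rewrite sc_sc.
Qed.

Lemma radial_change_neq0 (w : plane) :
  w <> (0, 0) -> poincare_disc w -> radial_change w <> (0, 0).
Proof.
  intros Hw Hd; destruct (radial_change_ray w Hw Hd) as [r [Hr ->]]; apply sc_neq0; auto; lra.
Qed.

Lemma disc_unit (u : plane) (r : R) : dot u u = 1 -> 0 <= r <= 1 -> poincare_disc (sc r u).
Proof. intros Hu Hr; unfold poincare_disc; rewrite dot_sc, Hu; nra. Qed.

Lemma sqrt_le_1 (w : plane) : poincare_disc w -> sqrt (dot w w) <= 1.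
Proof. intros H; rewrite <- sqrt_1; apply sqrt_le_1_alt, H. Qed.

(** The function [f] prescribes the squared norm of the image while the direction is kept. On each
    radius it increases from [0] to [1], which gives injectivity and, with the intermediate value
    theorem, surjectivity. *)
Lemma radial_change_homeomorphism : homeomorphism poincare_disc poincare_disc radial_change.
Proof.
  apply disc_homeomorphism.
  - apply within_ball; intros p Hp; destruct (classic (p = (0, 0))) as [->|Hp0].
    + apply cont_at_origin_of_dot with (f := f); auto using radial_change_origin, dot_radial_change.
    + assert (Hc : continuous radial_change p).
      { apply cont_sc; [apply cont_sqrt, f_cont, Hp|now apply cont_unit]. }
      intros e; destruct (proj1 (filterlim_locally _ _) Hc e) as [d Hd]; exists d; auto.
  - intros p Hp; unfold poincare_disc; rewrite dot_radial_change by auto.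
    destruct (classic (p = (0, 0))) as [->|H]; [lra|destruct (f_bounds p H Hp); lra].
  - intros p q Hp Hq E.
    assert (Hff : f p = f q) by (rewrite <- !dot_radial_change by auto; now rewrite E).
    destruct (classic (p = (0, 0))) as [->|Hp0]; destruct (classic (q = (0, 0))) as [->|Hq0]; auto.
    { rewrite f_origin in Hff; destruct (f_bounds q Hq0 Hq); lra. }
    { rewrite f_origin in Hff; destruct (f_bounds p Hp0 Hp); lra. }
    assert (Hu : unit p = unit q).
    { destruct (radial_change_ray p Hp0 Hp) as [r [Hr Er]].
      destruct (radial_change_ray q Hq0 Hq) as [s [Hs Es]].
      rewrite <- (unit_sc r p Hr Hp0), <- (unit_sc s q Hs Hq0); congruence. }
    rewrite (unit_form p Hp0), (unit_form q Hq0), Hu in Hff |- *; f_equal.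
    pose proof (sqrt_dot_pos p Hp0); pose proof (sqrt_dot_pos q Hq0).
    pose proof (sqrt_le_1 p Hp); pose proof (sqrt_le_1 q Hq).
    pose proof (dot_unit q Hq0) as Hdu.
    set (x := sqrt (dot p p)) in *; set (y := sqrt (dot q q)) in *; set (u := unit q) in *.
    clearbody x y u.
    destruct (Rtotal_order x y) as [h|[h|h]]; auto;
      [pose proof (f_incr u x y) as Hi|pose proof (f_incr u y x) as Hi];
      specialize (Hi Hdu ltac:(lra) h ltac:(lra)); lra.
  - intros q Hq; destruct (classic (q = (0, 0))) as [->|Hq0].
    { exists (0, 0); split; auto using radial_change_origin. }
    set (u := unit q); assert (Hu : dot u u = 1) by now apply dot_unit.
    set (g := fun r => f (sc (clamp 0 1 r) u)).
    destruct (IVT_gen g 0 1 (dot q q)) as [r [Hr Hg]].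
    + intros r; apply cont_pt; unfold g.
      assert (Hcl := clamp_bounds 0 1 r ltac:(lra)).
      apply (cont_comp_plane f (fun r => sc (clamp 0 1 r) u)).
      * apply cont_sc; [apply cont_clamp|apply continuous_const].
      * apply f_cont, disc_unit; auto.
    + unfold g; rewrite !clamp_id by lra.
      rewrite sc_1, (f_boundary u Hu).
      replace (sc 0 u) with ((0, 0) : plane) by (unfold sc; f_equal; ring).
      rewrite f_origin, Rmin_left, Rmax_right by lra; split; [apply dot_nonneg|exact Hq].
    + rewrite Rmin_left, Rmax_right in Hr by lra; unfold g in Hg; rewrite clamp_id in Hg by auto.
      exists (sc r u); split; [now apply disc_unit|].
      assert (Hr0 : r <> 0).
      { intros ->; replace (sc 0 u) with ((0, 0) : plane) in Hg by (unfold sc; f_equal; ring).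
        rewrite f_origin in Hg; pose proof (dot_pos q Hq0); lra. }
      unfold radial_change; rewrite Hg, unit_sc by (try lra; now apply unit_neq0).
      rewrite (unit_of_unit u Hu); symmetry; now apply unit_form.
Qed.

End RadialChange.

(** [T p q sigma]: the direction of [q] is that of [p] shifted by [sigma].
    The function [(1 - 2 |w|^2) / (1 - |w|^2)] decreases from [1] at the origin to
    [- oo] on the unit circle; along an orbit it is multiplied by [exp (- sigma)]. *)
Definition disc_rel (T : plane -> plane -> R -> Prop) (p q : plane) : Prop :=
  (p = (0, 0) /\ q = (0, 0)) \/
  (p <> (0, 0) /\ q <> (0, 0) /\ exists sigma, T p q sigma /\
     (1 - 2 * dot q q) * depth p = exp (- sigma) * ((1 - 2 * dot p p) * depth q)).

Section AngularChange.

Variables (P : plane -> plane) (T1 T2 : plane -> plane -> R -> Prop).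
Hypothesis P_cont : forall v, v <> (0, 0) -> continuous P v.
Hypothesis P_neq0 : forall v, v <> (0, 0) -> P v <> (0, 0).
Hypothesis P_ray : forall r v, 0 < r -> v <> (0, 0) -> exists r', 0 < r' /\ P (sc r v) = sc r' (P v).
Hypothesis P_inj : forall r v w, 0 < r -> v <> (0, 0) -> w <> (0, 0) -> P v = sc r (P w) ->
  exists r', 0 < r' /\ v = sc r' w.
Hypothesis P_surj : forall u, u <> (0, 0) -> exists r v, 0 < r /\ v <> (0, 0) /\ P v = sc r u.

(** Only the ray of [P w] is retained, so [P] must be bijective on rays but need not be homogeneous
    of degree one. *)
Definition angular_change (w : plane) : plane := sc (sqrt (dot w w)) (unit (P w)).

Lemma angular_change_origin : angular_change (0, 0) = (0, 0).
Proof.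
  unfold angular_change.
  replace (dot (0, 0) (0, 0)) with 0 by (unfold dot; simpl; ring).
  rewrite sqrt_0; unfold sc; f_equal; ring.
Qed.

Lemma dot_angular_change (w : plane) : dot (angular_change w) (angular_change w) = dot w w.
Proof.
  destruct (classic (w = (0, 0))) as [->|H]; [now rewrite angular_change_origin|].
  unfold angular_change; rewrite dot_sc, dot_unit, sqrt_sqrt by (auto using dot_nonneg); ring.
Qed.

Lemma angular_change_neq0 (w : plane) : w <> (0, 0) -> angular_change w <> (0, 0).
Proof. intros H; apply dot_pos_neq0; rewrite dot_angular_change; now apply dot_pos. Qed.

Lemma unit_angular_change (w : plane) : w <> (0, 0) -> unit (angular_change w) = unit (P w).
Proof.
  intros H; unfold angular_change; rewrite unit_sc by (auto using sqrt_dot_pos, unit_neq0).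
  apply unit_of_unit, dot_unit; auto.
Qed.

Lemma angular_change_homeomorphism : homeomorphism poincare_disc poincare_disc angular_change.
Proof.
  apply disc_homeomorphism.
  - apply within_ball; intros p Hp; destruct (classic (p = (0, 0))) as [->|Hp0].
    + apply cont_at_origin_of_dot with (f := fun w => dot w w); auto using angular_change_origin,
        dot_angular_change.
      * apply cont_dot; apply continuous_id.
      * unfold dot; simpl; ring.
    + assert (Hc : continuous angular_change p).
      { apply cont_sc; [apply cont_sqrt, cont_dot; apply continuous_id|].
        apply (cont_comp_plane unit P); auto using cont_unit. }
      intros e; destruct (proj1 (filterlim_locally _ _) Hc e) as [d Hd]; exists d; auto.
  - intros p Hp; unfold poincare_disc; rewrite dot_angular_change; exact Hp.
  - intros p q _ _ E.
    assert (Hdd : dot p p = dot q q) by (rewrite <- (dot_angular_change p), <- (dot_angular_change q); now rewrite E).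
    destruct (classic (p = (0, 0))) as [->|Hp0].
    { symmetry; apply dot_eq0; rewrite <- Hdd; unfold dot; simpl; ring. }
    assert (Hq0 : q <> (0, 0)) by (apply dot_pos_neq0; rewrite <- Hdd; now apply dot_pos).
    apply (f_equal unit) in E; rewrite !unit_angular_change in E by auto.
    destruct (unit_eq_ray (P p) (P q)) as [r [Hr Er]]; auto.
    destruct (P_inj r p q Hr Hp0 Hq0 Er) as [r' [Hr' ->]].
    rewrite dot_sc in Hdd; pose proof (dot_pos q Hq0).
    replace r' with 1; [apply sc_1|].
    apply Rmult_eq_reg_r with ((r' + 1) * dot q q); [lra|].
    apply Rmult_integral_contrapositive; split; lra.
  - intros q Hq; destruct (classic (q = (0, 0))) as [->|Hq0].
    { exists (0, 0); split; auto using angular_change_origin. }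
    destruct (P_surj q Hq0) as [r [v [Hr [Hv Hpv]]]].
    pose proof (sqrt_dot_pos q Hq0) as Hsq.
    assert (Huv := dot_unit v Hv); assert (Hun := unit_neq0 v Hv).
    exists (sc (sqrt (dot q q)) (unit v)).
    assert (Hd : dot (sc (sqrt (dot q q)) (unit v)) (sc (sqrt (dot q q)) (unit v)) = dot q q).
    { rewrite dot_sc, Huv, sqrt_sqrt by apply dot_nonneg; ring. }
    split; [unfold poincare_disc; now rewrite Hd|].
    unfold angular_change; rewrite Hd.
    transitivity (sc (sqrt (dot q q)) (unit q)); [f_equal|symmetry; now apply unit_form].
    destruct (P_ray (sqrt (dot q q) * / sqrt (dot v v)) v) as [r' [Hr' E]]; auto.
    { apply Rmult_lt_0_compat; auto; now apply Rinv_0_lt_compat, sqrt_dot_pos. }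
    unfold unit at 2; rewrite sc_sc, E, unit_sc, Hpv, unit_sc by auto; reflexivity.
Qed.

Hypothesis T2_ray : forall a b p q sigma, 0 < a -> 0 < b -> p <> (0, 0) -> q <> (0, 0) ->
  T2 p q sigma -> T2 (sc a p) (sc b q) sigma.
Hypothesis T_iff : forall p q sigma, p <> (0, 0) -> q <> (0, 0) ->
  (T1 p q sigma <-> T2 (P p) (P q) sigma).

(** Norms are preserved, so the radial equation of [disc_rel] is unaffected and only the relations
    between directions have to match. *)
Lemma angular_conjugate : conjugate (disc_rel T1) (disc_rel T2).
Proof.
  exists angular_change; split; [apply angular_change_homeomorphism|].
  assert (Hz : forall w, angular_change w = (0, 0) <-> w = (0, 0)).
  { intros w; split; [|intros ->; apply angular_change_origin].
    intros H; apply NNPP; intros N; now apply (angular_change_neq0 w). }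
  assert (Hr : forall w, w <> (0, 0) -> exists a, 0 < a /\ angular_change w = sc a (P w)).
  { intros w Hw; exists (sqrt (dot w w) * / sqrt (dot (P w) (P w))); split.
    - apply Rmult_lt_0_compat; [now apply sqrt_dot_pos|].
      apply Rinv_0_lt_compat, sqrt_dot_pos; auto.
    - unfold angular_change, unit; now rewrite sc_sc. }
  assert (HT : forall p q sigma, p <> (0, 0) -> q <> (0, 0) ->
    (T1 p q sigma <-> T2 (angular_change p) (angular_change q) sigma)).
  { intros p q sigma Hp Hq; rewrite T_iff by auto.
    destruct (Hr p Hp) as [a [Ha ->]]; destruct (Hr q Hq) as [b [Hb ->]]; split.
    - intros H; apply T2_ray; auto.
    - intros H; rewrite <- (sc_inv a (P p)), <- (sc_inv b (P q)) by lra.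
      apply T2_ray; auto using Rinv_0_lt_compat; apply sc_neq0; auto; lra. }
  intros p q _ _; unfold disc_rel, depth; rewrite !Hz, !dot_angular_change.
  split; (intros [H|[Hp [Hq [sigma [H E]]]]]; [left; exact H|right]);
    (split; [auto|split; [auto|]]); exists sigma; (split; [now apply HT|exact E]).
Qed.

End AngularChange.

(** [l] is the logarithm of a clock of [flow B]: [m] is its degree in the radius. *)
Definition log_clock (B : @matrix R 2 2) (l : plane -> R) (m : R) : Prop :=
  (forall v, v <> (0, 0) -> continuous l v) /\
  (forall r v, 0 < r -> v <> (0, 0) -> l (sc r v) = l v - m * ln r) /\
  (forall v s t, v <> (0, 0) -> s < t -> l (flow B s v) < l (flow B t v)) /\
  (forall v x, v <> (0, 0) -> exists s, l (flow B s v) = x).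

(** A relation between rays: [rho] absorbs the length, and the shift is read on the clock [l]
    instead of the time of the flow. *)
Definition shift_rel (B : @matrix R 2 2) (l : plane -> R) (p q : plane) (sigma : R) : Prop :=
  exists s rho, 0 < rho /\ q = sc rho (flow B s p) /\ l (flow B s p) = l p + sigma.

Lemma log_clock_inj (B : @matrix R 2 2) (l : plane -> R) (m : R) (v : plane) (s t : R) :
  log_clock B l m -> v <> (0, 0) -> l (flow B s v) = l (flow B t v) -> s = t.
Proof.
  intros [_ [_ [H _]]] Hv; apply (incr_inj (fun s => l (flow B s v))); intros x y; now apply H.
Qed.

Lemma shift_rel_ray (B : @matrix R 2 2) (l : plane -> R) (m a b : R) (p q : plane) (sigma : R) :
  log_clock B l m -> 0 < a -> 0 < b -> p <> (0, 0) -> q <> (0, 0) ->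
  shift_rel B l p q sigma -> shift_rel B l (sc a p) (sc b q) sigma.
Proof.
  intros [_ [Hl _]] Ha Hb Hp Hq [s [rho [Hrho [-> E]]]].
  exists s, (b * rho / a); split; [apply Rdiv_lt_0_compat; nra|]; rewrite !flow_sc, !sc_sc; split.
  - f_equal; field; lra.
  - rewrite !Hl by (auto using flow_neq0); lra.
Qed.

(** * The Poincare disc as a relation between directions and radii *)

Section DiscModel.

Variables (lambda : R) (B : @matrix R 2 2) (phi : plane -> R) (n : nat).
Hypothesis lambda_pos : 0 < lambda.
Hypothesis n_pos : (1 <= n)%nat.
Hypothesis phi_hom : homogeneous_poly (2 * n) phi.
Hypothesis phi_pos : positive_definite phi.
Hypothesis B_neg : negative_definite (quad_form B).

Variable c : R.
Hypothesis c_pos : 0 < c.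

Notation disc_field := (poincare_field lambda B phi n).
Notation K := (timefun lambda B phi n).
Notation kappa := (disc_time lambda B phi n).

Lemma timefun_log_clock : log_clock B (fun v => c * ln (K v)) (c * (2 * INR n)).
Proof.
  repeat split.
  - intros v Hv; assert (continuous K v) by now apply timefun_cont.
    cont; now apply timefun_pos.
  - intros r v Hr Hv; rewrite timefun_sc by (auto; lra).
    unfold Rdiv; rewrite ln_mult, ln_Rinv, ln_pow, INR_2n;
      auto using pow_lt, Rinv_0_lt_compat; [ring|].
    now apply timefun_pos.
  - intros v s t Hv Hst; apply Rmult_lt_compat_l; auto; apply ln_increasing.
    + now apply timefun_pos, flow_neq0.
    + now apply timefun_flow_incr.
  - intros v x Hv.
    destruct (timefun_flow_surj lambda B phi n lambda_pos n_pos phi_hom phi_pos B_neg v (exp (x / c)) Hv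
      (exp_pos _)) as [s Hs].
    exists s; rewrite Hs, ln_exp; field; lra.
Qed.

(** Solves [(1 - 2 f) / (1 - f) = odd_power c (kappa - 1) / odd_power c kappa]. *)
Definition model_radius (w : plane) : R :=
  if excluded_middle_informative (w = (0, 0)) then 0 else
  (odd_power c (kappa w) - odd_power c (kappa w - 1)) /
  (2 * odd_power c (kappa w) - odd_power c (kappa w - 1)).

Lemma model_radius_neq0 (w : plane) : w <> (0, 0) -> model_radius w =
  (odd_power c (kappa w) - odd_power c (kappa w - 1)) /
  (2 * odd_power c (kappa w) - odd_power c (kappa w - 1)).
Proof. intros H; unfold model_radius; destruct excluded_middle_informative; tauto. Qed.

Lemma model_den (x : R) : 0 <= x ->
  0 <= odd_power c x /\ odd_power c (x - 1) < odd_power c x.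
Proof.
  intros Hx; split; [|apply odd_power_incr; auto; lra].
  destruct Hx as [Hx|<-]; [now apply Rlt_le, odd_power_gt0|rewrite odd_power_0; lra].
Qed.

Lemma cont_disc_time (w : plane) : w <> (0, 0) -> continuous kappa w.
Proof.
  intros Hw; assert (continuous K w) by now apply timefun_cont.
  unfold disc_time, depth, dot; cont.
Qed.

(** For [w <> 0] this is [1 / kappa w]. *)
Lemma cont_inverse_disc_time :
  continuous (fun w => gauge lambda B phi n w / depth w ^ n) (0, 0).
Proof.
  assert (Hc : continuous (gauge lambda B phi n) (0, 0)) by now apply cont_gauge.
  unfold depth, dot; cont; simpl; apply pow_nonzero; lra.
Qed.

(** Near the origin [kappa] is unbounded. Dividing numerator and denominator by
    [odd_power c (kappa w)] leaves [(1 - y) / (2 - y)], where [y] is the odd power of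
    [1 - 1 / kappa] and extends continuously by [1]. *)
Lemma cont_model_radius (w : plane) : poincare_disc w -> continuous model_radius w.
Proof.
  intros Hw; destruct (classic (w = (0, 0))) as [->|Hw0].
  - set (y := fun w => odd_power c (1 - gauge lambda B phi n w / depth w ^ n)).
    assert (Hy0 : y (0, 0) = 1).
    { unfold y; rewrite gauge_origin; unfold Rdiv; rewrite Rmult_0_l, Rminus_0_r; apply odd_power_1. }
    assert (Hyc : continuous y (0, 0)).
    { apply (cont_real (odd_power c)); [|now apply cont_odd_power].
      assert (Hg := cont_inverse_disc_time); cont. }
    apply (continuous_ext_loc _ (fun w => (1 - y w) / (2 - y w))).
    + assert (Hloc : locally ((0, 0) : plane) (fun w => 0 < depth w)).
      { assert (Hd : continuous depth (0, 0)) by (unfold depth, dot; cont).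
        apply (Hd (fun r => 0 < r)), open_gt; unfold depth, dot; simpl; lra. }
      apply (filter_imp (fun w => 0 < depth w)); auto; intros v Hv.
      destruct (classic (v = (0, 0))) as [->|Hv0].
      * rewrite Hy0; unfold model_radius; destruct excluded_middle_informative; [|tauto].
        match goal with |- ?a = ?b => change (@eq R a b) end; unfold Rdiv; ring.
      * rewrite model_radius_neq0 by auto.
        assert (HK := timefun_pos lambda B phi n lambda_pos n_pos phi_hom phi_pos B_neg v Hv0).
        assert (Hk : 0 < kappa v) by (apply Rmult_lt_0_compat; auto; now apply pow_lt).
        assert (Hyv : y v * odd_power c (kappa v) = odd_power c (kappa v - 1)).
        { unfold y; rewrite Rmult_comm, <- odd_power_mult_pos by auto; f_equal.
          rewrite gauge_neq0 by auto; unfold disc_time; pose proof (pow_lt _ n Hv); field; lra. }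
        rewrite <- Hyv; pose proof (odd_power_gt0 c (kappa v) Hk) as Ho.
        assert (Hlt : y v < 1).
        { apply Rmult_lt_reg_r with (odd_power c (kappa v)); auto.
          rewrite Hyv, Rmult_1_l; apply odd_power_incr; auto; lra. }
        match goal with |- ?a = ?b => change (@eq R a b) end.
        field; split; [|lra].
        replace (2 * odd_power c (kappa v) - y v * odd_power c (kappa v)) with
          ((2 - y v) * odd_power c (kappa v)) by ring.
        apply Rmult_integral_contrapositive; split; lra.
    + cont; rewrite Hy0; lra.
  - assert (Hk := cont_disc_time w Hw0).
    destruct (model_den (kappa w)) as [H1 H2]; [now apply disc_time_nonneg|].
    assert (Hp1 : continuous (fun w => odd_power c (kappa w)) w).
    { apply (cont_real (odd_power c)); auto; now apply cont_odd_power. }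
    assert (Hp2 : continuous (fun w => odd_power c (kappa w - 1)) w).
    { apply (cont_real (odd_power c) (fun w => kappa w - 1)); [cont|now apply cont_odd_power]. }
    apply (continuous_ext_loc _ (fun w => (odd_power c (kappa w) - odd_power c (kappa w - 1)) /
      (2 * odd_power c (kappa w) - odd_power c (kappa w - 1)))).
    + apply (filter_imp (fun w : plane => w <> (0, 0))); [|now apply locally_neq0].
      intros v Hv; symmetry; now apply model_radius_neq0.
    + cont; lra.
Qed.

Lemma model_radius_eqs (w : plane) : w <> (0, 0) -> poincare_disc w ->
  let d := 2 * odd_power c (kappa w) - odd_power c (kappa w - 1) in
  0 < d /\ 0 < model_radius w <= 1 /\
  1 - model_radius w = odd_power c (kappa w) / d /\
  1 - 2 * model_radius w = odd_power c (kappa w - 1) / d.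
Proof.
  intros Hw Hd d; destruct (model_den (kappa w)) as [H1 H2]; [now apply disc_time_nonneg|].
  assert (Hd0 : 0 < d) by (unfold d; lra).
  rewrite model_radius_neq0 by auto; fold d; split; auto; split; [split|split].
  - apply Rdiv_lt_0_compat; lra.
  - apply Rmult_le_reg_r with d; auto; unfold Rdiv; rewrite Rmult_assoc, Rinv_l; unfold d in *; lra.
  - unfold d; field; unfold d in *; lra.
  - unfold d; field; unfold d in *; lra.
Qed.

Lemma model_radius_boundary (w : plane) : dot w w = 1 -> model_radius w = 1.
Proof.
  intros Hw; assert (Hw0 : w <> (0, 0)) by (apply dot_pos_neq0; lra).
  assert (Hk : kappa w = 0).
  { unfold disc_time, depth; rewrite Hw, Rminus_diag, pow_i by lia; ring. }
  rewrite model_radius_neq0, Hk, odd_power_0 by auto.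
  replace (0 - 1) with (- (1)) by ring; rewrite odd_power_opp, odd_power_1; field.
Qed.

Lemma disc_time_decr (u : plane) (r s : R) :
  dot u u = 1 -> 0 < r -> r < s -> s <= 1 -> kappa (sc s u) < kappa (sc r u).
Proof.
  intros Hu Hr Hrs Hs; assert (Hu0 : u <> (0, 0)) by (apply dot_pos_neq0; lra).
  assert (HK := timefun_pos lambda B phi n lambda_pos n_pos phi_hom phi_pos B_neg u Hu0).
  unfold disc_time; rewrite !timefun_sc by (auto; lra).
  unfold depth; rewrite !dot_sc, Hu, !Rmult_1_r, !pow_mult.
  replace (r ^ 2) with (r * r) by ring; replace (s ^ 2) with (s * s) by ring.
  assert (Hrr : (r * r) ^ n < (s * s) ^ n).
  { apply Rnot_le_lt; intros Hle; apply pow_le_inv in Hle; auto; nra. }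
  assert (Hrn := pow_lt (r * r) n ltac:(nra)).
  assert (Hd : (1 - s * s) ^ n <= (1 - r * r) ^ n) by (apply pow_incr; nra).
  assert (Hdr : 0 < (1 - r * r) ^ n) by (apply pow_lt; nra).
  apply Rle_lt_trans with (K u / (s * s) ^ n * (1 - r * r) ^ n).
  - apply Rmult_le_compat_l; auto; apply Rlt_le, Rdiv_lt_0_compat; lra.
  - apply Rmult_lt_compat_r; auto; unfold Rdiv; apply Rmult_lt_compat_l; auto.
    apply Rinv_lt_contravar; auto; nra.
Qed.

Lemma model_radius_incr (u : plane) (r s : R) :
  dot u u = 1 -> 0 < r -> r < s -> s <= 1 -> model_radius (sc r u) < model_radius (sc s u).
Proof.
  intros Hu Hr Hrs Hs; assert (Hu0 : u <> (0, 0)) by (apply dot_pos_neq0; lra).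
  assert (Hlt := disc_time_decr u r s Hu Hr Hrs Hs).
  assert (Hr0 : sc r u <> (0, 0)) by (apply sc_neq0; auto; lra).
  assert (Hs0 : sc s u <> (0, 0)) by (apply sc_neq0; auto; lra).
  assert (Hrd : poincare_disc (sc r u)) by (apply disc_unit; auto; lra).
  assert (Hsd : poincare_disc (sc s u)) by (apply disc_unit; auto; lra).
  rewrite !model_radius_neq0 by auto.
  destruct (model_radius_eqs _ Hr0 Hrd) as [H1 _]; destruct (model_radius_eqs _ Hs0 Hsd) as [H2 _].
  assert (Hk := disc_time_nonneg lambda B phi n lambda_pos n_pos phi_hom phi_pos B_neg _ Hs0 Hsd).
  set (x := kappa (sc r u)) in *; set (y := kappa (sc s u)) in *; clearbody x y.
  (* By multiplicativity and monotonicity this is [x * (y - 1) < y * (x - 1)], that is [y < x]. The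
     value [y = 0] needs a separate argument, as multiplicativity requires a positive factor. *)
  cut (odd_power c (y - 1) * odd_power c x < odd_power c (x - 1) * odd_power c y).
  { intros Hcut.
    apply Rmult_lt_reg_r with ((2 * odd_power c x - odd_power c (x - 1)) * (2 * odd_power c y - odd_power c (y - 1)));
      [now apply Rmult_lt_0_compat|].
    field_simplify; try lra. }
  destruct Hk as [Hk|<-].
  - rewrite (Rmult_comm (odd_power c (y - 1))), (Rmult_comm (odd_power c (x - 1))).
    rewrite <- !odd_power_mult_pos by lra; apply odd_power_incr; auto; lra.
  - rewrite odd_power_0, Rmult_0_r; replace (0 - 1) with (- (1)) by ring.
    rewrite odd_power_opp, odd_power_1; pose proof (odd_power_gt0 c x ltac:(lra)); lra.
Qed.

(** By [same_orbit_disc], the quantity [1 - 1 / kappa] is multiplied by [K p / K (flow B s p)] along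
    an orbit. Its odd power is multiplied by [exp (- sigma)], with [sigma] the increment of
    [c * ln K], and [model_radius] gives it the shape required by [disc_rel]. *)
Lemma poincare_conjugate :
  conjugate (same_orbit disc_field) (disc_rel (shift_rel B (fun v => c * ln (K v)))).
Proof.
  assert (Hbd : forall w, w <> (0, 0) -> poincare_disc w -> 0 < model_radius w <= 1).
  { intros w Hw Hd; apply (model_radius_eqs w Hw Hd). }
  assert (Hor : model_radius (0, 0) = 0).
  { unfold model_radius; destruct excluded_middle_informative; tauto. }
  exists (radial_change model_radius); split.
  { apply radial_change_homeomorphism; auto using cont_model_radius, model_radius_boundary.
    intros; now apply model_radius_incr. }
  intros p q Hdp Hdq.
  assert (Hz : forall w, poincare_disc w -> (radial_change model_radius w = (0, 0) <-> w = (0, 0))).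
  { intros w Hw; split; [|intros ->; apply radial_change_origin].
    intros H; apply NNPP; intros N; revert H; now apply radial_change_neq0. }
  unfold disc_rel, depth; rewrite !Hz, !dot_radial_change by auto.
  destruct (classic (p = (0, 0))) as [->|Hp].
  { rewrite same_orbit_origin by auto; split; [auto|].
    intros [[_ H]|[H _]]; tauto. }
  rewrite same_orbit_disc by auto.
  assert (Hiff : forall s A, 0 < A -> q = sc A (flow B s p) -> q <> (0, 0) ->
    (K (flow B s p) * (kappa q - 1) * kappa p = K p * (kappa p - 1) * kappa q <->
     (1 - 2 * model_radius q) * (1 - model_radius p) =
     exp (- (c * ln (K (flow B s p)) - c * ln (K p))) *
       ((1 - 2 * model_radius p) * (1 - model_radius q)))).
  { intros s A HA Hq Hq0.
    destruct (model_radius_eqs p Hp Hdp) as [Hdp0 [_ [-> ->]]].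
    destruct (model_radius_eqs q Hq0 Hdq) as [Hdq0 [_ [-> ->]]].
    assert (HKp := timefun_pos lambda B phi n lambda_pos n_pos phi_hom phi_pos B_neg p Hp).
    assert (HKs := timefun_pos lambda B phi n lambda_pos n_pos phi_hom phi_pos B_neg _ (flow_neq0 B s p Hp)).
    assert (Hkp := disc_time_nonneg lambda B phi n lambda_pos n_pos phi_hom phi_pos B_neg p Hp Hdp).
    assert (Hkq := disc_time_nonneg lambda B phi n lambda_pos n_pos phi_hom phi_pos B_neg q Hq0 Hdq).
    replace (exp (- (c * ln (K (flow B s p)) - c * ln (K p)))) with
      (odd_power c (K p) / odd_power c (K (flow B s p))).
    2: { rewrite !odd_power_pos by auto; unfold Rdiv; rewrite <- exp_Ropp, <- exp_plus; f_equal; ring. }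
    assert (Hop := odd_power_gt0 c _ HKp); assert (Hos := odd_power_gt0 c _ HKs).
    assert (Hmul : forall x y, 0 <= x -> odd_power c (x * y) = odd_power c x * odd_power c y).
    { intros x y [Hx|<-]; [now apply odd_power_mult_pos|].
      rewrite Rmult_0_l, odd_power_0; ring. }
    set (dp := 2 * odd_power c (kappa p) - odd_power c (kappa p - 1)) in *.
    set (dq := 2 * odd_power c (kappa q) - odd_power c (kappa q - 1)) in *.
    clearbody dp dq.
    transitivity (odd_power c (K (flow B s p)) * odd_power c (kappa q - 1) * odd_power c (kappa p) =
      odd_power c (K p) * odd_power c (kappa p - 1) * odd_power c (kappa q)).
    - rewrite <- (odd_power_mult_pos c (K (flow B s p))), <- (odd_power_mult_pos c (K p)) by auto.
      rewrite (Rmult_comm _ (odd_power c (kappa p))), (Rmult_comm _ (odd_power c (kappa q))).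
      rewrite <- !Hmul by auto.
      rewrite (Rmult_comm _ (kappa p)), (Rmult_comm _ (kappa q)).
      split; [intros ->; auto|apply odd_power_inj; auto].
    - set (a := odd_power c (K (flow B s p))) in *; set (b := odd_power c (K p)) in *.
      set (x := odd_power c (kappa p)); set (x' := odd_power c (kappa p - 1)).
      set (y := odd_power c (kappa q)); set (y' := odd_power c (kappa q - 1)).
      clearbody a b x x' y y'.
      assert (Hf : a * dp * dq <> 0) by (repeat apply Rmult_integral_contrapositive_currified; lra).
      split; intros E.
      + apply Rmult_eq_reg_l with (a * dp * dq); auto.
        transitivity (a * y' * x); [field; lra|rewrite E; field; lra].
      + transitivity (a * dp * dq * (y' / dq * (x / dp))); [field; lra|rewrite E; field; lra]. }
  split.
  - intros [s [A [HA [Hq E]]]].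
    assert (Hq0 : q <> (0, 0)) by (rewrite Hq; apply sc_neq0; [lra|now apply flow_neq0]).
    right; split; [auto|split; [auto|]].
    exists (c * ln (K (flow B s p)) - c * ln (K p)); split.
    + destruct (radial_change_ray model_radius Hbd p Hp Hdp) as [a [Ha ->]].
      destruct (radial_change_ray model_radius Hbd q Hq0 Hdq) as [b [Hb ->]].
      apply shift_rel_ray with (m := c * (2 * INR n)); auto using timefun_log_clock.
      exists s, A; split; [auto|split; [auto|ring]].
    + now apply (Hiff s A).
  - intros [[H _]|[_ [Hq0 [sigma [HT E]]]]]; [tauto|].
    assert (HT' : shift_rel B (fun v => c * ln (K v)) p q sigma).
    { destruct (radial_change_ray model_radius Hbd p Hp Hdp) as [a [Ha Ea]].
      destruct (radial_change_ray model_radius Hbd q Hq0 Hdq) as [b [Hb Eb]].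
      rewrite Ea, Eb in HT.
      rewrite <- (sc_inv a p), <- (sc_inv b q) by lra.
      apply shift_rel_ray with (m := c * (2 * INR n)); auto using timefun_log_clock, Rinv_0_lt_compat;
        apply sc_neq0; auto; lra. }
    destruct HT' as [s [A [HA [Hq Es]]]].
    exists s, A; split; [auto|split; [auto|]].
    apply (Hiff s A); auto; rewrite E; f_equal; f_equal; lra.
Qed.

End DiscModel.

(** * Normal forms *)

Section ClockChange.

Variables (B : @matrix R 2 2) (l1 l2 : plane -> R) (m : R).
Hypothesis clock1 : log_clock B l1 m.
Hypothesis clock2 : log_clock B l2 m.

(** The time for which [v] must be moved so that the second clock shows what the first one showed at
    [v]. *)
Definition matching_time (v : plane) : R :=
  epsilon (inhabits 0) (fun s => l2 (flow B s v) = l1 v).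

Lemma matching_time_spec (v : plane) :
  v <> (0, 0) -> l2 (flow B (matching_time v) v) = l1 v.
Proof.
  intros Hv; apply (epsilon_spec (inhabits 0) (fun s => l2 (flow B s v) = l1 v)).
  now apply (proj2 (proj2 (proj2 clock2))).
Qed.

Lemma matching_time_unique (v : plane) (s : R) :
  v <> (0, 0) -> l2 (flow B s v) = l1 v -> matching_time v = s.
Proof.
  intros Hv H; apply (log_clock_inj B l2 m v); auto; rewrite H; now apply matching_time_spec.
Qed.

(** The second clock increases along the flow, so strict inequalities at the fixed times [t - e] and
    [t + e] persist for nearby points and enclose their matching times. *)
Lemma cont_matching_time (v : plane) : v <> (0, 0) -> continuous matching_time v.
Proof.
  intros Hv; destruct clock1 as [C1 _]; destruct clock2 as [C2 [_ [I2 _]]].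
  apply filterlim_locally; intros e; assert (He := cond_pos e).
  set (t := matching_time v).
  assert (Hl : l2 (flow B (t - e) v) - l1 v < 0).
  { rewrite <- (matching_time_spec v Hv); fold t.
    pose proof (I2 v (t - e) t Hv ltac:(lra)); lra. }
  assert (Hr : 0 < l2 (flow B (t + e) v) - l1 v).
  { rewrite <- (matching_time_spec v Hv); fold t.
    pose proof (I2 v t (t + e) Hv ltac:(lra)); lra. }
  assert (Hc : forall s, continuous (fun v => l2 (flow B s v) - l1 v) v).
  { intros s; apply cont_sub; auto.
    apply (cont_comp_plane l2 (fun v => flow B s v)); [|apply C2, flow_neq0, Hv].
    apply (cont_flow B (fun _ => s) (fun v => v)); [apply cont_const|apply continuous_id]. }
  assert (H1 := Hc (t - e) (fun r => r < 0) (open_lt 0 _ Hl)).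
  assert (H2 := Hc (t + e) (fun r => 0 < r) (open_gt 0 _ Hr)).
  apply (filter_imp (fun w : plane => (l2 (flow B (t - e) w) - l1 w < 0 /\
    0 < l2 (flow B (t + e) w) - l1 w) /\ w <> (0, 0))).
  2: { apply filter_and; [apply filter_and; [exact H1|exact H2]|now apply locally_neq0]. }
  intros w [[Ha Hb] Hw].
  rewrite <- (matching_time_spec w Hw) in Ha, Hb.
  assert (Hinc : forall x y, l2 (flow B x w) < l2 (flow B y w) -> x < y).
  { apply incr_lt_inv; intros x y; now apply I2. }
  change (Rabs (matching_time w - t) < e).
  assert (t - e < matching_time w) by (apply Hinc; lra).
  assert (matching_time w < t + e) by (apply Hinc; lra).
  apply Rabs_def1; lra.
Qed.

Definition clock_change (v : plane) : plane := flow B (matching_time v) v.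

Lemma clock_change_neq0 (v : plane) : v <> (0, 0) -> clock_change v <> (0, 0).
Proof. apply flow_neq0. Qed.

Lemma clock_change_spec (v : plane) : v <> (0, 0) -> l2 (clock_change v) = l1 v.
Proof. apply matching_time_spec. Qed.

Lemma clock_change_eq (s : R) (v : plane) :
  v <> (0, 0) -> l2 (flow B s v) = l1 v -> clock_change v = flow B s v.
Proof. intros Hv H; unfold clock_change; now rewrite (matching_time_unique v s). Qed.

Lemma clock_change_sc (r : R) (v : plane) :
  0 < r -> v <> (0, 0) -> clock_change (sc r v) = sc r (clock_change v).
Proof.
  intros Hr Hv; unfold clock_change at 2; rewrite <- flow_sc; apply clock_change_eq.
  - apply sc_neq0; auto; lra.
  - destruct clock1 as [_ [S1 _]]; destruct clock2 as [_ [S2 _]].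
    rewrite flow_sc, S1, S2 by (auto using flow_neq0); fold (clock_change v).
    now rewrite clock_change_spec.
Qed.

(** With equal degrees, [matching_time] depends on the direction only, so
    [clock_change] commutes with scaling and with the flow. *)
Lemma log_clock_conjugate :
  conjugate (disc_rel (shift_rel B l1)) (disc_rel (shift_rel B l2)).
Proof.
  destruct clock1 as [C1 [S1 [I1 O1]]]; destruct clock2 as [C2 [S2 [I2 O2]]].
  assert (Hback : forall v, v = flow B (- matching_time v) (clock_change v)).
  { intros v; unfold clock_change; now rewrite flow_opp. }
  apply (angular_conjugate clock_change).
  - intros v Hv; apply (cont_flow B matching_time (fun v => v)); [now apply cont_matching_time|].
    apply continuous_id.
  - apply clock_change_neq0.
  - intros r v Hr Hv; exists r; split; auto; now apply clock_change_sc.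
  - intros r v w Hr Hv Hw E; exists r; split; auto.
    assert (E1 : v = sc r (flow B (- matching_time v + matching_time w) w)).
    { rewrite (Hback v) at 1; rewrite E, flow_sc; unfold clock_change; now rewrite flow_add. }
    assert (E2 : l1 v = l1 w - m * ln r).
    { rewrite <- (clock_change_spec v), E, S2, clock_change_spec by (auto using clock_change_neq0); auto. }
    rewrite E1 in E2 at 1; rewrite S1 in E2 by (auto using flow_neq0).
    rewrite E1; f_equal; transitivity (flow B 0 w); [f_equal|apply flow_0].
    apply (log_clock_inj B l1 m w); auto; rewrite flow_0; lra.
  - intros u Hu; destruct (O1 u (l2 u) Hu) as [s Hs].
    exists 1, (flow B s u); split; [lra|split; [now apply flow_neq0|]]; rewrite sc_1.
    rewrite (clock_change_eq (- s) (flow B s u)); [apply flow_opp|now apply flow_neq0|].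
    now rewrite flow_opp.
  - intros a b p q sigma; now apply (shift_rel_ray B l2 m).
  - intros p q sigma Hp Hq; split.
    + intros [s [rho [Hrho [E Es]]]].
      assert (E1 : clock_change q = sc rho (flow B (matching_time q + s - matching_time p) (clock_change p))).
      { unfold clock_change; rewrite <- flow_add.
        replace (matching_time q + s - matching_time p + matching_time p) with (matching_time q + s) by ring.
        rewrite flow_add, <- flow_sc; now rewrite <- E. }
      exists (matching_time q + s - matching_time p), rho; split; [auto|split; [auto|]].
      (* Both clocks have degree [m], so the terms [m * ln rho] cancel and the shift [sigma] is the
         same for both. *)
      assert (E2 := clock_change_spec q Hq).
      rewrite E1, S2 in E2 by (auto using flow_neq0, clock_change_neq0).
      assert (E3 : l1 q = l1 (flow B s p) - m * ln rho) by (rewrite E; auto using flow_neq0).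
      rewrite clock_change_spec by auto; lra.
    + intros [s [rho [Hrho [E Es]]]].
      assert (E1 : q = sc rho (flow B (- matching_time q + s + matching_time p) p)).
      { rewrite (Hback q) at 1; rewrite E, flow_sc, !flow_add; reflexivity. }
      exists (- matching_time q + s + matching_time p), rho; split; [auto|split; [auto|]].
      assert (E2 : l1 q = l1 (flow B (- matching_time q + s + matching_time p) p) - m * ln rho).
      { rewrite E1 at 1; auto using flow_neq0. }
      assert (E3 := clock_change_spec q Hq).
      rewrite E, S2, Es, clock_change_spec in E3 by (auto using flow_neq0, clock_change_neq0); lra.
Qed.

End ClockChange.

(** * Models without parameters *)

Definition rotate (t : R) (v : plane) : plane :=
  (cos t * fst v - sin t * snd v, sin t * fst v + cos t * snd v).

Definition shear (t : R) (v : plane) : plane := (fst v, snd v + t * fst v).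

Definition stretch (t : R) (v : plane) : plane := (exp (- t) * fst v, snd v).

(** Normal forms free of parameters. In the nilpotent case the shift is measured by
    the clock [2 t - ln |shear t p|^2] of the linear flow [exp (- t) shear t]. *)
Definition model_rel (T : portrait_type) (p q : plane) (sigma : R) : Prop :=
  match T with
  | LimitCycle => exists rho, 0 < rho /\ q = sc rho (rotate sigma p)
  | FourEquilibria => exists rho, 0 < rho /\ q = sc rho (stretch sigma p)
  | TwoSaddleNodes => exists t rho, 0 < rho /\ q = sc rho (shear t p) /\
      2 * t - ln (dot (shear t p) (shear t p)) = - ln (dot p p) + sigma
  | CircleOfEquilibria => exists rho, 0 < rho /\ q = sc rho p
  end.

Lemma shear_neq0 (t : R) (v : plane) : v <> (0, 0) -> shear t v <> (0, 0).
Proof.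
  intros Hv E; apply Hv; unfold shear in E; injection E; intros H1 H2.
  rewrite H2, Rmult_0_r, Rplus_0_r in H1; now apply plane_eq.
Qed.

Lemma model_rel_ray (T : portrait_type) (a b : R) (p q : plane) (sigma : R) :
  0 < a -> 0 < b -> p <> (0, 0) -> q <> (0, 0) ->
  model_rel T p q sigma -> model_rel T (sc a p) (sc b q) sigma.
Proof.
  intros Ha Hb Hp Hq; destruct T; simpl.
  - intros [rho [Hr ->]]; exists (b * rho / a); split; [apply Rdiv_lt_0_compat; nra|].
    apply plane_eq; unfold sc, rotate; simpl; field; lra.
  - intros [rho [Hr ->]]; exists (b * rho / a); split; [apply Rdiv_lt_0_compat; nra|].
    apply plane_eq; unfold sc, stretch; simpl; field; lra.
  - intros [t [rho [Hr [-> E]]]]; exists t, (b * rho / a); split; [apply Rdiv_lt_0_compat; nra|split].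
    + apply plane_eq; unfold sc, shear; simpl; field; lra.
    + replace (shear t (sc a p)) with (sc a (shear t p))
        by (apply plane_eq; unfold sc, shear; simpl; ring).
      rewrite !dot_sc, !ln_mult by (auto using dot_pos, shear_neq0; nra); lra.
  - intros [rho [Hr ->]]; exists (b * rho / a); split; [apply Rdiv_lt_0_compat; nra|].
    apply plane_eq; unfold sc; simpl; field; lra.
Qed.

Lemma linear_angular_conjugate (P : plane -> plane) (T1 T2 : plane -> plane -> R -> Prop) :
  (forall v, continuous P v) -> (forall r v, P (sc r v) = sc r (P v)) ->
  (forall v w, P v = P w -> v = w) -> (forall u, exists v, P v = u) ->
  (forall a b p q sigma, 0 < a -> 0 < b -> p <> (0, 0) -> q <> (0, 0) ->
     T2 p q sigma -> T2 (sc a p) (sc b q) sigma) ->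
  (forall p q sigma, p <> (0, 0) -> q <> (0, 0) -> (T1 p q sigma <-> T2 (P p) (P q) sigma)) ->
  conjugate (disc_rel T1) (disc_rel T2).
Proof.
  intros Hc Hs Hi Hsu HT HTT.
  assert (H0 : P (0, 0) = (0, 0)).
  { rewrite <- (sc_0 0) at 1; rewrite Hs; unfold sc; f_equal; ring. }
  apply (angular_conjugate P); auto.
  - intros v Hv E; apply Hv, Hi; congruence.
  - intros r v Hr _; exists r; auto.
  - intros r v w Hr _ _ E; exists r; split; auto; apply Hi; now rewrite Hs.
  - intros u Hu; destruct (Hsu u) as [v Hv]; exists 1, v; split; [lra|].
    rewrite sc_1; split; auto; intros ->; congruence.
Qed.

(** With [a = fst p] and [b = snd p + t * fst p] the derivative of the clock is
    [2 - 2 a b / (a^2 + b^2)], which is at least [1]. *)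
Lemma shear_clock_incr (p : plane) (s t : R) : p <> (0, 0) -> s < t ->
  t - s <= (2 * t - ln (dot (shear t p) (shear t p))) - (2 * s - ln (dot (shear s p) (shear s p))).
Proof.
  intros Hp Hst.
  set (g := fun t => 2 * t - ln (dot (shear t p) (shear t p))).
  set (dg := fun t => 2 - 2 * fst p * (snd p + t * fst p) / dot (shear t p) (shear t p)).
  assert (Hpos : forall t, 0 < dot (shear t p) (shear t p)) by (intros; now apply dot_pos, shear_neq0).
  assert (Hg : forall t, is_derive g t (dg t)).
  { intros u; unfold g; eapply is_derive_val.
    - apply derive_sub; [apply derive_lin|].
      apply derive_ln; [|apply Hpos].
      unfold dot, shear; simpl; apply derive_add; [apply derive_const|].
      assert (Hl : is_derive (fun t => snd p + t * fst p) u (0 + (1 * fst p + u * 0))).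
      { apply derive_add; [apply derive_const|].
        apply (derive_mul (fun t => t) (fun _ => fst p)); [apply derive_id|apply derive_const]. }
      apply derive_mul; exact Hl.
    - unfold dg; specialize (Hpos u); unfold dot, shear in *; simpl in *; field; lra. }
  destruct (MVT_gen g s t dg) as [u [_ Hu]].
  - intros; apply Hg.
  - intros; apply cont_pt, (derive_cont _ _ _ (Hg _)).
  - change (t - s <= g t - g s); rewrite Hu.
    assert (1 <= dg u); [|nra].
    unfold dg; specialize (Hpos u).
    assert (2 * fst p * (snd p + u * fst p) / dot (shear u p) (shear u p) <= 1); [|lra].
    apply Rmult_le_reg_r with (dot (shear u p) (shear u p)); auto.
    unfold Rdiv; rewrite Rmult_assoc, Rinv_l by lra.
    pose proof (Rle_0_sqr (fst p - (snd p + u * fst p))) as Hsq; unfold Rsqr in Hsq.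
    unfold dot, shear; simpl; lra.
Qed.

Lemma shear_clock_surj (p : plane) (x : R) : p <> (0, 0) ->
  exists t, 2 * t - ln (dot (shear t p) (shear t p)) = x.
Proof.
  intros Hp; set (g := fun t => 2 * t - ln (dot (shear t p) (shear t p))).
  assert (Hc : forall t, continuity_pt g t).
  { intros t; apply cont_pt; unfold g, dot, shear; simpl; cont.
    exact (dot_pos _ (shear_neq0 t p Hp)). }
  set (M := Rabs (x - g 0) + 1); pose proof (Rle_abs (x - g 0)) as H1.
  pose proof (Rle_abs (- (x - g 0))) as H2; rewrite Rabs_Ropp in H2.
  assert (HM : 0 < M) by (unfold M; pose proof (Rabs_pos (x - g 0)); lra).
  assert (Ha : M - 0 <= g M - g 0) by (apply shear_clock_incr; auto; lra).
  assert (Hb : 0 - - M <= g 0 - g (- M)) by (apply shear_clock_incr; auto; lra).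
  destruct (IVT_gen g (- M) M x) as [t [_ Ht]]; auto.
  - unfold M in *; rewrite Rmin_left, Rmax_right; lra.
  - now exists t.
Qed.

Section NormalForms.

Variables (lambda : R) (B : @matrix R 2 2) (phi : plane -> R) (n : nat).
Hypothesis lambda_pos : 0 < lambda.
Hypothesis n_pos : (1 <= n)%nat.
Hypothesis phi_hom : homogeneous_poly (2 * n) phi.
Hypothesis phi_pos : positive_definite phi.
Hypothesis B_neg : negative_definite (quad_form B).

Notation disc_field := (poincare_field lambda B phi n).
Notation K := (timefun lambda B phi n).

(** The exponent [m / (2 n)] gives [c * ln K] the degree of [l], so that one clock can replace the
    other; this is where [n] disappears. *)
Lemma poincare_log_clock (l : plane -> R) (m : R) :
  0 < m -> log_clock B l m -> conjugate (same_orbit disc_field) (disc_rel (shift_rel B l)).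
Proof.
  intros Hm Hl; pose proof (INR_n_pos n n_pos) as Hn.
  assert (Hc : 0 < m / (2 * INR n)) by (apply Rdiv_lt_0_compat; lra).
  apply (conjugate_trans _ _ _ (poincare_conjugate lambda B phi n lambda_pos n_pos phi_hom phi_pos B_neg
    (m / (2 * INR n)) Hc)).
  apply (log_clock_conjugate B _ l m); auto.
  assert (H := timefun_log_clock lambda B phi n lambda_pos n_pos phi_hom phi_pos B_neg _ Hc).
  replace (m / (2 * INR n) * (2 * INR n)) with m in H by (field; lra); exact H.
Qed.

(** In the norm of [(X, omega Y)] the flow is a rotation with scaling. The degree [m] is chosen so
    that the logarithmic clock advances by the angle [w * s], which makes the shift the angle
    itself. *)
Lemma limit_cycle_model : discr B < 0 ->
  conjugate (same_orbit disc_field) (disc_rel (model_rel LimitCycle)).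
Proof.
  intros Hd; destruct (discr_regular B) as [e He]; [lra|].
  pose proof (half_trace_neg B B_neg) as Hmu; pose proof (omega_pos B Hd) as Hw.
  set (mu := half_trace B) in *; set (w := omega B) in *.
  set (P := fun v => (frame_x B e v, w * frame_y B e v) : plane).
  assert (HPs : forall r v, P (sc r v) = sc r (P v)).
  { intros r v; unfold P; rewrite frame_x_sc, frame_y_sc by auto; unfold sc; simpl; f_equal; ring. }
  assert (HPi : forall v w, P v = P w -> v = w).
  { intros u v E; unfold P in E; injection E; intros E1 E2.
    apply (frame_inj B e He); auto; apply Rmult_eq_reg_l with w; auto; lra. }
  assert (HPc : forall v, continuous P v).
  { intros v; apply cont_pair; [apply (cont_frame_x B e He (fun v => v)), continuous_id|].
    apply cont_mul; [apply cont_const|apply (cont_frame_y B e He (fun v => v)), continuous_id]. }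
  assert (HP0 : forall v, v <> (0, 0) -> P v <> (0, 0)).
  { intros v Hv E; apply Hv, HPi; rewrite E; unfold P.
    rewrite frame_x_origin, frame_y_origin by auto; f_equal; ring. }
  assert (HPf : forall s v, P (flow B s v) = sc (exp (mu * s)) (rotate (w * s) (P v))).
  { intros s v; destruct (elliptic_flow B e He Hd s v) as [H1 H2].
    apply plane_eq; unfold P, sc, rotate; simpl; [exact H1|exact H2]. }
  assert (Hrot : forall t v, dot (rotate t v) (rotate t v) = dot v v).
  { intros t v; transitivity ((cos t * cos t + sin t * sin t) * dot v v).
    - unfold dot, rotate; simpl; ring.
    - rewrite cos_sin_sqr; ring. }
  set (m := w / - mu); assert (Hm : 0 < m) by (apply Rdiv_lt_0_compat; lra).
  set (l := fun v => - (m / 2) * ln (dot (P v) (P v))).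
  assert (Hlf : forall s v, v <> (0, 0) -> l (flow B s v) = l v + w * s).
  { intros s v Hv; unfold l; rewrite HPf, dot_sc, Hrot, <- exp_plus, ln_mult, ln_exp;
      auto using exp_pos, dot_pos; unfold m; field; lra. }
  assert (Hl : log_clock B l m).
  { repeat split.
    - intros v Hv; unfold l; apply cont_mul; [apply cont_const|].
      apply cont_ln; [apply cont_dot; auto|apply dot_pos; auto].
    - intros r v Hr Hv; unfold l; rewrite HPs, dot_sc, !ln_mult by (auto using dot_pos; nra); field.
    - intros v s t Hv Hst; rewrite !Hlf by auto; nra.
    - intros v x Hv; exists ((x - l v) / w); rewrite Hlf by auto; field; lra. }
  apply (conjugate_trans _ _ _ (poincare_log_clock l m Hm Hl)).
  apply (linear_angular_conjugate P); auto.
  - intros [x y]; destruct (frame_x_surj B e He x (y / w)) as [v [H1 H2]].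
    exists v; unfold P; rewrite H1, H2; f_equal; field; lra.
  - intros a b p q sigma; apply model_rel_ray.
  - intros p q sigma Hp Hq; simpl; split.
    + intros [s [rho [Hrho [-> E]]]]; rewrite Hlf in E by auto.
      exists (rho * exp (mu * s)); split; [apply Rmult_lt_0_compat; auto using exp_pos|].
      rewrite HPs, HPf, sc_sc; do 2 f_equal; lra.
    + intros [rho [Hrho E]]; exists (sigma / w), (rho / exp (mu * (sigma / w))).
      pose proof (exp_pos (mu * (sigma / w))).
      split; [now apply Rdiv_lt_0_compat|split].
      * apply HPi; rewrite HPs, HPf, sc_sc, E.
        replace (w * (sigma / w)) with sigma by (field; lra); f_equal; field; lra.
      * rewrite Hlf by auto; field; lra.
Qed.

(** The factor [- mu] in the second coordinate turns the flow into [exp (- t)] times [shear t] with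
    [t = - mu * s], which removes the eigenvalue. *)
Lemma saddle_node_model (e : plane) : discr B = 0 -> angular_form B e <> 0 ->
  conjugate (same_orbit disc_field) (disc_rel (model_rel TwoSaddleNodes)).
Proof.
  intros Hd He; pose proof (half_trace_neg B B_neg) as Hmu.
  set (mu := half_trace B) in *.
  set (P := fun v => (frame_x B e v, - mu * frame_y B e v) : plane).
  assert (HPs : forall r v, P (sc r v) = sc r (P v)).
  { intros r v; unfold P; rewrite frame_x_sc, frame_y_sc by auto; unfold sc; simpl; f_equal; ring. }
  assert (HPi : forall v w, P v = P w -> v = w).
  { intros u v E; unfold P in E; injection E; intros E1 E2.
    apply (frame_inj B e He); auto; nra. }
  assert (HPc : forall v, continuous P v).
  { intros v; apply cont_pair; [apply (cont_frame_x B e He (fun v => v)), continuous_id|].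
    apply cont_mul; [apply cont_const|apply (cont_frame_y B e He (fun v => v)), continuous_id]. }
  assert (HP0 : forall v, v <> (0, 0) -> P v <> (0, 0)).
  { intros v Hv E; apply Hv, HPi; rewrite E; unfold P.
    rewrite frame_x_origin, frame_y_origin by auto; f_equal; ring. }
  assert (HPf : forall s v, P (flow B s v) = sc (exp (mu * s)) (shear (- mu * s) (P v))).
  { intros s v; destruct (frame_flow B e He s v) as [H1 H2].
    rewrite Hd, gcos_zero, gsin_zero in H1, H2; fold mu in H1, H2.
    unfold P; rewrite H1, H2; apply plane_eq; unfold sc, shear; simpl; ring. }
  set (l := fun v => - ln (dot (P v) (P v))).
  assert (Hlf : forall s v, v <> (0, 0) -> l (flow B s v) =
    2 * (- mu * s) - ln (dot (shear (- mu * s) (P v)) (shear (- mu * s) (P v)))).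
  { intros s v Hv; unfold l; rewrite HPf, dot_sc, <- exp_plus, ln_mult, ln_exp;
      auto using exp_pos, dot_pos, shear_neq0; ring. }
  assert (Hl : log_clock B l 2).
  { repeat split.
    - intros v Hv; unfold l; apply cont_opp.
      apply cont_ln; [apply cont_dot; auto|apply dot_pos; auto].
    - intros r v Hr Hv; unfold l; rewrite HPs, dot_sc, !ln_mult by (auto using dot_pos; nra); ring.
    - intros v s t Hv Hst; rewrite !Hlf by auto.
      pose proof (shear_clock_incr (P v) (- mu * s) (- mu * t) (HP0 v Hv) ltac:(nra)); nra.
    - intros v x Hv; destruct (shear_clock_surj (P v) x (HP0 v Hv)) as [t Ht].
      exists (t / - mu); rewrite Hlf by auto.
      replace (- mu * (t / - mu)) with t by (field; lra); exact Ht. }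
  apply (conjugate_trans _ _ _ (poincare_log_clock l 2 ltac:(lra) Hl)).
  apply (linear_angular_conjugate P); auto.
  - intros [x y]; destruct (frame_x_surj B e He x (y / - mu)) as [v [H1 H2]].
    exists v; unfold P; rewrite H1, H2; f_equal; field; lra.
  - intros a b p q sigma; apply model_rel_ray.
  - intros p q sigma Hp Hq; simpl; split.
    + intros [s [rho [Hrho [-> E]]]]; rewrite Hlf in E by auto.
      exists (- mu * s), (rho * exp (mu * s)); split; [apply Rmult_lt_0_compat; auto using exp_pos|].
      rewrite HPs, HPf, sc_sc; split; auto.
    + intros [t [rho [Hrho [E Es]]]]; exists (t / - mu), (rho / exp (mu * (t / - mu))).
      pose proof (exp_pos (mu * (t / - mu))).
      assert (Et : - mu * (t / - mu) = t) by (field; lra).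
      split; [now apply Rdiv_lt_0_compat|split].
      * apply HPi; rewrite HPs, HPf, sc_sc, E, Et; f_equal; field; lra.
      * rewrite Hlf, Et by auto; exact Es.
Qed.

(** The flow only scales, so directions never move, while the clock can realize any shift; every
    [sigma] is therefore admissible. *)
Lemma circle_of_equilibria_model : (forall v, angular_form B v = 0) ->
  conjugate (same_orbit disc_field) (disc_rel (model_rel CircleOfEquilibria)).
Proof.
  intros Hz; pose proof (INR_n_pos n n_pos) as Hn.
  set (l := fun v => 1 * ln (K v)).
  assert (Hl : log_clock B l (1 * (2 * INR n))) by (apply timefun_log_clock; auto; lra).
  apply (conjugate_trans _ _ _ (poincare_log_clock l (1 * (2 * INR n)) ltac:(lra) Hl)).
  assert (Hf : forall s v, v <> (0, 0) -> exists r, 0 < r /\ flow B s v = sc r v).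
  { intros s v Hv; destruct (angular_form_line B v Hv (Hz v)) as [nu Hnu].
    exists (exp (nu * s)); split; [apply exp_pos|now apply flow_eigenvector]. }
  apply (linear_angular_conjugate (fun v => v)); auto using continuous_id.
  - intros u; now exists u.
  - intros a b p q sigma; apply model_rel_ray.
  - intros p q sigma Hp Hq; simpl; split.
    + intros [s [rho [Hrho [-> E]]]]; destruct (Hf s p Hp) as [r [Hr ->]].
      exists (rho * r); rewrite sc_sc; split; auto; now apply Rmult_lt_0_compat.
    + intros [rho [Hrho ->]].
      destruct (proj2 (proj2 (proj2 Hl)) p (l p + sigma) Hp) as [s Hs].
      destruct (Hf s p Hp) as [r [Hr E]].
      exists s, (rho / r); split; [now apply Rdiv_lt_0_compat|split; auto].
      rewrite E, sc_sc; f_equal; field; lra.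
Qed.

(** The quotient [d] of the eigenvalues has to be removed, which a power of [Y] achieves: along the
    flow it is multiplied by [exp (m1 * s)], like [X]. The clock of degree [d - 1] makes
    [X * exp (- l)] homogeneous of degree [d] as well, and its shift supplies the factor of
    [stretch]. Here [d > 1] because both eigenvalues are negative and [m1] is the smaller one. *)
Lemma four_equilibria_model : 0 < discr B ->
  conjugate (same_orbit disc_field) (disc_rel (model_rel FourEquilibria)).
Proof.
  intros Hd; destruct (discr_regular B) as [e He]; [lra|].
  pose proof (slow_rate_neg B B_neg Hd) as Hm2; pose proof (omega_pos' B Hd) as Hw.
  pose proof (INR_n_pos n n_pos) as Hn.
  set (m1 := half_trace B - omega B); set (m2 := half_trace B + omega B) in *.
  set (d := m1 / m2).
  assert (Hd1 : 0 < d - 1).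
  { unfold d; replace (m1 / m2 - 1) with ((2 * omega B) / (- m2)) by (unfold m1, m2 in *; field; lra).
    apply Rdiv_lt_0_compat; lra. }
  assert (Hd0 : 0 < d) by lra.
  assert (Hc : 0 < (d - 1) / (2 * INR n)) by (apply Rdiv_lt_0_compat; lra).
  set (l := fun v => (d - 1) / (2 * INR n) * ln (K v)).
  assert (Hl : log_clock B l (d - 1)).
  { replace (d - 1) with ((d - 1) / (2 * INR n) * (2 * INR n)) by (field; lra).
    now apply timefun_log_clock. }
  apply (conjugate_trans _ _ _ (poincare_log_clock l _ Hd1 Hl)).
  assert (Hl' := Hl); destruct Hl as [Cl [Sl [Il Ol]]].
  set (X := fast B e); set (Y := slow B e).
  set (P := fun v => (X v * exp (- l v), odd_power d (Y v)) : plane).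
  assert (HXs : forall r v, X (sc r v) = r * X v) by (intros; now apply fast_sc).
  assert (HYs : forall r v, Y (sc r v) = r * Y v) by (intros; now apply slow_sc).
  assert (HXY : forall v, v <> (0, 0) -> X v <> 0 \/ Y v <> 0).
  { intros v Hv; apply NNPP; intros N; apply Hv, (slow_fast_inj B e He Hd);
      rewrite ?slow_origin, ?fast_origin by auto; apply NNPP; intros N'; apply N; auto. }
  assert (HYz : forall y, odd_power d y = 0 -> y = 0).
  { intros y Hy; apply (odd_power_inj d Hd0); now rewrite odd_power_0. }
  assert (HPf : forall s v, v <> (0, 0) ->
    P (flow B s v) = sc (exp (m1 * s)) (stretch (l (flow B s v) - l v) (P v))).
  { intros s v Hv; destruct (hyperbolic_flow B e He Hd s v) as [H1 H2].
    fold X Y m1 m2 in H1, H2; apply plane_eq; unfold P, sc, stretch; simpl.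
    - fold X in H2; rewrite H2.
      replace (- (l (flow B s v))) with (- (l (flow B s v) - l v) + - l v) by ring.
      rewrite exp_plus; ring.
    - rewrite H1, odd_power_mult_pos by (auto using exp_pos).
      rewrite (odd_power_pos d (exp (m2 * s)) (exp_pos _)), ln_exp.
      do 2 f_equal; unfold d; field; lra. }
  assert (HPs : forall r v, 0 < r -> v <> (0, 0) -> P (sc r v) = sc (exp (d * ln r)) (P v)).
  { intros r v Hr Hv; apply plane_eq; unfold P, sc; simpl; fold (sc r v).
    - rewrite HXs, Sl by auto.
      replace (- (l v - (d - 1) * ln r)) with (d * ln r + - ln r + - l v) by ring.
      rewrite !exp_plus, exp_Ropp, exp_ln by auto; field; lra.
    - rewrite HYs, odd_power_mult_pos, odd_power_pos by auto; auto. }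
  assert (HP0 : forall v, v <> (0, 0) -> P v <> (0, 0)).
  { intros v Hv E; unfold P in E; injection E; intros E2 E1.
    pose proof (exp_pos (- l v)).
    apply Rmult_integral in E1; destruct E1 as [E1|E1]; [|lra].
    destruct (HXY v Hv); auto. }
  (* The map [P] respects the quadrants and the axes of the eigencoordinates. *)
  assert (Hsign : forall r v w, 0 < r -> P v = sc r (P w) ->
    0 <= X v * X w /\ 0 <= Y v * Y w /\ (X v = 0 <-> X w = 0) /\ (Y v = 0 <-> Y w = 0)).
  { intros r v w Hr E; unfold P, sc in E; simpl in E; injection E; intros E2 E1.
    pose proof (exp_pos (- l v)) as H1; pose proof (exp_pos (- l w)) as H2.
    assert (Hk : 0 < r * exp (- l w) / exp (- l v)) by (apply Rdiv_lt_0_compat; nra).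
    assert (EX : X v = r * exp (- l w) / exp (- l v) * X w).
    { apply Rmult_eq_reg_r with (exp (- l v)); [|lra]; rewrite E1; field; lra. }
    set (k := r * exp (- l w) / exp (- l v)) in *.
    assert (EY : Y v = 0 <-> Y w = 0).
    { split; intros Ez; rewrite Ez, odd_power_0 in E2.
      - apply HYz; symmetry in E2; apply Rmult_integral in E2; destruct E2; auto; lra.
      - apply HYz; rewrite E2; ring. }
    split; [|split; [|split]]; auto.
    - rewrite EX; replace (k * X w * X w) with (k * (X w * X w)) by ring; nra.
    - apply Rnot_lt_le; intros Hlt.
      assert (HY0 : odd_power d (Y v) * odd_power d (Y w) < 0).
      { destruct (Rtotal_order (Y w) 0) as [h|[h|h]]; [|rewrite h in Hlt; lra|].
        - pose proof (odd_power_gt0 d (Y v) ltac:(nra)); pose proof (odd_power_gt0 d (- Y w) ltac:(lra)) as Ho.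
          rewrite odd_power_opp in Ho; nra.
        - pose proof (odd_power_gt0 d (Y w) h); pose proof (odd_power_gt0 d (- Y v) ltac:(nra)) as Ho.
          rewrite odd_power_opp in Ho; nra. }
      rewrite E2 in HY0; pose proof (Rle_0_sqr (odd_power d (Y w))) as Hsq; unfold Rsqr in Hsq; nra.
    - split; intros Ez; [|rewrite EX, Ez; ring].
      rewrite Ez in EX; symmetry in EX; apply Rmult_integral in EX; destruct EX; auto; lra. }
  (* The rays of an open quadrant form a single orbit of directions; [s] adjusts the quotient of the
     coordinates. *)
  assert (Hquad : forall v w, 0 < X v * X w -> 0 < Y v * Y w ->
    exists s rho, 0 < rho /\ v = sc rho (flow B s w)).
  { intros v w HX HY.
    assert (HXw : X w <> 0) by (intros E; rewrite E in HX; lra).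
    assert (HYw : Y w <> 0) by (intros E; rewrite E in HY; lra).
    assert (HXv : X v <> 0) by (intros E; rewrite E in HX; lra).
    assert (Ha : 0 < X v / X w).
    { replace (X v / X w) with (X v * X w / (X w * X w)) by (field; auto).
      apply Rdiv_lt_0_compat; auto; nra. }
    assert (Hb : 0 < Y v / Y w).
    { replace (Y v / Y w) with (Y v * Y w / (Y w * Y w)) by (field; auto).
      apply Rdiv_lt_0_compat; auto; nra. }
    set (s := ln (Y v / Y w / (X v / X w)) / (m2 - m1)).
    assert (Hmm : 0 < m2 - m1) by (unfold m1, m2; lra).
    assert (Hs : exp (m2 * s) = exp (m1 * s) * (Y v / Y w / (X v / X w))).
    { rewrite <- (exp_ln (Y v / Y w / (X v / X w))) by (now apply Rdiv_lt_0_compat).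
      rewrite <- exp_plus; f_equal; unfold s; field; lra. }
    pose proof (exp_pos (m1 * s)) as He1.
    exists s, (X v / X w / exp (m1 * s)); split; [now apply Rdiv_lt_0_compat|].
    destruct (hyperbolic_flow B e He Hd s w) as [H1 H2]; fold X Y m1 m2 in H1, H2.
    apply (slow_fast_inj B e He Hd); fold X Y.
    - rewrite HYs, H1, Hs; field; repeat split; auto; lra.
    - rewrite HXs, H2; field; repeat split; auto; lra. }
  (* On an axis a ray is given by a sign. In a quadrant [v] is a multiple of some [flow B s w];
     equality of the images forces the stretch, hence the change of the clock and then [s], to be
     zero. *)
  assert (Hinj : forall r v w, 0 < r -> v <> (0, 0) -> w <> (0, 0) -> P v = sc r (P w) ->
    exists r', 0 < r' /\ v = sc r' w).
  { intros r v w Hr Hv Hw0 E; destruct (Hsign r v w Hr E) as [HX [HY [EX EY]]].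
    destruct (Req_dec (X w) 0) as [HXw|HXw].
    - assert (HXv := proj2 EX HXw).
      assert (HYw : Y w <> 0) by (destruct (HXY w Hw0); tauto).
      assert (HYv : Y v <> 0) by (rewrite EY; auto).
      exists (Y v / Y w); split.
      { replace (Y v / Y w) with (Y v * Y w / (Y w * Y w)) by (field; auto).
        apply Rdiv_lt_0_compat; [|nra].
        destruct HY as [HY|HY]; auto; symmetry in HY; apply Rmult_integral in HY; tauto. }
      apply (slow_fast_inj B e He Hd); fold X Y.
      + rewrite HYs; field; auto.
      + rewrite HXs, HXv, HXw; ring.
    - assert (HXv : X v <> 0) by (rewrite EX; auto).
      assert (HX' : 0 < X v * X w).
      { destruct HX as [HX|HX]; auto; symmetry in HX; apply Rmult_integral in HX; tauto. }
      destruct (Req_dec (Y w) 0) as [HYw|HYw].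
      + assert (HYv := proj2 EY HYw).
        exists (X v / X w); split.
        { replace (X v / X w) with (X v * X w / (X w * X w)) by (field; auto).
          apply Rdiv_lt_0_compat; auto; nra. }
        apply (slow_fast_inj B e He Hd); fold X Y.
        * rewrite HYs, HYv, HYw; ring.
        * rewrite HXs; field; auto.
      + assert (HYv : Y v <> 0) by (rewrite EY; auto).
        assert (HY' : 0 < Y v * Y w).
        { destruct HY as [HY|HY]; auto; symmetry in HY; apply Rmult_integral in HY; tauto. }
        destruct (Hquad v w HX' HY') as [s [rho [Hrho Ev]]].
        assert (E' : P v = sc (exp (d * ln rho) * exp (m1 * s)) (stretch (l (flow B s w) - l w) (P w))).
        { rewrite Ev at 1; rewrite HPs, HPf, sc_sc by (auto using flow_neq0); auto. }
        rewrite E in E'; unfold sc, stretch in E'; simpl in E'; injection E'; intros E2 E1.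
        set (k := exp (d * ln rho) * exp (m1 * s)) in *.
        assert (Hok : r = k).
        { apply Rmult_eq_reg_r with (odd_power d (Y w)); auto. }
        assert (Hx1 : exp (- (l (flow B s w) - l w)) = 1).
        { apply Rmult_eq_reg_l with (r * (X w * exp (- l w))).
          - rewrite Rmult_1_r; rewrite E1 at 2; rewrite <- Hok; ring.
          - pose proof (exp_pos (- l w)).
            repeat apply Rmult_integral_contrapositive_currified; auto; lra. }
        rewrite <- exp_0 in Hx1; apply exp_inv in Hx1.
        assert (Hs0 : s = 0).
        { apply (log_clock_inj B l (d - 1) w); auto; rewrite flow_0; lra. }
        exists rho; split; auto; rewrite Ev, Hs0, flow_0; auto. }
  apply (angular_conjugate P); auto.
  - intros v Hv; unfold P; apply cont_pair.
    + apply cont_mul; [apply (cont_fast B e He (fun v => v)), continuous_id|].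
      apply cont_exp, cont_opp, Cl, Hv.
    + apply (cont_real (odd_power d) Y); [apply (cont_slow B e He (fun v => v)), continuous_id|].
      now apply cont_odd_power.
  - intros r v Hr Hv; exists (exp (d * ln r)); split; [apply exp_pos|now apply HPs].
  - intros [x y] Hu.
    destruct (slow_fast_surj B e He Hd y x) as [v [Hv2 Hv1]]; fold Y in Hv2; fold X in Hv1.
    assert (Hv : v <> (0, 0)).
    { intros E; apply Hu; rewrite E in Hv1, Hv2; unfold X, Y in *.
      rewrite fast_origin in Hv1 by auto; rewrite slow_origin in Hv2 by auto; congruence. }
    pose proof (exp_pos (- l v)) as Hel.
    destruct (Req_dec y 0) as [Hy|Hy].
    { exists (exp (- l v)), v; split; [auto|split; [auto|]].
      unfold P; rewrite Hv1, Hv2, Hy, odd_power_0; apply plane_eq; unfold sc; simpl; ring. }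
    set (k := odd_power d y / y).
    assert (Hk : 0 < k).
    { unfold k; destruct (Rtotal_order y 0) as [h|[h|h]]; [|tauto|].
      - replace (odd_power d y / y) with (odd_power d (- y) / (- y)) by (rewrite odd_power_opp; field; auto).
        apply Rdiv_lt_0_compat; [apply odd_power_gt0|]; lra.
      - apply Rdiv_lt_0_compat; auto; now apply odd_power_gt0. }
    (* The image of [v] has the factors [exp (- l v)] and [k] on the coordinates of the target; the
       shift is chosen so that the stretch makes both equal to [k]. *)
    destruct (Ol v (l v - ln (k / exp (- l v))) Hv) as [s Hs].
    exists (exp (m1 * s) * k), (flow B s v).
    split; [apply Rmult_lt_0_compat; auto using exp_pos|split; [now apply flow_neq0|]].
    rewrite HPf, Hs by auto.
    replace (l v - ln (k / exp (- l v)) - l v) with (- ln (k / exp (- l v))) by ring.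
    apply plane_eq; unfold sc, stretch, P; simpl; rewrite ?Ropp_involutive, Hv1 || rewrite Hv2.
    + rewrite exp_ln by (now apply Rdiv_lt_0_compat); field; lra.
    + unfold k; field; auto.
  - intros a b p q sigma; apply model_rel_ray.
  - intros p q sigma Hp Hq; simpl; split.
    + intros [s [rho [Hrho [-> E]]]].
      exists (exp (d * ln rho) * exp (m1 * s)); split; [apply Rmult_lt_0_compat; apply exp_pos|].
      rewrite HPs, HPf, sc_sc by (auto using flow_neq0); f_equal; f_equal; lra.
    + intros [rho [Hrho E]].
      destruct (Ol p (l p + sigma) Hp) as [s Hs].
      pose proof (exp_pos (m1 * s)) as He1.
      destruct (Hinj (rho / exp (m1 * s)) q (flow B s p)) as [r' [Hr' Eq]];
        auto using flow_neq0.
      * now apply Rdiv_lt_0_compat.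
      * rewrite HPf, sc_sc, Hs, E by auto; f_equal; [field; lra|f_equal; ring].
      * exists s, r'; auto.
Qed.

Lemma algebraic_model (T : portrait_type) :
  algebraic_type T B -> conjugate (same_orbit disc_field) (disc_rel (model_rel T)).
Proof.
  intros HT; destruct T; simpl in HT.
  - now apply limit_cycle_model.
  - now apply four_equilibria_model.
  - destruct HT as [Hd [e He]]; now apply saddle_node_model with (e := e).
  - now apply circle_of_equilibria_model.
Qed.

End NormalForms.

(** * Reduction to positive [phi] and negative definite [B] *)

Definition opp_matrix (B : @matrix R 2 2) : @matrix R 2 2 :=
  mk_matrix 2 2 (fun i j => - coeff_mat 0 B i j).

Lemma mat_app_opp (B : @matrix R 2 2) (v : plane) : mat_app (opp_matrix B) v = sc (-1) (mat_app B v).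
Proof.
  unfold mat_app, opp_matrix; rewrite !coeff_mat_bij by lia.
  apply plane_eq; unfold sc; simpl; ring.
Qed.

Lemma nonlinearity_opp (B : @matrix R 2 2) (phi : plane -> R) :
  nonlinearity (opp_matrix B) (fun v => - phi v) = nonlinearity B phi.
Proof.
  apply functional_extensionality; intros v.
  change (sc (- phi v) (mat_app (opp_matrix B) v) = sc (phi v) (mat_app B v)).
  rewrite mat_app_opp, sc_sc; apply (f_equal (fun r => sc r (mat_app B v))); ring.
Qed.

(** The fields depend on [phi] and [B] only through [nonlinearity], which is
    unchanged when both change sign. *)
Lemma positive_representative (B : @matrix R 2 2) (n : nat) (phi : plane -> R) :
  homogeneous_poly (2 * n) phi -> opposite_sign phi B ->
  exists B' phi', homogeneous_poly (2 * n) phi' /\ positive_definite phi' /\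
    negative_definite (quad_form B') /\
    forall lambda, poincare_field lambda B phi n = poincare_field lambda B' phi' n /\
      forall T, has_type T lambda B phi n = has_type T lambda B' phi' n.
Proof.
  intros Hh [[Hp HB]|[Hp HB]].
  - exists B, phi; repeat split; auto.
  - exists (opp_matrix B), (fun v => - phi v); split; [|split; [|split]].
    + destruct Hh as [c Hc]; exists (fun i => - c i); intros x y; rewrite Hc.
      rewrite <- (Rmult_1_l (sum_f_R0 _ _)), <- Ropp_mult_distr_l_reverse, scal_sum.
      apply sum_eq; intros i _; ring.
    + intros v Hv; specialize (Hp v Hv); lra.
    + intros v Hv; specialize (HB v Hv); unfold quad_form in *; rewrite mat_app_opp.
      set (w := mat_app B v) in *; clearbody w; unfold dot, sc in *; simpl in *; lra.
    + intros lambda.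
      assert (Hv : vector_field lambda B phi = vector_field lambda (opp_matrix B) (fun v => - phi v)).
      { unfold vector_field; now rewrite nonlinearity_opp. }
      assert (Hd : poincare_field lambda B phi n = poincare_field lambda (opp_matrix B) (fun v => - phi v) n).
      { unfold poincare_field; now rewrite nonlinearity_opp. }
      assert (Ha : angular B phi = angular (opp_matrix B) (fun v => - phi v)).
      { unfold angular; now rewrite nonlinearity_opp. }
      split; auto; intros T; unfold has_type; now rewrite Hv, Hd, Ha.
Qed.

Theorem proposition6p1 :
  forall (lambda : R) (B : @matrix R 2 2) (n : nat) (phi : plane -> R),
    0 < lambda -> (1 <= n)%nat -> homogeneous_poly (2 * n) phi -> opposite_sign phi B ->
    exists T : portrait_type,
      has_type T lambda B phi n /\
      forall (lambda' : R) (B' : @matrix R 2 2) (n' : nat) (phi' : plane -> R),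
        0 < lambda' -> (1 <= n')%nat -> homogeneous_poly (2 * n') phi' ->
        opposite_sign phi' B' ->
        has_type T lambda' B' phi' n' ->
        same_phase_portrait poincare_disc (poincare_field lambda B phi n)
          (poincare_field lambda' B' phi' n').
Proof.
  intros lambda B n phi Hlam Hn Hh Ho.
  destruct (positive_representative B n phi Hh Ho) as [B1 [phi1 [Hh1 [Hp1 [HB1 E1]]]]].
  destruct (E1 lambda) as [Ed1 Et1].
  destruct (algebraic_type_exists B1) as [T HT]; exists T; split.
  { rewrite Et1; now apply algebraic_has_type. }
  intros lambda' B' n' phi' Hlam' Hn' Hh' Ho' Htype.
  destruct (positive_representative B' n' phi' Hh' Ho') as [B2 [phi2 [Hh2 [Hp2 [HB2 E2]]]]].
  destruct (E2 lambda') as [Ed2 Et2].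
  (* The portrait of the second system determines the type of its matrix, so both discs are
     conjugate to the same [model_rel T]. *)
  rewrite Et2 in Htype; apply has_type_algebraic in Htype; auto.
  rewrite Ed1, Ed2.
  apply (conjugate_trans _ (disc_rel (model_rel T))).
  - now apply algebraic_model.
  - apply conjugate_sym; now apply algebraic_model.
Qed.
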